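(* Let $v,k$ be integers with $k\ge2$, $v-k\ge2$, let $d=\binom v2$, and let $D_1,D_2$ be as in the context. Suppose $0<\delta < k^{-2} \binom{v}{k}^{-2} \left[ \frac{1}{6 \cdot 96^2} \left( \frac{2 \pi}{k-1} \right)^4 \right]$, and let $t \geq 2$ be an integer with $t < 2 (d \delta)^{-3}$. Then: (1) if $t \frac{k(k-1)}{v(v-1)}\notin\mathbb Z$, then $\mathbb{P}_{v,k}^{(t)}(\vec 0, \vec 0) = 0$; (2) if $t \frac{k(k-1)}{v(v-1)}\in\mathbb Z$ but $t \frac{k}{v}\notin\mathbb Z$, then $\mathbb{P}_{v,k}^{(t)}(\vec 0, \vec 0) \leq \exp \left( - \binom{v}{k}^{-1} \frac{11}{768} t \delta^2 \right)$; (3) if both $t \frac{k(k-1)}{v(v-1)}$ and $t\frac{k}{v}$ are integers, then \[ \mathbb{P}_{v,k}^{(t)}(\vec 0, \vec 0) \leq \frac{(k-1)^{v-1}}{\sqrt{(2 \pi t)^{d-1} \det(M)}} U(v , k, t, \delta) + e^{- \binom{v}{k}^{-1} \frac{11}{768} t \delta^2}\] and \[ \mathbb{P}_{v,k}^{(t)}(\vec 0, \vec 0) \geq\frac{(k-1)^{v-1}}{\sqrt{(2 \pi t)^{d-1} \det(M)}} L(v , k, t, \delta) - e^{- \binom{v}{k}^{-1} \frac{11}{768} t \delta^2}. \]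
   Context: Coordinates of $\mathbb R^d$ are indexed by the 2-element subsets $\{i,j\}$ of $\{1,\dots,v\}$ (in lexicographic order). $V_{v,k}$ is the set of vectors in $\mathbb R^v$ with entries in $\{0,1\}$ having exactly $k$ ones; $Z:V_{v,k}\to\mathbb R^d$ is $Z(\vec y)_{\{i,j\}}=y_iy_j$; $\vec 1$ is the all-ones vector. Let $\vec\xi^{(1)},\vec\xi^{(2)},\dots$ be i.i.d. uniform on $V_{v,k}$ and $Y_t=\sum_{s=1}^t\big(Z(\vec\xi^{(s)})-\frac{k(k-1)}{v(v-1)}\vec 1\big)$; $\mathbb{P}_{v,k}^{(t)}(\vec 0,\vec 0)$ denotes $\mathbb P(Y_t=\vec 0)$. For $1\le j\le v$ let $C_j=\prod_{i=0}^{j-1}(k-i)/\prod_{i=0}^{j-1}(v-i)$. Let $N$ be the $d\times d$ matrix indexed by pairs of 2-subsets with $N_{\{a,b\},\{c,e\}}=C_2-C_2^2$, $C_3-C_2^2$, or $C_4-C_2^2$ according as $|\{a,b\}\cap\{c,e\}|$ equals $2$, $1$, or $0$. Let $M$ be the $(d-1)\times(d-1)$ principal submatrix of $N$ obtained by deleting the row and column indexed by $\{v-1,v\}$. $M$ is symmetric positive definite; let $P$ be its symmetric positive definite square root. Let $D_1,D_2>0$ be constants (depending only on $v,k$) such that for all $\delta>0$, $[-D_1\delta,D_1\delta]^{d-1}\subset P[-\delta,\delta]^{d-1}\subset[-D_2\delta,D_2\delta]^{d-1}$, where $P[-\delta,\delta]^{d-1}=\{P\vec\mu:\ |\mu_{\{i,j\}}|<\delta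 \text{ for all } \{i,j\}\}$. Define \[ L(v, k, t, \delta) = [1 + t^2(d \delta)^6]^{-1/2} \left[ 1 - \tfrac{1}{3}(d \delta)^4 \right]^t [1 - e^{-\frac{1}{2} t (D_1\delta)^2}]^{(d-1)/2},\] \[ U(v, k, t, \delta) = \left[ 1 + \tfrac{1}{4}(d \delta)^6 \right]^{t/2} \left[ 1 + \tfrac{1}{3} ( d \delta)^4 \right]^t [1 - e^{- t (2 D_2 \delta)^2}]^{(d-1)/2}.\] *)

(* Defs.v *)
From HB Require Import structures.
From mathcomp Require Import all_boot all_order all_algebra.
From mathcomp Require Import finmap.
From mathcomp Require Import all_classical all_reals all_analysis.

Set Implicit Arguments.
Unset Strict Implicit.
Unset Printing Implicit Defensive.

Import Order.TTheory GRing.Theory Num.Theory.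
Local Open Scope classical_set_scope.
Local Open Scope ring_scope.

(* The 2-subsets {i, j} of 'I_v, each written as the ordered pair (i, j) with
   i < j, in lexicographic order. They index the coordinates of R^d. *)
Definition lex_pairs (v : nat) : seq ('I_v * 'I_v) :=
  [seq p : 'I_v * 'I_v <- [seq (i, j) | i <- enum 'I_v, j <- enum 'I_v]
  | (p.1 < p.2)%N].

Lemma size_lex_pairs (v : nat) : size (lex_pairs v) == 'C(v, 2).
Proof.
rewrite /lex_pairs size_filter count_flatten -map_comp sumnE big_map big_enum /=.
rewrite -bin2_sum big_nat_rev /= add0n big_mkord.
apply/eqP/eq_bigr => i _ /=; rewrite count_map.
rewrite (@eq_count _ _ (preim val (fun j : nat => (i < j)%N))) //.
rewrite -count_map val_enum_ord -size_filter.
have -> : iota 0 v = iota 0 i.+1 ++ iota i.+1 (v - i.+1).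
  by rewrite -[X in iota X (v - _)]add0n -iotaD subnKC.
rewrite size_filter count_cat.
rewrite [X in (X + _)%N](_ : _ = 0%N) ?add0n.
  have : all (fun j => (i < j)%N) (iota i.+1 (v - i.+1)).
    by apply/allP => j; rewrite mem_iota => /andP[].
  by rewrite all_count => /eqP ->; rewrite size_iota.
apply/eqP; rewrite -leqn0 leqNgt -has_count; apply/hasPn => j.
by rewrite mem_iota add0n ltnS /= -leqNgt.
Qed.

Definition lex_pair (v : nat) (a : 'I_('C(v, 2))) : 'I_v * 'I_v :=
  tnth (Tuple (size_lex_pairs v)) a.

Definition edge (v : nat) (a : 'I_('C(v, 2))) : {set 'I_v} :=
  [set (lex_pair a).1; (lex_pair a).2].

(* V_{v,k} *)
Definition kvectors (R : realType) (v k : nat) : set 'cV[R]_v :=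
  [set y : 'cV[R]_v | (forall i, y i 0 = 0 \/ y i 0 = 1) /\
           #|[set i : 'I_v | y i 0 == 1]%SET| = k].

Arguments kvectors R v k : clear implicits.

Definition Zmap (R : realType) (v : nat) (y : 'cV[R]_v) : 'cV[R]_('C(v, 2)) :=
  \col_a (y (lex_pair a).1 0 * y (lex_pair a).2 0).

(* A sequence of random elements of the finite set V, which carries the
   discrete sigma-algebra: mutually independent and uniform on V. *)
Definition iid_uniform (R : realType) (disp : measure_display)
    (T : measurableType disp) (Pr : probability T R) (S : choiceType)
    (V : set S) (xi : nat -> T -> S) : Prop :=
  [/\ forall s w, V (xi s w),
      forall s (A : set S), measurable (xi s @^-1` A),
      forall s y, V y ->
        Pr (xi s @^-1` [set y]) = (#|` fset_set V|%:R^-1)%:E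
    & forall (J : {fset nat}) (A : nat -> set S),
        Pr (\bigcap_(s in [set` J]) (xi s @^-1` A s)) =
        (\prod_(s <- J) Pr (xi s @^-1` A s))%E].

(* Y_t; the vectors are numbered from 0 instead of 1. *)
Definition walk (R : realType) (T : Type) (v k : nat)
    (xi : nat -> T -> 'cV[R]_v) (t : nat) (w : T) : 'cV[R]_('C(v, 2)) :=
  \sum_(s < t) (Zmap (xi s w) -
                const_mx ((k%:R * (k%:R - 1)) / (v%:R * (v%:R - 1)))).

Definition Ccoef (R : realType) (v k j : nat) : R :=
  (\prod_(i < j) (k%:R - i%:R)) / (\prod_(i < j) (v%:R - i%:R)).

Definition Nmx (R : realType) (v k : nat) : 'M[R]_('C(v, 2)) :=
  \matrix_(a, b)
    ((if #|edge a :&: edge b| == 2%N then Ccoef R v k 2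
      else if #|edge a :&: edge b| == 1%N then Ccoef R v k 3
      else Ccoef R v k 4) - Ccoef R v k 2 ^+ 2).

(* The deleted last index is that of {v-1, v}, by last_lex_pairs below. *)
Definition Mmx (R : realType) (v k : nat) : 'M[R]_(('C(v, 2)).-1) :=
  mxsub (widen_ord (leq_pred _)) (widen_ord (leq_pred _)) (Nmx R v k).

Lemma last_lex_pairs (n : nat) (p0 : 'I_n.+2 * 'I_n.+2) :
  last p0 (lex_pairs n.+2) = (inord n, ord_max).
Proof.
pose a : 'I_n.+2 := inord n; pose b : 'I_n.+2 := ord_max.
have va : a = n :> nat by rewrite inordK.
have [s Es] : exists s, enum 'I_n.+2 = s ++ [:: a; b].
  exists (map (widen_ord (leqnSn _)) (map (widen_ord (leqnSn _)) (enum 'I_n))).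
  rewrite !enum_ordSr map_rcons -!cats1 -catA /=; congr (_ ++ [:: _; _]).
  by apply/val_inj; rewrite /= -/a va.
rewrite /lex_pairs {2}Es map_cat flatten_cat filter_cat /= cats0 filter_cat.
have -> : [seq p : 'I_n.+2 * 'I_n.+2 <- [seq (b, j) | j <- enum 'I_n.+2] | (p.1 < p.2)%N] = [::].
  apply/eqP; rewrite -(negbK (_ == _)) -has_filter; apply/hasPn => _ /mapP[j _ ->].
  by rewrite /= -leqNgt -ltnS.
by rewrite cats0 Es map_cat filter_cat /= va ltnn ltnSn /= !last_cat.
Qed.

Definition posdefmx (R : realType) (n : nat) (A : 'M[R]_n) : Prop :=
  A^T = A /\ forall x : 'cV[R]_n, x != 0 -> 0 < (x^T *m A *m x) 0 0.

Definition cube (R : realType) (n : nat) (c : R) : set 'cV[R]_n :=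
  [set x | forall i, - c <= x i 0 <= c].

Definition open_cube (R : realType) (n : nat) (c : R) : set 'cV[R]_n :=
  [set x | forall i, `|x i 0| < c].

Arguments cube {R} n c.
Arguments open_cube {R} n c.

(* D1 is the constant D_1 attached to (v, k), through which L depends on k. *)
Definition lower_factor (R : realType) (v t : nat) (D1 delta : R) : R :=
  let d := 'C(v, 2) in
  (1 + t%:R ^+ 2 * (d%:R * delta) ^+ 6) `^ (- 2^-1) *
  (1 - 3^-1 * (d%:R * delta) ^+ 4) ^+ t *
  (1 - expR (- (2^-1 * t%:R * (D1 * delta) ^+ 2))) `^ ((d%:R - 1) / 2).

(* D2 is the constant D_2 attached to (v, k), through which U depends on k. *)
Definition upper_factor (R : realType) (v t : nat) (D2 delta : R) : R :=
  let d := 'C(v, 2) in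
  (1 + 4^-1 * (d%:R * delta) ^+ 6) `^ (t%:R / 2) *
  (1 + 3^-1 * (d%:R * delta) ^+ 4) ^+ t *
  (1 - expR (- (t%:R * (2 * D2 * delta) ^+ 2))) `^ ((d%:R - 1) / 2).

(* Main.v *)
(** The number of visits of a walk to the pairs through a point i is k-1 times
    the number of steps whose k-set contains i; hence a return to 0 at time t
    forces both t k(k-1)/(v(v-1)) and t k/v to be integers, and in cases (1) and
    (2) the event is empty.

    In case (3) the number of returning walks is a Fourier average of phi^t, phi
    being the characteristic function of one step, over a discrete torus
    (Z/m)^(d-1), where m > t is a large multiple of k-1. The function phi^t is
    invariant under translation by the (k-1)^(v-1) peaks with coordinates
    2 pi (p_i + p_j - p_{v-1}) / (k-1), where p_v = 0, and the boxes of radius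
    delta around the peaks are disjoint. Outside all boxes the phases of some
    two k-sets differ by at least delta/4 modulo 2 pi (otherwise second
    differences of phases would put the point near a peak), so that |phi| is
    bounded away from 1. Inside the box around 0, Taylor expansion compares
    phi^t with exp(-t <x, Mx>/2).

    As m tends to infinity, the Gaussian Riemann sums are evaluated in the
    coordinates P x, P^2 = M. An LUP decomposition writes P as a product of
    permutations, shears and a diagonal matrix, and a shear becomes a bijection
    of the torus once its translations are rounded to the mesh; so no
    multidimensional integral is needed. The one-dimensional integral F over
    [0, x] of exp(-u^2) satisfies
    (pi/4)(1 - exp(-x^2)) <= F^2 <= (pi/4)(1 - exp(-2x^2)), because the
    differences vanish at 0 and at infinity and their derivatives change sign
    at most once. *)
Require Import Defs.
From HB Require Import structures.
From mathcomp Require Import all_boot all_order all_algebra.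
From mathcomp Require Import finmap.
From mathcomp Require Import all_classical all_reals all_analysis.
From mathcomp Require Import fingroup perm.
From mathcomp Require Import complex ring lra zify.

Set Implicit Arguments.
Unset Strict Implicit.
Unset Printing Implicit Defensive.

Import Order.TTheory GRing.Theory Num.Theory.
Import numFieldNormedType.Exports.
Local Open Scope classical_set_scope.
Local Open Scope ring_scope.

(** * Riemann sums on a discrete torus *)

(** The obstacle is that the Gaussian main term lives on a parallelepiped, the preimage of a cube
    under P, whereas the Fourier average lives on a cubic mesh. Lipschitz cutoffs of the cube in the
    coordinates P x mediate between the two: D_1 places the support of a cutoff inside the box of
    radius delta, and D_2 makes another cutoff equal to 1 on that box. The number of returning walks
    does not depend on m, so m may grow for fixed t and delta until the errors of the Riemann sums
    disappear. The condition m > t turns a congruence of visit numbers modulo m into an equality;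
    divisibility by k-1 puts the peaks on the mesh, so that translation by a peak permutes the
    torus. One pair may be deleted because the total number of visits depends on t alone; the
    summand - p_{v-1} of a peak makes its coordinate at the deleted pair {v-1, v} vanish. Away from
    the peaks a single pair of k-sets with separated phases is exploited. It gains 11/768 delta^2
    among binom(v, k) unit vectors, whence the inverse binomial in the exponent. *)

Section Torus.
Variable N : nat.
Implicit Types (x y : 'I_N.+2) (z w : int).

(** The modulus has the form [N.+2] so that the ordinals form the ring Z/(N+2) and [z%:~R] is
    reduction modulo N+2. *)
Lemma eq_intr_ord z w : (z%:~R == w%:~R :> 'I_N.+2) = (N.+2 %| z - w)%Z.
Proof.
rewrite -subr_eq0 -intrB; move: (z - w) => {z w} z.
have natE (n : nat) : (n%:R == 0 :> 'I_N.+2) = (N.+2 %| n)%N.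
  by rewrite Zp_nat -val_eqE.
by case: z => n; rewrite dvdzE ?NegzE ?mulrNz ?oppr_eq0 ?pmulrn natE ?abszN.
Qed.

(* The representative of the residue x of least absolute value. *)
Definition cent x : int := if (x.*2 <= N.+2)%N then x%:Z else x%:Z - N.+2%:Z.

Lemma centK x : (cent x)%:~R = x.
Proof.
have -> : (cent x)%:~R = (x%:Z)%:~R :> 'I_N.+2.
  rewrite /cent; case: ifP => // _; apply/eqP.
  by rewrite eq_intr_ord addrAC subrr add0r dvdzE abszN dvdnn.
by rewrite -pmulrn natr_Zp.
Qed.

Lemma cent_le x : `|cent x| * 2 <= N.+2%:Z.
Proof. by rewrite /cent; case: ifP => h; have := ltn_ord x; lia. Qed.

(** The strict inequality excludes half the modulus, where two representatives have the same
    absolute value. *)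
Lemma cent_intr z : `|z| * 2 < N.+2%:Z -> cent z%:~R = z.
Proof.
move=> hz; have := centK z%:~R => /eqP; rewrite eq_intr_ord => /dvdzP[q hq].
have := cent_le z%:~R; move: (cent _) hq => c hq hc.
have : q = 0 by nia.
lia.
Qed.

Lemma cent_add x z : exists e : int, cent (x + z%:~R) = cent x + z + e * N.+2%:Z.
Proof.
have : ((cent (x + z%:~R))%:~R == (cent x + z)%:~R :> 'I_N.+2).
  by rewrite centK intrD centK.
rewrite eq_intr_ord => /dvdzP[e he]; exists e; rewrite -he; lia.
Qed.

End Torus.

Section RiemannSums.
Variables (R : realType) (n : nat).
Implicit Types (f g : 'cV[R]_n -> R) (A B : 'M[R]_n) (h : R) (N : nat).

Definition mesh_point h N (j : {ffun 'I_n -> 'I_N.+2}) : 'cV[R]_n :=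
  \col_a (h * (cent (j a))%:~R).

(** The step h and the modulus are independent: the mesh fills a box of width [h * N.+2] centred at
    0. *)
Definition riemann_sum h N f : R :=
  h ^+ n * \sum_(j : {ffun 'I_n -> 'I_N.+2}) f (mesh_point h j).

Definition supported_in (b : R) f :=
  forall x : 'cV[R]_n, (exists i, b < `|x i 0|) -> f x = 0.

Definition sup_lipschitz (c : R) f :=
  forall (x y : 'cV[R]_n) (e : R), (forall i, `|x i 0 - y i 0| <= e) ->
  `|f x - f y| <= c * e.

Definition tame f := exists b c, [/\ 0 <= b, 0 <= c, supported_in b f & sup_lipschitz c f].

Definition shear_mx (i : 'I_n) (l : 'rV[R]_n) : 'M[R]_n :=
  1%:M + delta_mx i 0 *m l.

Lemma shear_mxE i l (x : 'cV[R]_n) a :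
  (shear_mx i l *m x) a 0 = x a 0 + (a == i)%:R * (l *m x) 0 0.
Proof.
rewrite mulmxDl mul1mx -mulmxA !mxE; congr (_ + _).
by rewrite big_ord1 !mxE eqxx andbT.
Qed.

(* Rounding the translation [l *m x] down to the mesh turns the shear into a
   permutation of the torus, so that only the rounding error (at most h in one
   coordinate) has to be paid for. *)
Lemma riemann_sum_shear f i (l : 'rV[R]_n) b c h N :
  l 0 i = 0 -> 0 <= b -> 0 <= c -> 0 < h ->
  supported_in b f -> sup_lipschitz c f ->
  2 * (b + (\sum_a `|l 0 a|) * b + h) < h * N.+2%:R ->
  `|riemann_sum h N (fun x => f (shear_mx i l *m x)) - riemann_sum h N f|
     <= (h * N.+2%:R) ^+ n * (c * h).
Proof.
move=> li b0 c0 h0 sf lf hN.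
pose p (j : {ffun 'I_n -> 'I_N.+2}) : int :=
  Num.floor (\sum_a l 0 a * (cent (j a))%:~R).
pose s (j : {ffun 'I_n -> 'I_N.+2}) : {ffun 'I_n -> 'I_N.+2} :=
  [ffun a => if a == i then j a + (p j)%:~R else j a].
(* The map [s] changes only the coordinate i, on which [p] does not depend; so the translation can
   be read off its result and undone. *)
have pE j : p (s j) = p j.
  congr (Num.floor _); apply: eq_bigr => a _; rewrite ffunE.
  by case: eqP => [->|//]; rewrite li !mul0r.
have s_inj : injective s.
  move=> j j' e; apply/ffunP => a.
  have := congr1 p e; rewrite !pE => pe.
  have := congr1 (fun u : {ffun 'I_n -> 'I_N.+2} => u a) e.
  by rewrite !ffunE pe; case: eqP => // _ /addIr.
rewrite /riemann_sum -mulrBr [X in _ - X](reindex_inj s_inj) /= -sumrB.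
rewrite normrM ger0_norm ?exprn_ge0 ?(ltW h0)// exprMn -mulrA.
apply: ler_wpM2l; first by rewrite exprn_ge0 ?(ltW h0).
apply: (le_trans (ler_norm_sum _ _ _)).
have -> : N.+2%:R ^+ n * (c * h) = \sum_(j : {ffun 'I_n -> 'I_N.+2}) (c * h).
  by rewrite sumr_const card_ffun !card_ord -natrX mulr_natl.
apply: ler_sum => j _.
set x := mesh_point h j; set x' := mesh_point h (s j).
have xE a : x a 0 = h * (cent (j a))%:~R by rewrite mxE.
have x'E a : a != i -> x' a 0 = x a 0.
  by move=> ai; rewrite !mxE ffunE (negPf ai).
(* A large coordinate other than i is shared by both points and puts them outside the support. *)
have [a /andP[ai xa]|small] := pickP (fun a => (a != i) && (b < `|x a 0|)).
  rewrite !sf ?subrr ?normr0 ?mulr_ge0 ?(ltW h0)//.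
    by exists a; rewrite x'E.
  by exists a; rewrite shear_mxE (negPf ai) mul0r addr0.
have lx : `|(l *m x) 0 0| <= (\sum_a `|l 0 a|) * b.
  rewrite mxE; apply: (le_trans (ler_norm_sum _ _ _)); rewrite mulr_suml.
  apply: ler_sum => a _; rewrite normrM.
  have [->|ai] := eqVneq a i; first by rewrite li normr0 !mul0r.
  by apply: ler_wpM2l => //; rewrite leNgt; have := small a; rewrite ai /= => ->.
have lxE : (l *m x) 0 0 = h * \sum_a l 0 a * (cent (j a))%:~R.
  by rewrite mxE mulr_sumr; apply: eq_bigr => a _; rewrite xE mulrCA.
have hp : `|(l *m x) 0 0 - h * (p j)%:~R| <= h.
  rewrite lxE -mulrBr normrM (gtr0_norm h0) ler_piMr ?(ltW h0)//.
  have := floor_itv (\sum_a l 0 a * (cent (j a))%:~R) => /andP[].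
  rewrite -/(p j) intrD ler_norml => h1 h2.
  by apply/andP; split; lra.
have [e he] := cent_add (j i) (p j).
have x'i : x' i 0 = x i 0 + h * (p j)%:~R + e%:~R * (h * N.+2%:R).
  by rewrite !mxE ffunE eqxx he !intrD intrM; lra.
have xi2 : `|x i 0| * 2 <= h * N.+2%:R.
  rewrite xE normrM (gtr0_norm h0) -mulrA ler_pM2l// -intr_norm.
  by have := cent_le (j i); rewrite -(ler_int R) intrM.
have x'i2 : `|x' i 0| * 2 <= h * N.+2%:R.
  rewrite mxE normrM (gtr0_norm h0) -mulrA ler_pM2l// -intr_norm.
  by have := cent_le (s j i); rewrite -(ler_int R) intrM.
have Axi : (shear_mx i l *m x) i 0 = x i 0 + (l *m x) 0 0.
  by rewrite shear_mxE eqxx mul1r.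
(* Without wrap-around the two points are within h of each other. With wrap-around, the width of the
   box forces the coordinate i of both beyond b, and both values vanish. *)
have [e0|e0] := eqVneq e 0.
  apply: lf => a; have [->|ai] := eqVneq a i.
    rewrite Axi x'i e0 mul0r addr0.
    by rewrite [X in `|X|](_ : _ = (l *m x) 0 0 - h * (p j)%:~R) //; ring.
  by rewrite shear_mxE (negPf ai) mul0r addr0 x'E// subrr normr0 ltW.
have e1 : h * N.+2%:R <= `|e%:~R * (h * N.+2%:R)|.
  rewrite normrM -intr_norm [leRHS]mulrC (ger0_norm (_ : 0 <= h * _)).
    by rewrite ler_peMr ?mulr_ge0 ?(ltW h0)// ler1z; lia.
  by rewrite mulr_ge0 ?(ltW h0).
have e2 : e%:~R * (h * N.+2%:R) = x' i 0 - x i 0 - h * (p j)%:~R.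
  by rewrite x'i; ring.
move: e1; rewrite e2 => e1.
have n1 := ler_normB (x' i 0 - x i 0) (h * (p j)%:~R).
have n2 := ler_normB (x' i 0) (x i 0).
have n3 := lerB_dist (h * (p j)%:~R) ((l *m x) 0 0).
have n4 : `|(l *m x) 0 0 - h * (p j)%:~R| = `|h * (p j)%:~R - (l *m x) 0 0|.
  by rewrite distrC.
rewrite !sf ?subrr ?normr0 ?mulr_ge0 ?(ltW h0)//; first by exists i; lra.
exists i; rewrite Axi.
have n6 := ler_normB (x' i 0) (x i 0 + h * (p j)%:~R).
have n7 := ler_normB (x i 0 + (l *m x) 0 0) ((l *m x) 0 0 - h * (p j)%:~R).
have n8 : x i 0 + (l *m x) 0 0 - ((l *m x) 0 0 - h * (p j)%:~R) = x i 0 + h * (p j)%:~R by ring.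
rewrite n8 in n7.
have n9 : x' i 0 - (x i 0 + h * (p j)%:~R) = x' i 0 - x i 0 - h * (p j)%:~R by ring.
rewrite n9 in n6.
have l0 : 0 <= (\sum_a `|l 0 a|) * b by rewrite mulr_ge0 ?sumr_ge0.
lra.
Qed.

End RiemannSums.

(** * Linear maps that preserve Riemann sums in the limit *)

Section LinearChange.
Variables (R : realType) (n : nat).
Implicit Types (f g : 'cV[R]_n -> R) (A B : 'M[R]_n).

(* Along meshes of step h covering a box of width between w and 2 w, the two
   Riemann sums have the same behaviour as h tends to 0. *)
Definition riemann_close f g := exists2 w0 : R, 0 < w0 & forall w e : R,
  w0 <= w -> 0 < e -> exists2 h0 : R, 0 < h0 & forall (h : R) (N : nat),
    0 < h < h0 -> w <= h * N.+2%:R <= 2 * w ->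
    `|riemann_sum h N f - riemann_sum h N g| <= e.

Lemma riemann_close_refl f : riemann_close f f.
Proof.
exists 1 => // w e _ e0; exists 1 => // h N _ _.
by rewrite subrr normr0 ltW.
Qed.

Lemma riemann_close_trans f g k :
  riemann_close f g -> riemann_close g k -> riemann_close f k.
Proof.
move=> [w1 w10 H1] [w2 w20 H2]; exists (Num.max w1 w2).
  by rewrite lt_max w10.
move=> w e; rewrite ge_max => /andP[ww1 ww2] e0.
have e20 : 0 < e / 2 by rewrite divr_gt0.
have [h1 h10 K1] := H1 w _ ww1 e20; have [h2 h20 K2] := H2 w _ ww2 e20.
exists (Num.min h1 h2); first by rewrite lt_min h10.
move=> h N; rewrite lt_min => /andP[h0 /andP[hh1 hh2]] hN.
have := K1 h N; rewrite h0 hh1 => /(_ isT hN) k1.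
have := K2 h N; rewrite h0 hh2 => /(_ isT hN) k2.
have -> : riemann_sum h N f - riemann_sum h N k = (riemann_sum h N f - riemann_sum h N g) +
  (riemann_sum h N g - riemann_sum h N k) by ring.
by apply: (le_trans (ler_normD _ _)); lra.
Qed.

Lemma mulmx_coord_le A (x : 'cV[R]_n) (e : R) i :
  (forall j, `|x j 0| <= e) -> `|(A *m x) i 0| <= (\sum_i \sum_j `|A i j|) * e.
Proof.
move=> hx.
have e0 : 0 <= e by apply: le_trans (hx i).
rewrite mxE; apply: (le_trans (ler_norm_sum _ _ _)).
apply: (@le_trans _ _ ((\sum_j `|A i j|) * e)).
  rewrite mulr_suml; apply: ler_sum => j _; rewrite normrM.
  exact: ler_wpM2l.
apply: ler_wpM2r => //; rewrite [leRHS](bigD1 i)//= lerDl.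
by apply: sumr_ge0 => a _; apply: sumr_ge0.
Qed.

(** This stability is what allows volume preserving factors to be composed: the support grows by the
    norm of the inverse, the Lipschitz constant by that of A. *)
Lemma tame_mulmx A f : A \in unitmx -> tame f -> tame (fun x => f (A *m x)).
Proof.
move=> uA [b [c [b0 c0 sf lf]]].
have bnd0 B : 0 <= \sum_i \sum_j `|B i j| by apply: sumr_ge0 => a _; apply: sumr_ge0.
exists ((\sum_i \sum_j `|invmx A i j|) * b), (c * (\sum_i \sum_j `|A i j|)).
split; rewrite ?mulr_ge0//.
- move=> x [i hi]; apply: sf.
  have [a ha|no] := pickP (fun a => b < `|(A *m x) a 0|); first by exists a.
  have xE : x i 0 = (invmx A *m (A *m x)) i 0 by rewrite mulKmx.
  move: hi; rewrite ltNge xE mulmx_coord_le// => a.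
  by rewrite leNgt no.
- move=> x y e hxy; rewrite -mulrA; apply: lf => i.
  have -> : (A *m x) i 0 - (A *m y) i 0 = (A *m (x - y)) i 0.
    by rewrite mulmxBr !mxE.
  by apply: mulmx_coord_le => j; rewrite !mxE.
Qed.

Definition volume_preserving A := A \in unitmx /\
  forall f, tame f -> riemann_close (fun x => f (A *m x)) f.

Lemma volume_preserving1 : volume_preserving 1%:M.
Proof.
split=> [|f _]; first exact: unitmx1.
have -> : (fun x => f (1%:M *m x)) = f by apply/funext => x; rewrite mul1mx.
exact: riemann_close_refl.
Qed.

Lemma volume_preservingM A B :
  volume_preserving A -> volume_preserving B -> volume_preserving (A *m B).
Proof.
move=> [uA hA] [uB hB]; split=> [|f tf]; first by rewrite unitmx_mul uA.
apply: riemann_close_trans (hA f tf).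
have := hB _ (tame_mulmx uA tf); congr riemann_close.
by apply/funext => x; rewrite mulmxA.
Qed.

Lemma volume_preserving_shear i (l : 'rV[R]_n) :
  l 0 i = 0 -> volume_preserving (shear_mx i l).
Proof.
move=> li; split.
  suff : shear_mx i l *m shear_mx i (- l) = 1%:M by case/mulmx1_unit.
  rewrite /shear_mx mulmxDl mul1mx mulmxDr mulmx1 -mulmxA (mulmxA l).
  have -> : l *m delta_mx i 0 = 0 :> 'M[R]_1.
    by apply/matrixP => a b; rewrite !ord1 -colE !mxE.
  by rewrite mul0mx mulmx0 addr0 mulmxN addrNK.
move=> f [b [c [b0 c0 sf lf]]].
set L := \sum_a `|l 0 a|.
have L0 : 0 <= L by rewrite sumr_ge0.
exists (2 * (b + L * b + 1) + 1); first by nra.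
move=> w e hw e0.
have w0 : 0 < w by nra.
have K0 : 0 < (2 * w) ^+ n * c + 1.
  by rewrite ltr_wpDl// mulr_ge0// exprn_ge0// mulr_ge0// (ltW w0).
exists (Num.min 1 (e / ((2 * w) ^+ n * c + 1))).
  by rewrite lt_min ltr01 divr_gt0.
move=> h N; rewrite lt_min => /andP[h0 /andP[h1 h2]] /andP[hN1 hN2].
apply: (le_trans (riemann_sum_shear li b0 c0 h0 sf lf _)).
  by rewrite -/L; lra.
have h2' : h * ((2 * w) ^+ n * c + 1) <= e by rewrite -ler_pdivlMr// ltW.
apply: (@le_trans _ _ ((2 * w) ^+ n * (c * h))); last by lra.
apply: ler_wpM2r; first by rewrite mulr_ge0 ?(ltW h0).
by apply: lerXn2r; rewrite // nnegrE; lra.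
Qed.

Lemma volume_preserving_perm (s : 'S_n) : volume_preserving (perm_mx s).
Proof.
split=> [|f _]; first exact: unitmx_perm.
have E h N : riemann_sum h N (fun x => f (perm_mx s *m x)) = riemann_sum h N f.
  congr (_ * _).
  pose q (j : {ffun 'I_n -> 'I_N.+2}) := [ffun a => j (s a)].
  have q_inj : injective q.
    move=> j j' e; apply/ffunP => a.
    have := congr1 (fun u : {ffun 'I_n -> 'I_N.+2} => u (s^-1%g a)) e.
    by rewrite !ffunE permKV.
  rewrite [RHS](reindex_inj q_inj); apply: eq_bigr => j _; congr (f _).
  by apply/matrixP => a b; rewrite -row_permE !mxE ffunE.
exists 1 => // w e _ e0; exists 1 => // h N _ _.
by rewrite E subrr normr0 ltW.
Qed.

(* The ranking r makes the statement cover the lower triangular factor of an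
   LUP decomposition as well as the upper one. *)
Lemma volume_preserving_unitriangular (r : 'I_n -> nat) A : injective r ->
  (forall i, A i i = 1) -> (forall i j, i != j -> (r i <= r j)%N -> A i j = 0) ->
  volume_preserving A.
Proof.
move=> r_inj A1 A0.
(* The matrix [T k] has the rows of A of rank below k and identity rows elsewhere. Each further row
   costs one shear on the right, because the rows already in place have entry 0 in the column of the
   new one. *)
pose T k := \matrix_(a, b) (if (r a < k)%N then A a b else (a == b)%:R).
suff H k : volume_preserving (T k).
  have -> : A = T (\max_a r a).+1.
    by apply/matrixP => a b; rewrite mxE ltnS leq_bigmax.
  exact: H.
elim: k => [|k IH].
  rewrite (_ : T 0 = 1%:M); first exact: volume_preserving1.
  by apply/matrixP => a b; rewrite !mxE ltn0.
have [i /eqP ri|no] := pickP (fun i => r i == k); last first.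
  rewrite (_ : T k.+1 = T k)//; apply/matrixP => a b.
  by rewrite !mxE ltnS leq_eqVlt no.
have -> : T k.+1 = T k *m shear_mx i (row i (A - 1%:M)).
  rewrite /shear_mx mulmxDr mulmx1 mulmxA -colE.
  apply/matrixP => a b; rewrite !mxE big_ord1 !mxE ltnS.
  have [->|ai] := eqVneq a i.
    by rewrite ri leqnn ltnn mul1r addrC subrK.
  have ak : r a != k by rewrite -ri; apply: contra_neq ai => /r_inj.
  rewrite (leq_eqVlt (r a)) (negPf ak) /=.
  case: ifP => rak; last by rewrite mul0r addr0.
  by rewrite (A0 a i)// ?mul0r ?addr0// ri ltnW.
apply: volume_preservingM IH _; apply: volume_preserving_shear.
by rewrite !mxE A1 eqxx subrr.
Qed.

End LinearChange.

(** The decomposition is applied to the transpose, so that the triangular factor with nontrivial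
    diagonal comes first in P. Its diagonal is pulled out on the left, where it acts on each
    coordinate of the product integrand separately; V is what remains of this factor. *)
Lemma unitmx_diag_volume (R : realType) n (P : 'M[R]_n) : P \in unitmx ->
  exists (D : 'rV[R]_n) (B : 'M[R]_n), [/\ volume_preserving B,
    P = diag_mx D *m B & `|\prod_i D 0 i| = `|\det P|].
Proof.
case: n P => [|n] P uP.
  exists 0, 1%:M; split; first exact: volume_preserving1.
    by rewrite [LHS]flatmx0 [RHS]flatmx0.
  by rewrite big_ord0 det_mx00.
have := cormen_lup_correct P^T; have := cormen_lup_perm P^T.
have := cormen_lup_lower P^T; have := cormen_lup_upper P^T.
have := cormen_lup_detL P^T.
case: cormen_lup => [[S L] U] /= dL Up Lo /is_perm_mxP[s ->] E.
have Etr : P *m (perm_mx s)^T = U^T *m L^T by rewrite -trmx_mul -[L *m U]E trmx_mul trmxK.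
have PE : P = U^T *m L^T *m perm_mx s.
  rewrite -Etr -mulmxA tr_perm_mx -perm_mxM mulVg perm_mx1 mulmx1 //.
have dU : \det U = \prod_i U i i.
  rewrite -det_tr det_trig; first by apply: eq_bigr => i _; rewrite mxE.
  by apply/is_trig_mxP => i j ij; rewrite mxE Up.
have dP : `|\det P| = `|\det U|.
  rewrite PE !det_mulmx !det_tr dL mulr1 det_perm normrM.
  by case: odd_perm; rewrite ?normrN normr1 mulr1.
have U0 i : U i i != 0.
  have : \det U != 0 by rewrite -normr_eq0 -dP normr_eq0 -unitfE -unitmxE.
  by rewrite dU => /prodf_neq0; apply.
pose D : 'rV[R]_n.+1 := \row_i U i i.
pose V : 'M[R]_n.+1 := \matrix_(i, j) ((U i i)^-1 * U j i).
exists D, (V *m (L^T *m perm_mx s)); split.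
- apply: volume_preservingM.
    apply: (@volume_preserving_unitriangular _ _ (fun i => i)).
    + exact: ord_inj.
    + by move=> i; rewrite mxE mulVf.
    + move=> i j ij ij'; rewrite mxE (Up j i) ?mulr0//.
      by rewrite ltn_neqAle ij' andbT; apply: contra_neq ij => /ord_inj.
  apply: volume_preservingM; last exact: volume_preserving_perm.
  apply: (@volume_preserving_unitriangular _ _ (fun i => rev_ord i)).
  + by move=> i j /ord_inj/rev_ord_inj.
  + by move=> i; rewrite mxE Lo// eqxx.
  + move=> i j ij /= rij; rewrite mxE Lo ?(negPf ij)//.
      by rewrite eq_sym (negPf ij).
    by have := ltn_ord i; have := ltn_ord j; move: rij; lia.
- rewrite PE -[in LHS]mulmxA !mulmxA; congr (_ *m _ *m _).
  apply/matrixP => i j; rewrite mul_diag_mx !mxE mulrA mulfV// mul1r//.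
- by rewrite dP dU; congr `|_|; apply: eq_bigr => i _; rewrite mxE.
Qed.

(** Points of the support have the same centred representatives in both tori. The Fourier average
    has width 2 pi, while the change of variables chooses its own width, so one has to pass between
    moduli. *)
Lemma riemann_sum_eq (R : realType) n (f : 'cV[R]_n -> R) (b h : R) N N' :
  0 < h -> supported_in b f -> 2 * b < h * N.+2%:R -> 2 * b < h * N'.+2%:R ->
  riemann_sum h N f = riemann_sum h N' f.
Proof.
move=> h0 sf hN hN'; congr (_ * _).
pose Q K (j : {ffun 'I_n -> 'I_K.+2}) := [forall a, `|(mesh_point h j) a 0| <= b].
have restrict K : \sum_(j : {ffun 'I_n -> 'I_K.+2}) f (mesh_point h j) =
    \sum_(j : {ffun 'I_n -> 'I_K.+2} | Q K j) f (mesh_point h j).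
  rewrite [LHS](bigID (Q K)) /= [X in _ + X]big1 ?addr0// => j.
  rewrite negb_forall => /existsP[a]; rewrite -ltNge => ha.
  by apply: sf; exists a.
pose g K K' (j : {ffun 'I_n -> 'I_K.+2}) : {ffun 'I_n -> 'I_K'.+2} :=
  [ffun a => (cent (j a))%:~R].
have gcent K K' (j : {ffun 'I_n -> 'I_K.+2}) : 2 * b < h * K'.+2%:R -> Q K j ->
    forall a, cent (g K K' j a) = cent (j a).
  move=> hK /forallP qj a; rewrite ffunE cent_intr//.
  rewrite -(ltr_int R) intrM intr_norm -(ltr_pM2l h0).
  have := qj a; rewrite mxE normrM (gtr0_norm h0); lra.
have gmesh K K' (j : {ffun 'I_n -> 'I_K.+2}) : 2 * b < h * K'.+2%:R -> Q K j ->
    mesh_point h (g K K' j) = mesh_point h j.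
  by move=> hK qj; apply/matrixP => a c; rewrite !mxE gcent.
have gK K K' (j : {ffun 'I_n -> 'I_K.+2}) : 2 * b < h * K'.+2%:R -> Q K j ->
    g K' K (g K K' j) = j.
  by move=> hK qj; apply/ffunP => a; rewrite ffunE gcent// centK.
rewrite !restrict (reindex_onto (g N' N) (g N N')); last by move=> j; exact: gK.
apply: eq_big => [j|j /andP[qj /eqP gj]].
  apply/andP/idP => [[qj /eqP gj]|qj].
    by rewrite -gj /Q gmesh.
  by rewrite gK// eqxx /Q gmesh.
by rewrite -[in RHS]gj (gmesh N N').
Qed.

(** The nonzero residues are paired as b and -b; [K.*2 < N.+2] keeps the two apart. *)
Lemma sum_cent (V : nmodType) (g : int -> V) N K : (K.*2 < N.+2)%N ->
  (forall z : int, K%:Z < `|z| -> g z = 0) ->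
  \sum_(x : 'I_N.+2) g (cent x) = g 0 + \sum_(b < K) (g b.+1%:Z + g (- b.+1%:Z)).
Proof.
move=> KN g0.
pose G (x : nat) := g (if (x.*2 <= N.+2)%N then x%:Z else x%:Z - N.+2%:Z).
rewrite -[LHS]/(\sum_(x < N.+2) G x) -(big_mkord xpredT G).
rewrite (@big_cat_nat _ _ _ 1) //= big_nat1 {1}/G /=; congr (_ + _).
have [h1 h2 h3] : [/\ K.+1 <= N.+2, K.+1 <= N.+2 - K & N.+2 - K <= N.+2]%N by split; lia.
rewrite (@big_cat_nat _ _ _ K.+1) //= (@big_cat_nat _ _ _ (N.+2 - K) K.+1) //=.
rewrite [X in _ + (X + _)]big1_seq ?add0r => [|x]; last first.
  by rewrite mem_index_iota /G => xK; apply: g0; case: ifP => h; lia.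
rewrite big_split /=; congr (_ + _).
  rewrite big_add1 big_mkord; apply: eq_bigr => b _; rewrite /G ifT//.
  by have := ltn_ord b; lia.
rewrite big_nat_rev /= -{1}[(N.+2 - K)%N]add0n big_addn.
rewrite (_ : (N.+2 - (N.+2 - K))%N = K); last by lia.
rewrite big_mkord; apply: eq_bigr => b _; rewrite /G ifF; last first.
  by have := ltn_ord b; lia.
by congr g; have := ltn_ord b; lia.
Qed.

(** Telescoping, one factor at a time. *)
Lemma dist_prod_le (R : realDomainType) (I : Type) (s : seq I) (a b : I -> R) (K : R) :
  1 <= K -> (forall i, `|a i| <= K) -> (forall i, `|b i| <= K) ->
  `|\prod_(i <- s) a i - \prod_(i <- s) b i| <= K ^+ size s * \sum_(i <- s) `|a i - b i|.
Proof.
move=> K1 aK bK; have K0 : 0 <= K by apply: le_trans K1.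
have prodK (c : I -> R) (u : seq I) : (forall i, `|c i| <= K) -> `|\prod_(i <- u) c i| <= K ^+ size u.
  move=> cK; elim: u => [|i u IH]; first by rewrite big_nil normr1.
  by rewrite big_cons normrM exprS ler_pM.
elim: s => [|i s IH]; first by rewrite !big_nil subrr normr0 mulr0.
rewrite !big_cons /=; set A := \prod_(_ <- _) a _; set B := \prod_(_ <- _) b _.
have -> : a i * A - b i * B = (a i - b i) * A + b i * (A - B) by ring.
apply: (le_trans (ler_normD _ _)); rewrite !normrM mulrDr; apply: lerD.
  rewrite mulrC; apply: ler_wpM2r => //.
  by apply: (le_trans (prodK _ _ aK)); rewrite exprS ler_peMl ?exprn_ge0.
by rewrite exprS -mulrA; apply: ler_pM.
Qed.

(** * Gaussian integrals over boxes *)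

Section GaussianTrapezoid.
Variables (R : realType) (c : R).
Hypothesis c0 : 0 < c.
Implicit Types (x y u h : R).

Definition gauss u : R := expR (- (c * u ^+ 2)).

(* E is the primitive of gauss vanishing at 0, known only through these bounds. *)
Variable E : R -> R.
Hypothesis E0 : E 0 = 0.
Hypothesis E_itv : forall x y, 0 <= x -> x <= y ->
  gauss y * (y - x) <= E y - E x <= gauss x * (y - x).

Lemma gauss_gt0 u : 0 < gauss u. Proof. exact: expR_gt0. Qed.

Lemma gauss_le1 u : gauss u <= 1.
Proof. by rewrite -expR0 ler_expR oppr_le0 mulr_ge0 ?sqr_ge0// ltW. Qed.

Lemma gauss_norm u : gauss `|u| = gauss u.
Proof. by rewrite /gauss real_normK ?num_real. Qed.

Lemma E_mono x y : 0 <= x -> x <= y -> E x <= E y.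
Proof.
move=> x0 xy; have /andP[h _] := E_itv x0 xy.
have : 0 <= gauss y * (y - x) by rewrite mulr_ge0 ?subr_ge0// ltW// gauss_gt0.
lra.
Qed.

Variables (al be : R).
Hypothesis al0 : 0 <= al.
Hypothesis albe : al < be.

(** A Lipschitz substitute for the indicator of an interval: 1 up to [al], 0 from [be] on, and
    linear in between. *)
Definition trapezoid u : R := Num.max 0 (Num.min 1 ((be - `|u|) / (be - al))).

Definition gauss_trap u : R := gauss u * trapezoid u.

Lemma trapezoid_itv u : 0 <= trapezoid u <= 1.
Proof. by rewrite /trapezoid le_max lexx /= ge_max ler01 ge_min lexx. Qed.

Lemma trapezoid_out u : be <= `|u| -> trapezoid u = 0.
Proof.
move=> h; apply/eqP; rewrite eq_le (andP (trapezoid_itv u)).1 andbT.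
by rewrite ge_max lexx ge_min pmulr_lle0 ?invr_gt0 ?subr_gt0// subr_le0 h orbT.
Qed.

Lemma trapezoid_in u : `|u| <= al -> trapezoid u = 1.
Proof.
move=> h; apply/eqP; rewrite eq_le (andP (trapezoid_itv u)).2 /=.
by rewrite le_max le_min lexx ler_pdivlMr ?subr_gt0// mul1r lerD2l lerN2 h orbT.
Qed.

Lemma trapezoid_lip u v : `|trapezoid u - trapezoid v| <= (be - al)^-1 * `|u - v|.
Proof.
have d0 : 0 < (be - al)^-1 by rewrite invr_gt0 subr_gt0.
suff H x y : `|x| <= `|y| -> `|trapezoid x - trapezoid y| <= (be - al)^-1 * `|x - y|.
  have [uv|/ltW vu] := leP `|u| `|v|; first exact: H.
  by rewrite distrC (distrC u); exact: H.
move=> xy; rewrite /trapezoid.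
have h1 : `|y| - `|x| <= `|x - y| by rewrite distrC lerB_dist.
have h2 : (be - `|x|) / (be - al) - (be - `|y|) / (be - al) <= (be - al)^-1 * `|x - y|.
  by rewrite -mulrBl mulrC ler_pM2l//; lra.
have h3 : (be - `|y|) / (be - al) <= (be - `|x|) / (be - al).
  by rewrite ler_pM2r//; lra.
move: h2 h3; set p := _ / _; set q := _ / _; set e := _ * _ => h2 h3.
rewrite ler_norml /Num.max /Num.min; move: p q e h2 h3; clear=> p q e h2 h3.
by case: (ltP 1 p) => ?; case: (ltP 1 q) => ?; case: ltP => ?; case: ltP => ?; apply/andP; split; lra.
Qed.

Lemma gauss_trap_itv u : 0 <= gauss_trap u <= 1.
Proof.
have /andP[h1 h2] := trapezoid_itv u; rewrite mulr_ge0 ?(ltW (gauss_gt0 u))//=.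
by rewrite -[1]mulr1 ler_pM ?gauss_le1// ltW// gauss_gt0.
Qed.

Lemma gauss_trap_out u : be <= `|u| -> gauss_trap u = 0.
Proof. by move=> /trapezoid_out h; rewrite /gauss_trap h mulr0. Qed.

Lemma gauss_trap_in u : `|u| <= al -> gauss_trap u = gauss u.
Proof. by move=> /trapezoid_in h; rewrite /gauss_trap h mulr1. Qed.

Lemma gauss_trap_le u : gauss_trap u <= gauss u.
Proof.
have /andP[_ h2] := trapezoid_itv u.
by rewrite -[leRHS]mulr1 ler_pM2l// gauss_gt0.
Qed.

Lemma gauss_trap_norm u : gauss_trap `|u| = gauss_trap u.
Proof. by rewrite /gauss_trap /trapezoid gauss_norm normr_id. Qed.

Lemma gauss_trap_lip u v :
  `|gauss_trap u - gauss_trap v| <= (2 * c * be + (be - al)^-1) * `|u - v|.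
Proof.
have d0 : 0 < (be - al)^-1 by rewrite invr_gt0 subr_gt0.
suff H x y : `|x| <= `|y| ->
    `|gauss_trap x - gauss_trap y| <= (2 * c * be + (be - al)^-1) * `|x - y|.
  have [uv|/ltW vu] := leP `|u| `|v|; first exact: H.
  by rewrite distrC (distrC u); exact: H.
move=> xy.
have T := trapezoid_lip x y.
have cb0 : 0 <= 2 * c * be * `|x - y|.
  by rewrite mulr_ge0// mulr_ge0 ?(ltW (le_lt_trans al0 albe))// mulr_ge0// (ltW c0).
(* From [be] on only the slope of the cutoff counts; below it the exponent of the Gaussian has slope
   at most 2 c be. *)
have [yb|by_] := leP be `|y|.
  move: T; rewrite (trapezoid_out yb) (gauss_trap_out yb) !subr0 => T.
  rewrite normrM (gtr0_norm (gauss_gt0 x)).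
  apply: (le_trans (_ : _ <= `|trapezoid x|)).
    by rewrite ler_piMl// gauss_le1.
  by rewrite mulrDl; lra.
have -> : gauss_trap x - gauss_trap y =
    (gauss x - gauss y) * trapezoid x + gauss y * (trapezoid x - trapezoid y).
  by rewrite /gauss_trap; ring.
apply: (le_trans (ler_normD _ _)); rewrite !normrM mulrDl.
have /andP[t0 t1] := trapezoid_itv x.
apply: lerD; last first.
  apply: le_trans T; rewrite (gtr0_norm (gauss_gt0 y)).
  by rewrite ler_piMl// gauss_le1.
apply: (le_trans (_ : _ <= `|gauss x - gauss y|)).
  by rewrite ler_piMr// ger0_norm.
have gxy : gauss y <= gauss x.
  rewrite -(gauss_norm x) -(gauss_norm y) ler_expR lerN2 ler_pM2l//.
  by rewrite lerXn2r// nnegrE.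
rewrite ger0_norm ?subr_ge0//.
have e1 : gauss y = gauss x * expR (- (c * (y ^+ 2 - x ^+ 2))).
  by rewrite /gauss -expRD; congr expR; ring.
have e2 : 1 - c * (y ^+ 2 - x ^+ 2) <= expR (- (c * (y ^+ 2 - x ^+ 2))).
  by rewrite -[leLHS]/(1 + - _) expR_ge1Dx.
have y2x2 : 0 <= y ^+ 2 - x ^+ 2.
  by rewrite subr_ge0 -[x ^+ 2]real_normK ?num_real// -[y ^+ 2]real_normK ?num_real// lerXn2r// nnegrE.
have e3 : gauss x - gauss y <= c * (y ^+ 2 - x ^+ 2).
  rewrite e1; have := gauss_gt0 x; have := gauss_le1 x.
  have : 0 <= c * (y ^+ 2 - x ^+ 2) by rewrite mulr_ge0// ltW.
  move: e2; set p := expR _; set q := c * _; move: (gauss x) => g; nra.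
apply: (le_trans e3); rewrite -[2 * c]mulrC -!mulrA ler_pM2l//.
have -> : y ^+ 2 - x ^+ 2 = `|y + x| * `|x - y|.
  by rewrite -[LHS]ger0_norm// subr_sqr mulrC normrM distrC.
have := ler_normD y x.
have := normr_ge0 (x - y); move: (`|x - y|) (`|y + x|) => d s d0' s2.
rewrite mulrA ler_wpM2r//; lra.
Qed.

Lemma E_sum_ub K x : 0 <= x -> \sum_(b < K) gauss (x * b.+1%:R) * x <= E (x * K%:R).
Proof.
move=> x0; elim: K => [|K IH]; first by rewrite big_ord0 mulr0 E0.
rewrite big_ord_recr /=.
have p1 : 0 <= x * K%:R by rewrite mulr_ge0.
have p2 : x * K%:R <= x * K.+1%:R by rewrite ler_wpM2l ?ler_nat.
have /andP[+ _] := E_itv p1 p2.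
by rewrite -mulrBr -natrB// subSnn mulr1; lra.
Qed.

(** The sum starts at the mesh point x; the cell from 0 to x is bounded by its length, which gives
    the extra x. *)
Lemma E_sum_lb K x : 0 <= x -> E (x * K.+1%:R) <= x + \sum_(b < K) gauss (x * b.+1%:R) * x.
Proof.
move=> x0; elim: K => [|K IH].
  rewrite big_ord0 addr0 mulr1.
  have /andP[_] := E_itv (lexx 0) x0; rewrite E0 !subr0 => /le_trans; apply.
  by rewrite ler_piMl// gauss_le1.
rewrite big_ord_recr /=.
have p1 : 0 <= x * K.+1%:R by rewrite mulr_ge0.
have p2 : x * K.+1%:R <= x * K.+2%:R by rewrite ler_wpM2l ?ler_nat.
have /andP[_] := E_itv p1 p2.
by rewrite -mulrBr -natrB// subSnn mulr1; lra.
Qed.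

Lemma gauss_trap_sum a h N : a != 0 -> 0 < h -> 2 * be < `|a| * h * N.+2%:R ->
  2 * E al / `|a| - 2 * h <=
  h * \sum_(x : 'I_N.+2) gauss_trap (a * (h * (cent x)%:~R)) <= 2 * E be / `|a| + h.
Proof.
move=> a0 h0 hN.
have na0 : 0 < `|a| by rewrite normr_gt0.
have [s sE] : exists s, s = `|a| * h by exists (`|a| * h).
have s0 : 0 < s by rewrite sE mulr_gt0.
(* In the scale s = |a| h these are the numbers of positive mesh points up to [be] and up to
   [al]. *)
pose K := Num.truncn (be / s); pose k := Num.truncn (al / s).
have be0 : 0 < be by exact: le_lt_trans albe.
have /andP[K1 K2] : K%:R <= be / s < K.+1%:R by apply: truncn_itv; rewrite divr_ge0// ltW.
have /andP[k1 k2] : k%:R <= al / s < k.+1%:R by apply: truncn_itv; rewrite divr_ge0// ltW.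
rewrite ler_pdivlMr// in K1; rewrite ltr_pdivrMr// in K2.
rewrite ler_pdivlMr// in k1; rewrite ltr_pdivrMr// in k2.
have kK : (k <= K)%N.
  rewrite -ltnS -(ltr_nat R) -(ltr_pM2r s0).
  exact: le_lt_trans k1 (lt_trans albe K2).
pose g (z : int) := gauss_trap (a * (h * z%:~R)).
have gE (b : nat) : (g b%:Z = gauss_trap (s * b%:R)) /\ (g (- b%:Z) = gauss_trap (s * b%:R)).
  split; rewrite /g -[LHS]gauss_trap_norm !normrM ?mulrNz ?normrN (gtr0_norm h0).
    by rewrite mulrA -sE -pmulrn normr_nat.
  by rewrite mulrA -sE -pmulrn normr_nat.
have sumE : \sum_(x : 'I_N.+2) gauss_trap (a * (h * (cent x)%:~R)) =
    gauss_trap 0 + 2 * \sum_(b < K) gauss_trap (s * b.+1%:R).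
  rewrite -[LHS]/(\sum_(x : 'I_N.+2) g (cent x)) (@sum_cent _ g _ K).
  - rewrite {1}/g !mulr0; congr (_ + _); rewrite mulr_sumr; apply: eq_bigr => b _.
    by have [-> ->] := gE b.+1; ring.
  - rewrite -(ltr_nat R) -muln2 natrM -(ltr_pM2r s0); rewrite -sE in hN; lra.
  - move=> z hz; rewrite /g gauss_trap_out// !normrM (gtr0_norm h0) mulrA -sE.
    have : K.+1%:R <= `|z|%:~R :> R.
      by rewrite -[K.+1%:R]/(K.+1%:Z%:~R) ler_int; move: hz; clear; lia.
    by rewrite intr_norm -(ler_pM2l s0); lra.
rewrite sumE.
have g1 := gauss_trap_itv 0; case/andP: g1 => g1 g2.
have hs : h = s / `|a| by rewrite sE mulrAC mulfV ?mul1r// normr_eq0.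
have hsum (F : nat -> R) m : h * (2 * \sum_(b < m) F b) = 2 * (\sum_(b < m) F b * s) / `|a|.
  by rewrite -mulr_suml hs; ring.
rewrite mulrDr (hsum (fun b => gauss_trap (s * b.+1%:R))); apply/andP; split.
- have lb : E al <= s + \sum_(b < K) gauss_trap (s * b.+1%:R) * s.
    have := E_sum_lb k (ltW s0).
    have : E al <= E (s * k.+1%:R) by apply: E_mono => //; lra.
    suff : \sum_(b < k) gauss (s * b.+1%:R) * s <= \sum_(b < K) gauss_trap (s * b.+1%:R) * s by lra.
    rewrite -!(big_mkord xpredT (fun b => _ (s * b.+1%:R) * s)).
    rewrite [leRHS](@big_cat_nat _ _ _ k) //= -[leLHS]addr0; apply: lerD.
      rewrite !big_mkord; apply: ler_sum => b _; rewrite gauss_trap_in//.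
      rewrite ger0_norm ?mulr_ge0 ?(ltW s0)//.
      apply: le_trans k1; rewrite mulrC ler_pM2r// ler_nat; exact: ltn_ord.
    apply: sumr_ge0 => b _; rewrite mulr_ge0 ?(ltW s0)//.
    by case/andP: (gauss_trap_itv (s * b.+1%:R)).
  have : 2 * E al / `|a| <= 2 * (s + \sum_(b < K) gauss_trap (s * b.+1%:R) * s) / `|a|.
    by rewrite ler_pM2r ?invr_gt0// ler_pM2l.
  rewrite mulrDr mulrDl -[2 * s / _]mulrA -hs.
  have : 0 <= h * gauss_trap 0 by rewrite mulr_ge0// ltW.
  lra.
- have ub : \sum_(b < K) gauss_trap (s * b.+1%:R) * s <= E be.
    have := E_sum_ub K (ltW s0).
    have : E (s * K%:R) <= E be by apply: E_mono; [rewrite mulr_ge0// ltW|lra].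
    suff : \sum_(b < K) gauss_trap (s * b.+1%:R) * s <= \sum_(b < K) gauss (s * b.+1%:R) * s by lra.
    by apply: ler_sum => b _; rewrite ler_pM2r// gauss_trap_le.
  have : 2 * (\sum_(b < K) gauss_trap (s * b.+1%:R) * s) / `|a| <= 2 * E be / `|a|.
    by rewrite ler_pM2r ?invr_gt0// ler_pM2l.
  have : h * gauss_trap 0 <= h by rewrite ler_piMr// ltW.
  lra.
Qed.

End GaussianTrapezoid.

Section GaussianVolume.
Variables (R : realType) (c al be : R) (E : R -> R).
Hypotheses (c0 : 0 < c) (E0 : E 0 = 0).
Hypothesis E_itv : forall x y, 0 <= x -> x <= y ->
  gauss c y * (y - x) <= E y - E x <= gauss c x * (y - x).
Hypotheses (al0 : 0 <= al) (albe : al < be).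

Let g := gauss_trap c al be.

Lemma tame_prod_gauss_trap n : tame (fun x : 'cV[R]_n => \prod_i g (x i 0)).
Proof.
have be0 : 0 < be by exact: le_lt_trans albe.
have g01 u : 0 <= g u <= 1 by apply: gauss_trap_itv.
have gn u : `|g u| <= 1 by have /andP[h1 h2] := g01 u; rewrite ger0_norm.
have d0 : 0 <= (be - al)^-1 by rewrite invr_ge0 subr_ge0 ltW.
have L0 : 0 <= 2 * c * be + (be - al)^-1.
  by rewrite addr_ge0// mulr_ge0 ?(ltW be0)// mulr_ge0// (ltW c0).
exists be, (n%:R * (2 * c * be + (be - al)^-1)); split=> //.
- exact: ltW.
- by rewrite mulr_ge0.
- move=> x [i hi]; rewrite (bigD1 i)//= {1}/g gauss_trap_out ?mul0r//; exact: ltW.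
- move=> x y e hxy.
  apply: (le_trans (@dist_prod_le R _ _ _ _ 1 _ _ _)) => //.
  rewrite expr1n mul1r.
  apply: (@le_trans _ _ (\sum_(i : 'I_n) (2 * c * be + (be - al)^-1) * e)).
    apply: ler_sum => i _; apply: (le_trans (gauss_trap_lip c0 al0 albe _ _)).
    exact: ler_wpM2l.
  by rewrite sumr_const card_ord -[leRHS]mulrA -[leLHS]mulr_natl.
Qed.

Lemma prod_shift_close n (u v : 'I_n -> R) (K : R) : 1 <= K ->
  (forall i, `|u i| <= K) -> (forall i, `|v i| <= K) -> forall r,
  (forall i, `|u i - v i| <= r) ->
  `|\prod_i u i - \prod_i v i| <= K ^+ n * (n%:R * r).
Proof.
move=> K1 uK vK r uv; apply: (le_trans (dist_prod_le _ K1 uK vK)).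
have -> : size (index_enum 'I_n) = n by rewrite -[RHS]card_ord cardE enumT.
apply: ler_wpM2l; first by rewrite exprn_ge0// (le_trans ler01 K1).
apply: (@le_trans _ _ (\sum_(i : 'I_n) r)); first exact: ler_sum.
by rewrite sumr_const card_ord mulr_natl.
Qed.

Lemma riemann_sum_prod n (D : 'rV[R]_n) h N :
  riemann_sum h N (fun x => \prod_i g ((diag_mx D *m x) i 0)) =
  \prod_i (h * \sum_(x : 'I_N.+2) g (D 0 i * (h * (cent x)%:~R))).
Proof.
rewrite big_split /= prodr_const card_ord bigA_distr_bigA /=.
congr (_ * _); apply: eq_bigr => j _; apply: eq_bigr => i _.
by rewrite mul_diag_mx !mxE.
Qed.

(** This takes the place of a multidimensional Gaussian integral. The volume preserving factor of P
    costs e/2, and the diagonal factor splits the sum into one-dimensional ones. The bound W lets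
    the caller ask for a box wide enough to hold the support of another function. *)
Lemma riemann_sum_gauss_trap n (P : 'M[R]_n) : P \in unitmx ->
  forall W e : R, 0 < e -> exists2 h0 : R, 0 < h0 & forall h, 0 < h < h0 ->
  exists2 N, W < h * N.+2%:R &
    (2 * E al) ^+ n / `|\det P| - e <=
    riemann_sum h N (fun x => \prod_i g ((P *m x) i 0)) <=
    (2 * E be) ^+ n / `|\det P| + e.
Proof.
move=> uP W e e0.
have be0 : 0 < be by exact: le_lt_trans albe.
have Eal0 : 0 <= E al by rewrite -E0; apply: (E_mono E_itv).
have Ebe0 : 0 <= E be by rewrite -E0; apply: (E_mono E_itv) => //; exact: ltW.
have [D [B [[uB vB] PE dP]]] := unitmx_diag_volume uP.
have D0 i : D 0 i != 0.
  have : \prod_i D 0 i != 0 by rewrite -normr_eq0 dP normr_eq0 -unitfE -unitmxE.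
  by move=> /prodf_neq0; apply.
have uD : diag_mx D \in unitmx.
  by rewrite unitmxE det_diag unitfE; apply/prodf_neq0 => i _.
have [w0 w00 Hw] := vB _ (tame_mulmx uD (tame_prod_gauss_trap n)).
have [S S0 HS] : exists2 S : R, 0 <= S & forall i, `|D 0 i|^-1 <= S.
  exists (\sum_i `|D 0 i|^-1); first by apply: sumr_ge0 => i _; rewrite invr_ge0.
  by move=> i; rewrite (bigD1 i)//= lerDl sumr_ge0// => j _; rewrite invr_ge0.
(* The width has to exceed the threshold of the volume preserving factor, the demand W of the
   caller, and the extent 2 be / |D i| of the support in each diagonal coordinate. *)
pose w := Num.max w0 (Num.max (W + 1) (2 * be * S + 1)).
have ww0 : w0 <= w by rewrite le_max lexx.
have wW : W + 1 <= w by rewrite !le_max lexx orbT.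
have wS : 2 * be * S + 1 <= w by rewrite !le_max lexx !orbT.
have wp : 0 < w by exact: lt_le_trans ww0.
have e20 : 0 < e / 2 by rewrite divr_gt0.
have [h1 h10 Hh] := Hw w (e / 2) ww0 e20.
pose K := 2 * E be * S + 2 * E al * S + 3.
have K1 : 1 <= K.
  have : 0 <= 2 * E be * S by rewrite !mulr_ge0.
  have : 0 <= 2 * E al * S by rewrite !mulr_ge0.
  by rewrite /K; lra.
have K00 : 0 <= K by apply: le_trans K1.
pose T := K ^+ n * (n%:R * 2) + 1.
have T0 : 0 < T by rewrite ltr_wpDl// mulr_ge0 ?exprn_ge0// mulr_ge0.
exists (Num.min h1 (Num.min 1 (Num.min (w / 2) (e / 2 / T)))).
  by rewrite !lt_min h10 ltr01 !divr_gt0.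
move=> h; rewrite !lt_min => /andP[h0 /and4P[hh1 hl1 hw hT]].
have [N /andP[N1 N2]] : exists N, w <= h * N.+2%:R <= 2 * w.
  (* Then [h * N.+2] is the first multiple of h beyond w, and h < w / 2 keeps it below 2 w. *)
  exists (Num.truncn (w / h)).-1.
  have wh2 : 2 <= w / h by rewrite ler_pdivlMr//; lra.
  have t2 : (2 <= Num.truncn (w / h))%N by rewrite truncn_ge_nat// ltW// divr_gt0.
  have -> : (Num.truncn (w / h)).-1.+2 = (Num.truncn (w / h)).+1.
    by rewrite prednK// ltnW.
  have /andP[t3 t4] : (Num.truncn (w / h))%:R <= w / h < (Num.truncn (w / h)).+1%:R.
    by apply: truncn_itv; rewrite divr_ge0// ltW.
  rewrite ler_pdivlMr// in t3; rewrite ltr_pdivrMr// in t4.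
  rewrite mulrC (ltW t4) /= mulrC -natr1 mulrDr mulr1 mulrC; lra.
exists N; first by lra.
have := Hh h N; rewrite h0 hh1 N1 N2 => /(_ isT isT).
have -> : (fun x => (fun y : 'cV[R]_n => \prod_i g ((diag_mx D *m y) i 0)) (B *m x)) =
    (fun x => \prod_i g ((P *m x) i 0)).
  by apply/funext => x; rewrite PE; apply: eq_bigr => i _; rewrite mulmxA.
have := riemann_sum_prod D h N; set sD := riemann_sum h N (fun x => \prod_i g ((diag_mx D *m x) i 0)) => sDE.
pose r i := h * \sum_(x : 'I_N.+2) g (D 0 i * (h * (cent x)%:~R)).
have Hr i : 2 * E al / `|D 0 i| - 2 * h <= r i <= 2 * E be / `|D 0 i| + h.
  apply: gauss_trap_sum => //.
  have nD : 0 < `|D 0 i| by rewrite normr_gt0.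
  have : 2 * be * `|D 0 i|^-1 < h * N.+2%:R.
    apply: (lt_le_trans _ N1); have : 2 * be * `|D 0 i|^-1 <= 2 * be * S.
      by apply: ler_wpM2l => //; rewrite mulr_ge0// ltW.
    by lra.
  by rewrite ltr_pdivrMr// [ltRHS]mulrC mulrA.
have r0 i : 0 <= r i.
  rewrite mulr_ge0 ?(ltW h0)// sumr_ge0// => x _.
  by have /andP[] := gauss_trap_itv c0 al be (D 0 i * (h * (cent x)%:~R)).
have KE i x : 0 <= x -> x <= E be \/ x <= E al -> `|2 * x / `|D 0 i| | <= 2 * E be * S + 2 * E al * S.
  move=> x0 xE; rewrite ger0_norm ?divr_ge0 ?mulr_ge0//.
  apply: (@le_trans _ _ (2 * x * S)); first by rewrite ler_wpM2l// mulr_ge0.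
  have : 0 <= E be * S by rewrite mulr_ge0.
  have : 0 <= E al * S by rewrite mulr_ge0.
  by case: xE => /(ler_wpM2r S0); rewrite -!mulrA; lra.
have prodE x : \prod_i (2 * x / `|D 0 i|) = (2 * x) ^+ n / `|\det P|.
  by rewrite big_split /= prodr_const card_ord prodfV -normr_prod dP.
have close (u v : 'I_n -> R) : (forall i, `|u i| <= K) -> (forall i, `|v i| <= K) ->
    (forall i, `|u i - v i| <= 2 * h) -> `|\prod_i u i - \prod_i v i| <= e / 2.
  move=> uK vK uv; apply: (le_trans (prod_shift_close K1 uK vK uv)).
  rewrite mulrA mulrA -(mulrA (K ^+ n)).
  have : h * T <= e / 2 by rewrite -ler_pdivlMr// ltW.
  by rewrite /T; lra.
have hh0 := ltW h0.
have P1 : \prod_i r i <= (2 * E be) ^+ n / `|\det P| + e / 2.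
  have : \prod_i r i <= \prod_i (2 * E be / `|D 0 i| + h).
    by apply: ler_prod => i _; rewrite r0; have /andP[] := Hr i.
  move/le_trans; apply; rewrite -lerBlDl -prodE.
  apply: (le_trans (ler_norm _)); apply: close => i.
  - apply: (le_trans (ler_normD _ _)); have := KE i _ Ebe0 (or_introl (lexx _)).
    by rewrite (ger0_norm hh0) /K; lra.
  - by have := KE i _ Ebe0 (or_introl (lexx _)); rewrite /K; lra.
  - by rewrite addrC addKr ger0_norm//; lra.
have P2 : (2 * E al) ^+ n / `|\det P| - e / 2 <= \prod_i r i.
  (* The lower bounds may be negative; cutting them off at 0 allows a termwise comparison of
     products. *)
  have : \prod_i Num.max 0 (2 * E al / `|D 0 i| - 2 * h) <= \prod_i r i.
    apply: ler_prod => i _; rewrite le_max lexx /= ge_max r0.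
    by have /andP[] := Hr i.
  apply: le_trans; rewrite lerBlDr -lerBlDl -prodE.
  apply: (le_trans (ler_norm _)); apply: close => i.
  - by have := KE i _ Eal0 (or_intror (lexx _)); rewrite /K; lra.
  - rewrite ger0_norm ?le_max ?lexx// ge_max K00 /=.
    have := KE i _ Eal0 (or_intror (lexx _)); rewrite ler_norml => /andP[_].
    by rewrite /K; lra.
  - have q0 : 0 <= 2 * E al / `|D 0 i| by rewrite divr_ge0// mulr_ge0.
    move: q0 hh0; clear; move: (_ / _) => q q0 hh0.
    by rewrite ler_norml /Num.max; case: ltP => ?; apply/andP; split; lra.
have {}sDE : sD = \prod_i r i by [].
rewrite sDE ler_norml => /andP[Q1 Q2]; move: P1 P2 Q1 Q2; clear=> P1 P2 Q1 Q2.
by apply/andP; split; lra.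
Qed.

End GaussianVolume.

(* A increases until its derivative changes sign and decreases to 0 afterwards. *)
Lemma ge0_of_derive_sign (R : realType) (A dA : R -> R) :
  A 0 = 0 -> (forall x : R, 0 < x -> is_derive x 1 A (dA x)) ->
  (forall x : R, 0 < x -> {within `[0, x], continuous A}) -> A x @[x --> +oo] --> 0 ->
  (forall x, 0 < x -> (forall y, 0 < y < x -> 0 <= dA y) \/ (forall y, x < y -> dA y <= 0)) ->
  forall x, 0 <= x -> 0 <= A x.
Proof.
move=> A0 dAP cA limA sgn x; rewrite le_eqVlt => /predU1P[<-|x0]; first by rewrite A0.
have mvt a b : 0 <= a -> a < b -> exists2 z, a < z < b & A b - A a = dA z * (b - a).
  move=> a0 ab; have [||z] := @MVT _ A dA a b ab.
  - move=> z; rewrite in_itv/= => /andP[az _]; apply: dAP; exact: le_lt_trans az.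
  - apply: continuous_subspaceW (cA b (le_lt_trans a0 ab)) => z /=.
    by rewrite !in_itv/= => /andP[az ->]; rewrite (le_trans a0 az).
  - by rewrite in_itv/= => ? ->; exists z.
have [up|down] := sgn x x0.
  have [z z0x /eqP] := mvt 0 x (lexx _) x0.
  by rewrite A0 !subr0 => /eqP ->; rewrite mulr_ge0 ?up// ltW.
rewrite leNgt; apply/negP => Ax.
have /cvgrPdist_lt /(_ (- A x)) := limA; rewrite oppr_gt0 => /(_ Ax) [M [_ HM]].
pose y := Num.max (M + 1) (x + 1).
have yM : M < y by rewrite lt_max ltrDl ltr01.
have yx : x < y by rewrite lt_max [x < x + 1]ltrDl ltr01 orbT.
have := HM y yM; rewrite sub0r normrN.
have [z /andP[xz _] Ez] := mvt x y (ltW x0) yx.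
have := down z xz => dz.
have : A y <= A x by rewrite -subr_le0 Ez mulr_le0_ge0// subr_ge0 ltW.
by move=> Ayx; rewrite ltr0_norm ?(le_lt_trans Ayx)// ltrN2 ltNge Ayx.
Qed.

(** * The Gaussian integral over a finite interval *)

Section FiniteGaussian.
Variable R : realType.
Implicit Types x y : R.
Import gauss_integral_proof.

Let mu : {measure set _ -> \bar R} := @lebesgue_measure R.
Let F : R -> R := @integral0_gauss R.
Let e : R -> R := @gauss_fun R.

Let e_gt0 x : 0 < e x. Proof. exact: expR_gt0. Qed.

Let F0 : F 0 = 0.
Proof. by rewrite /F /integral0_gauss set_itv1 Rintegral_set1. Qed.

Let F_cont x : 0 <= x -> {within `[0, x], continuous F}.
Proof.
move=> x0; apply: parameterized_integral_continuous => //=.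
apply: continuous_compact_integrable => //; first exact: segment_compact.
by apply: continuous_subspaceT; exact: continuous_gauss_fun.
Qed.

Let F_derive x : 0 < x -> is_derive x 1 F (e x).
Proof.
move=> x0.
have [dF <-] : derivable F x 1 /\ F^`()%classic x = e x.
  apply: (@continuous_FTC1 R e (BLeft 0) _ (x + 1) _ _ _ _).
  - by rewrite ltrDl.
  - apply: continuous_compact_integrable => //; first exact: segment_compact.
    by apply: continuous_subspaceT; exact: continuous_gauss_fun.
  - by rewrite /=; rewrite lte_fin.
  - by move=> ?; exact: continuous_gauss_fun.
by rewrite derive1E; apply: DeriveDef.
Qed.

Let e_le x y : 0 <= x -> x <= y -> e y <= e x.
Proof.
move=> x0 xy; rewrite ler_expR lerN2 lerXn2r// nnegrE//; exact: le_trans xy.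
Qed.

Let F_itv x y : 0 <= x -> x <= y -> e y * (y - x) <= F y - F x <= e x * (y - x).
Proof.
move=> x0; rewrite le_eqVlt => /predU1P[->|xy]; first by rewrite !subrr !mulr0 lexx.
have [||z] := @MVT _ F e x y xy.
- by move=> z; rewrite in_itv/= => /andP[az _]; apply: F_derive; exact: le_lt_trans az.
- have y0 : 0 <= y by apply: le_trans (ltW xy).
  apply: continuous_subspaceW (F_cont y0) => z /=.
  by rewrite !in_itv/= => /andP[az ->]; rewrite (le_trans x0 az).
- rewrite in_itv/= => /andP[/ltW xz /ltW zy] ->.
  by rewrite !ler_pM2r ?subr_gt0// !e_le// (le_trans x0).
Qed.

Let F_ge x : 0 <= x -> e x * x <= F x.
Proof. by move=> x0; have := F_itv (lexx 0) x0; rewrite F0 !subr0 => /andP[]. Qed.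

Let F_le x : 0 <= x -> F x <= x.
Proof.
move=> x0; have := F_itv (lexx 0) x0; rewrite F0 !subr0 => /andP[_].
by rewrite /e /gauss_fun expr0n oppr0 expR0 mul1r.
Qed.

(** By concavity F x / x decreases. Hence F x - (pi/4) x changes sign at most once, as the lower
    bound requires. *)
Let F_slope y x : 0 < y -> y <= x -> F x * y <= F y * x.
Proof.
move=> y0 yx; have /andP[_ h] := F_itv (ltW y0) yx.
have := F_ge (ltW y0); move: (e y) (F x) (F y) h => p u v; nra.
Qed.

(** The quotient F x / (x e x) increases, so that the derivative in the upper bound changes sign at
    most once. *)
Let F_ratio y x : 0 < y -> y <= x -> F y * (x * e x) <= F x * (y * e y).
Proof.
move=> y0 yx; have x0 : 0 < x by exact: lt_le_trans yx.
have /andP[h _] := F_itv (ltW y0) yx.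
have h1 := F_le (ltW y0); have h2 := F_ge (ltW y0).
pose p := expR (y ^+ 2); pose q := expR (x ^+ 2).
have ep : e y * p = 1 by rewrite /e /gauss_fun /p -expRD addNr expR0.
have eq_ : e x * q = 1 by rewrite /e /gauss_fun /q -expRD addNr expR0.
have p1 : 1 + y ^+ 2 <= p by exact: expR_ge1Dx.
have pY : p - 1 <= y ^+ 2 * p.
  have : 1 - y ^+ 2 <= e y by exact: expR_ge1Dx.
  have : 0 < p by exact: expR_gt0.
  by move: ep; move: p (e y) (y ^+ 2) {p1} => p f Y; nra.
have qp : p * (1 + (x ^+ 2 - y ^+ 2)) <= q.
  have -> : q = p * expR (x ^+ 2 - y ^+ 2) by rewrite -expRD; congr expR; ring.
  by rewrite ler_pM2l ?expR_gt0// expR_ge1Dx.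
have p0 : 0 < p by exact: expR_gt0.
have q0 : 0 < q by exact: expR_gt0.
(* The quotient (exp(y^2) - 1) / y is nondecreasing. Together with F x - F y >= e x (x - y) and F y
   <= y this gives the claim. *)
have key : (p - 1) * x <= (q - 1) * y.
  have k1 : (p - 1) * x ^+ 2 <= (q - 1) * y ^+ 2.
    have : p * (x ^+ 2 - y ^+ 2) <= q - p by lra.
    have d0 : 0 <= x ^+ 2 - y ^+ 2 by rewrite subr_ge0 lerXn2r// nnegrE ltW.
    have Y0 : 0 < y ^+ 2 by rewrite exprn_gt0.
    move: pY d0 Y0; move: (x ^+ 2) (y ^+ 2) => X Y; nra.
  have pp : 0 <= p - 1 by have := sqr_ge0 y; lra.
  have k2 : (p - 1) * x * x <= (q - 1) * y * x.
    apply: (@le_trans _ _ ((q - 1) * y * y)); first by rewrite -!mulrA -!expr2.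
    have qq : 0 <= q - 1.
      by rewrite subr_ge0 -expR0 ler_expR sqr_ge0.
    by rewrite ler_wpM2l// mulr_ge0// ltW.
  by rewrite -(ler_pM2r x0).
have exE : e x = q^-1 by apply: (mulIf (lt0r_neq0 q0)); rewrite eq_ mulVf ?gt_eqF.
have eyE : e y = p^-1 by apply: (mulIf (lt0r_neq0 p0)); rewrite ep mulVf ?gt_eqF.
rewrite exE eyE !mulrA ler_pdivrMr// mulrAC ler_pdivlMr//.
rewrite exE in h.
have h' : (x - y) <= (F x - F y) * q by rewrite -ler_pdivrMr// mulrC.
have : (F y * q + (x - y)) * y <= F x * q * y by rewrite ler_pM2r//; lra.
have Fy0 : 0 <= F y by apply: le_trans h2; rewrite mulr_ge0// ltW.
move: key h1 Fy0 yx y0; move: (F x) (F y) => u v key h1 v0 yx y0 hh.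
suff : v * x * p <= v * q * y + (x - y) * y by lra.
have a0 : 0 <= y * (x - y) by rewrite mulr_ge0 ?subr_ge0 ?(ltW y0).
have b : v * (x * p - q * y) <= v * (x - y) by apply: ler_wpM2l => //; lra.
have c : v * (x - y) <= y * (x - y) by apply: ler_wpM2r => //; lra.
lra.
Qed.

Let F_sqr_derive x : 0 < x -> is_derive x 1 (fun z => F z ^+ 2) (2 * F x * e x).
Proof.
move=> x0; have := F_derive x0 => dF.
have -> : 2 * F x * e x = F x *: e x + F x *: e x by rewrite /GRing.scale /=; ring.
have -> : (fun z => F z ^+ 2) = F * F by apply/funext => z; rewrite expr2.
exact: is_deriveM.
Qed.

Let exp_derive_sqr (k x : R) :
  is_derive x 1 (fun z : R => expR (- (k * z ^+ 2))) (- (2 * k * x) * expR (- (k * x ^+ 2))).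
Proof.
have d1 : is_derive x 1 (fun z : R => - (k * z ^+ 2)) (- (2 * k * x)).
  have -> : (fun z : R => - (k * z ^+ 2)) = - (k \*: ((@id R) ^+ 2)).
    by apply/funext => z; rewrite !fctE.
  by apply: is_derive_eq; rewrite /GRing.scale /=; ring.
have := @is_derive1_comp _ expR (fun z : R => - (k * z ^+ 2)) x _ _ (is_derive_expR _) d1.
by rewrite mulrC.
Qed.

Let exp_cvg0 (k : R) : 0 < k -> expR (- (k * z ^+ 2)) @[z --> +oo] --> (0 : R).
Proof.
move=> k0.
have h : (k * z ^+ 2) @[z --> +oo] --> (+oo : set_system R).
  apply/cvgryPge => B; have /cvgryPge/(_ (B / k)) := @cvgr_expr2 R.
  by apply: filterS => z; rewrite ler_pdivrMr// mulrC.
exact: (cvg_comp _ _ h (@cvgr_expR R)).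
Qed.

(** The upper bound is the nonnegativity of [A 2], the lower bound that of [- A 1]. *)
Let A (k z : R) := pi / 4 * (1 - expR (- (k * z ^+ 2))) - F z ^+ 2.
Let dA (k z : R) := pi / 4 * (2 * k * z * expR (- (k * z ^+ 2))) - 2 * F z * e z.

Let A0 k : A k 0 = 0.
Proof. by rewrite /A F0 expr0n /= mulr0 oppr0 expR0 subrr mulr0 addr0. Qed.

Let A_derive (k z : R) : 0 < z -> is_derive z 1 (A k) (dA k z).
Proof.
move=> z0; have d1 := F_sqr_derive z0; have d2 := exp_derive_sqr k z.
have -> : A k = (pi / 4 \*: (cst 1 - (fun y => expR (- (k * y ^+ 2))))) - (fun y => F y ^+ 2).
  by apply/funext => y; rewrite !fctE.
by apply: is_derive_eq; rewrite /GRing.scale /= /dA; ring.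
Qed.

Let A_cont (k z : R) : 0 < z -> {within `[0, z], continuous (A k)}.
Proof.
move=> z0; have cF := F_cont (ltW z0).
have cE : {within `[0, z], continuous (fun y : R => expR (- (k * y ^+ 2)))}.
  by apply: derivable_within_continuous => u _; have [] := exp_derive_sqr k u.
have -> : A k = (cst (pi / 4) * (cst 1 - (fun y => expR (- (k * y ^+ 2))))) - F * F.
  by apply/funext => y; rewrite !fctE /A expr2.
move=> y; apply: cvgB; last by apply: cvgM; exact: cF.
apply: cvgM; first exact: cvg_cst.
by apply: cvgB; [exact: cvg_cst|exact: cE].
Qed.

Let A_lim (k : R) : 0 < k -> A k z @[z --> +oo] --> 0.
Proof.
move=> k0; have -> : 0 = pi / 4 * (1 - 0) - pi / 4 :> R by ring.
apply: cvgB; last exact: cvg_integral0_gauss_sqr.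
apply: cvgM; first exact: cvg_cst.
apply: cvgB; [exact: cvg_cst|exact: exp_cvg0].
Qed.

(** The square of F is the integral of exp(-|u|^2) over a square of side x, and the two bounds are
    the integrals over the quarter discs of radii x and sqrt 2 x, inscribed and circumscribed. The
    proof compares derivatives instead of using a plane integral. *)
Lemma finite_gauss_sqr x : 0 <= x ->
  pi / 4 * (1 - expR (- (1 * x ^+ 2))) <= F x ^+ 2 <= pi / 4 * (1 - expR (- (2 * x ^+ 2))).
Proof.
move=> x0.
have pi40 : 0 < pi / 4 :> R by rewrite divr_gt0// pi_gt0.
apply/andP; split.
- have : 0 <= - A 1 x; last by rewrite /A; lra.
  apply: (@ge0_of_derive_sign R (fun z => - A 1 z) (fun z => - dA 1 z)) x0.
  + by rewrite A0 oppr0.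
  + by move=> z z0; have dA1 := A_derive 1 z0; apply: is_deriveN.
  + by move=> z z0 y; apply: cvgN; exact: A_cont.
  + by rewrite -oppr0; apply: cvgN; exact: A_lim.
  + move=> z z0.
    have dE y : - dA 1 y = 2 * e y * (F y - pi / 4 * y).
      by rewrite /dA /e /gauss_fun !mul1r; ring.
    have [h|h] := leP (pi / 4 * z) (F z); [left|right] => y.
      move=> /andP[y0 yz]; rewrite dE mulr_ge0 ?subr_ge0 ?mulr_ge0// ?(ltW (e_gt0 _))//.
      have := F_slope y0 (ltW yz); rewrite -(ler_pM2r z0).
      have : pi / 4 * z * y <= F z * y by rewrite ler_pM2r.
      by lra.
    move=> zy; rewrite dE mulr_ge0_le0 ?subr_le0 ?mulr_ge0// ?(ltW (e_gt0 _))//.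
    have := F_slope z0 (ltW zy); rewrite -(ler_pM2r z0).
    have : F z * y <= pi / 4 * z * y by rewrite ler_pM2r ?(lt_trans z0)// ltW.
    by lra.
- have : 0 <= A 2 x; last by rewrite /A; lra.
  apply: (@ge0_of_derive_sign R (A 2) (dA 2)) x0.
  + exact: A0.
  + by move=> z z0; exact: A_derive.
  + exact: A_cont.
  + exact: A_lim.
  + move=> z z0.
    have dE y : dA 2 y = 2 * e y * (pi / 2 * (y * e y) - F y).
      rewrite /dA; have -> : expR (- (2 * y ^+ 2)) = e y * e y.
        by rewrite /e /gauss_fun -expRD; congr expR; ring.
      by field.
    have ze y : 0 < y -> 0 < y * e y by move=> y0; rewrite mulr_gt0// e_gt0.
    have [h|h] := leP (F z) (pi / 2 * (z * e z)); [left|right] => y.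
      move=> /andP[y0 yz]; rewrite dE mulr_ge0 ?subr_ge0 ?mulr_ge0// ?(ltW (e_gt0 _))//.
      have := F_ratio y0 (ltW yz); rewrite -(ler_pM2r (ze z z0)).
      have : F z * (y * e y) <= pi / 2 * (z * e z) * (y * e y) by rewrite ler_pM2r// ze.
      by lra.
    move=> zy; rewrite dE mulr_ge0_le0 ?subr_le0 ?mulr_ge0// ?(ltW (e_gt0 _))//.
    have y0 : 0 < y by exact: lt_trans zy.
    have := F_ratio z0 (ltW zy); rewrite -(ler_pM2r (ze z z0)).
    have : pi / 2 * (z * e z) * (y * e y) <= F z * (y * e y) by rewrite ler_pM2r ?ze// ltW.
    by lra.
Qed.

Lemma gauss_primitive (c : R) : 0 < c -> exists E : R -> R, [/\ E 0 = 0,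
  forall x y, 0 <= x -> x <= y -> gauss c y * (y - x) <= E y - E x <= gauss c x * (y - x) &
  forall x, 0 <= x ->
    pi / c * (1 - expR (- (c * x ^+ 2))) <= (2 * E x) ^+ 2 <=
    pi / c * (1 - expR (- (2 * (c * x ^+ 2))))].
Proof.
move=> c0; pose s := Num.sqrt c; have s0 : 0 < s by rewrite sqrtr_gt0.
have ss : s ^+ 2 = c by rewrite sqr_sqrtr// ltW.
have ge x : gauss c x = e (s * x) by rewrite /gauss /e /gauss_fun exprMn ss.
exists (fun x => F (s * x) / s); split.
- by rewrite mulr0 F0 mul0r.
- move=> x y x0 xy; have sx : 0 <= s * x by rewrite mulr_ge0// ltW.
  have sxy : s * x <= s * y by rewrite ler_pM2l.
  have := F_itv sx sxy; rewrite !ge -mulrBl ler_pdivlMr// ler_pdivrMr//.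
  by rewrite -mulrBr -![e _ * (y - x) * s]mulrA ![(y - x) * s]mulrC.
- move=> x x0; have sx : 0 <= s * x by rewrite mulr_ge0// ltW.
  have := finite_gauss_sqr sx; rewrite mul1r !exprMn ss exprVn ss.
  have ci : 0 < c^-1 by rewrite invr_gt0.
  move=> /andP[h1 h2]; apply/andP; split.
    by have := h1; rewrite -(ler_pM2r ci); lra.
  by have := h2; rewrite -(ler_pM2r ci); lra.
Qed.

End FiniteGaussian.

(** * The characteristic function near the origin *)

Section TaylorBounds.
Variable R : realType.
Implicit Types x : R.

(** The Taylor bounds below form a chain: each difference vanishes at 0 and has the preceding
    difference as its derivative. *)
Lemma ge0_of_derive_ge0 (f df : R -> R) : f 0 = 0 ->
  (forall x : R, is_derive x 1 f (df x)) -> (forall x, 0 <= x -> 0 <= df x) ->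
  forall x, 0 <= x -> 0 <= f x.
Proof.
move=> f0 df_ df0 x; rewrite le_eqVlt => /predU1P[<-|x0]; first by rewrite f0.
have [|z] := @MVT _ f df 0 x x0 (fun z _ => df_ z).
- by apply: derivable_within_continuous => z _; have [] := df_ z.
- rewrite in_itv/= => /andP[z0 _]; rewrite f0 !subr0 => ->.
  by rewrite mulr_ge0 ?df0// ltW.
Qed.

Lemma is_derive1_congr (f g : R -> R) (z d d' : R) :
  f =1 g -> is_derive z 1 g d -> d = d' -> is_derive z 1 f d'.
Proof. by move=> /funext -> h <-. Qed.

Lemma is_derive_monomial (k : R) n (z : R) :
  is_derive z 1 (fun y : R => k * y ^+ n) (k * (n%:R * z ^+ n.-1)).
Proof.
apply: (@is_derive1_congr _ (cst k * ((@id R) ^+ n))) => [y|]; first by rewrite !fctE.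
by rewrite -![_ *: _]/(_ * _) /=; ring.
Qed.

Let sin_le_pos x : 0 <= x -> sin x <= x.
Proof.
move=> x0; rewrite -subr_ge0.
apply: (@ge0_of_derive_ge0 (fun z : R => z - sin z) (fun z : R => 1 - cos z)) x0.
- by rewrite sin0 subr0.
- by move=> z _; rewrite subr_ge0 cos_le1.
Qed.

Let cos_ge_pos x : 0 <= x -> 1 - x ^+ 2 / 2 <= cos x.
Proof.
move=> x0; rewrite -subr_ge0.
apply: (@ge0_of_derive_ge0 (fun z : R => cos z - (1 - z ^+ 2 / 2)) (fun z : R => z - sin z)) x0.
- by rewrite cos0; lra.
- move=> z.
  apply: (@is_derive1_congr _ (cos - (cst 1 - cst 2^-1 * ((@id R) ^+ 2)))) => [y|].
    by rewrite !fctE /=; ring.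
  by rewrite -![_ *: _]/(_ * _) /=; field.
- by move=> z z0; rewrite subr_ge0 sin_le_pos.
Qed.

Let sin_ge_pos x : 0 <= x -> x - x ^+ 3 / 6 <= sin x.
Proof.
move=> x0; rewrite -subr_ge0.
apply: (@ge0_of_derive_ge0 (fun z : R => sin z - (z - z ^+ 3 / 6)) (fun z : R => cos z - (1 - z ^+ 2 / 2))) x0.
- by rewrite sin0; lra.
- move=> z.
  apply: (@is_derive1_congr _ (sin - (id - cst 6^-1 * ((@id R) ^+ 3)))) => [y|].
    by rewrite !fctE /=; ring.
  by rewrite -![_ *: _]/(_ * _) /=; field.
- by move=> z z0; rewrite subr_ge0 cos_ge_pos.
Qed.

Let cos_le_pos x : 0 <= x -> cos x <= 1 - x ^+ 2 / 2 + x ^+ 4 / 24.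
Proof.
move=> x0; rewrite -subr_ge0.
apply: (@ge0_of_derive_ge0 (fun z : R => 1 - z ^+ 2 / 2 + z ^+ 4 / 24 - cos z)
  (fun z : R => sin z - (z - z ^+ 3 / 6))) x0.
- by rewrite cos0; lra.
- move=> z.
  have d2 := is_derive_monomial 2^-1 2 z; have d4 := is_derive_monomial 24^-1 4 z.
  apply: (@is_derive1_congr _ (cst 1 - (fun y : R => 2^-1 * y ^+ 2) + (fun y : R => 24^-1 * y ^+ 4) - cos) _ _ _ _
    (is_deriveB (is_deriveD (is_deriveB (is_derive_cst _ _ _) d2) d4) (is_derive_cos _))) => [y|].
    by rewrite !fctE /=; field.
  by rewrite /=; field.
- by move=> z z0; rewrite subr_ge0 sin_ge_pos.
Qed.

Lemma cos_ge_deg2 x : 1 - x ^+ 2 / 2 <= cos x.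
Proof.
have [x0|/ltW x0] := leP 0 x; first exact: cos_ge_pos.
by have := @cos_ge_pos (- x); rewrite oppr_ge0 cosN sqrrN => /(_ x0).
Qed.

Lemma cos_le_deg4 x : cos x <= 1 - x ^+ 2 / 2 + x ^+ 4 / 24.
Proof.
have [x0|/ltW x0] := leP 0 x; first exact: cos_le_pos.
have := @cos_le_pos (- x); rewrite oppr_ge0 cosN sqrrN => /(_ x0).
by rewrite (_ : (- x) ^+ 4 = x ^+ 4) //; ring.
Qed.

Lemma dist_sin_deg3 x : `|sin x - x| <= `|x| ^+ 3 / 6.
Proof.
suff pos (y : R) : 0 <= y -> `|sin y - y| <= y ^+ 3 / 6.
  have [x0|/ltW x0] := leP 0 x; first by rewrite (ger0_norm x0) pos.
  have := @pos (- x); rewrite oppr_ge0 sinN -opprD normrN => /(_ x0).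
  by rewrite (ler0_norm x0).
move=> y0; have h1 := sin_le_pos y0; have h2 := sin_ge_pos y0.
rewrite ler_norml; apply/andP; split; first by lra.
have : 0 <= y ^+ 3 by rewrite exprn_ge0.
by lra.
Qed.

Lemma expRN_le_deg2 x : 0 <= x -> expR (- x) <= 1 - x + x ^+ 2 / 2.
Proof.
move=> x0; rewrite -subr_ge0.
have dE (z : R) : is_derive z 1 (fun y : R => expR (- y)) (- expR (- z)).
  have := @is_derive1_comp _ expR (fun y : R => - y) z _ _ (is_derive_expR _) (is_deriveNid _ _).
  by rewrite mulrN1.
apply: (@ge0_of_derive_ge0 (fun z : R => 1 - z + z ^+ 2 / 2 - expR (- z))
  (fun z : R => expR (- z) - (1 - z))) x0.
- by rewrite oppr0 expR0; lra.
- move=> z; have d := dE z.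
  have d2 := is_derive_monomial 2^-1 2 z.
  apply: (@is_derive1_congr _ (cst 1 - id + (fun y : R => 2^-1 * y ^+ 2) - (fun y : R => expR (- y))) _ _ _ _
    (is_deriveB (is_deriveD (is_deriveB (is_derive_cst _ _ _) (is_derive_id _ _)) d2) d)) => [y|].
    by rewrite !fctE /=; field.
  by rewrite /=; field.
- by move=> z z0; rewrite subr_ge0 expR_ge1Dx.
Qed.

End TaylorBounds.

Section LocalExpansion.
Variable R : realType.

Definition cis (x : R) : R[i] := (cos x +i* sin x)%C.

Lemma cisD x y : cis (x + y) = cis x * cis y.
Proof. by rewrite /cis cosD sinD; apply/eqP; rewrite eq_complex /= eqxx addrC eqxx. Qed.

Lemma cis0 : cis 0 = 1.
Proof. by rewrite /cis cos0 sin0. Qed.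

Lemma normc_cis x : Normc.normc (cis x) = 1.
Proof. by rewrite /cis /= cos2Dsin2 sqrtr1. Qed.

Lemma normcX (z : R[i]) n : Normc.normc (z ^+ n) = Normc.normc z ^+ n.
Proof.
elim: n => [|n IH]; first by rewrite !expr0 Normc.normc1.
by rewrite !exprS Normc.normcM IH.
Qed.

Lemma Re_le_normc (z : R[i]) : complex.Re z <= Normc.normc z.
Proof.
case: z => a b /=; apply: (le_trans (ler_norm a)).
by rewrite -sqrtr_sqr ler_wsqrtr// lerDl sqr_ge0.
Qed.

(** In the application a + i b is the mean of exp(i X) over the k-sets, Q the mean of X^2, and eps =
    d delta a bound for |X|. The bound on b is cubic because X has mean 0. *)
Variables (a b Q eps : R).
Hypotheses (Q0 : 0 <= Q) (Qe : Q <= eps ^+ 2) (e0 : 0 <= eps) (e1 : eps < 1).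
Hypotheses (a_ge : 1 - Q / 2 <= a) (a_le : a <= 1 - Q / 2 + eps ^+ 2 * Q / 24).
Hypothesis b_le : `|b| <= eps ^+ 3 / 6.

Let e2 : eps ^+ 2 < 1.
Proof. by rewrite expr_lt1// -normr_lt1 ger0_norm. Qed.

Let a_half : 2^-1 <= a.
Proof. by apply: le_trans a_ge; have := e2; have := Qe; lra. Qed.

Let b2 : b ^+ 2 <= a ^+ 2 * (4^-1 * eps ^+ 6).
Proof.
have h : b ^+ 2 <= (eps ^+ 3 / 6) ^+ 2.
  by rewrite -[b ^+ 2]real_normK ?num_real// lerXn2r// nnegrE// (le_trans _ b_le).
have a2 : 4^-1 <= a ^+ 2 by have := a_half; nra.
have e6 : 0 <= eps ^+ 6 by rewrite exprn_ge0.
apply: (le_trans h); rewrite (_ : (eps ^+ 3 / 6) ^+ 2 = eps ^+ 6 / 36); last by field.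
by move: a2 e6; move: (a ^+ 2) (eps ^+ 6) => A E; nra.
Qed.

(** The first factor compares the modulus with the real part a. The second pays for the quartic term
    of the cosine: a <= (1 + eps^4/3)(1 - Q/2), and 1 - Q/2 <= exp(-Q/2). *)
Lemma normc_near_peak_le t :
  Normc.normc (a +i* b)%C ^+ t <= (1 + 4^-1 * eps ^+ 6) `^ (t%:R / 2) *
    (1 + 3^-1 * eps ^+ 4) ^+ t * expR (- (t%:R * (Q / 2))).
Proof.
have a0 : 0 <= a by apply: le_trans a_half; rewrite invr_ge0.
have e6 : 0 <= eps ^+ 6 by rewrite exprn_ge0.
have e4 : 0 <= eps ^+ 4 by rewrite exprn_ge0.
have s0 : 0 <= 1 + 4^-1 * eps ^+ 6 by lra.
have -> : (1 + 4^-1 * eps ^+ 6) `^ (t%:R / 2) = Num.sqrt (1 + 4^-1 * eps ^+ 6) ^+ t.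
  by rewrite (mulrC t%:R) powRrM powR12_sqrt// powR_mulrn ?sqrtr_ge0.
have -> : expR (- (t%:R * (Q / 2))) = expR (- (Q / 2)) ^+ t.
  by rewrite -expRM_natl mulrN.
rewrite -!exprMn; apply: lerXn2r; rewrite ?nnegrE /=.
- exact: sqrtr_ge0.
- by rewrite !mulr_ge0 ?sqrtr_ge0 ?expR_ge0//; lra.
apply: (@le_trans _ _ (a * Num.sqrt (1 + 4^-1 * eps ^+ 6))).
  rewrite -[X in X * _](ger0_norm a0) -sqrtr_sqr -sqrtrM ?sqr_ge0// ler_wsqrtr//.
  by have := b2; lra.
rewrite mulrC -mulrA ler_wpM2l ?sqrtr_ge0//.
have ex : 1 - Q / 2 <= expR (- (Q / 2)) by exact: expR_ge1Dx.
apply: (@le_trans _ _ ((1 + 3^-1 * eps ^+ 4) * (1 - Q / 2))); last first.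
  by rewrite ler_wpM2l//; lra.
apply: (le_trans a_le).
have -> : eps ^+ 4 = (eps ^+ 2) ^+ 2 by ring.
by move: e2 Qe Q0; move: (eps ^+ 2) => E; nra.
Qed.

Lemma Re_near_peak_ge (t : nat) : t%:R * eps ^+ 3 < 2 ->
  (1 + t%:R ^+ 2 * eps ^+ 6) `^ (- 2^-1) * (1 - 3^-1 * eps ^+ 4) ^+ t *
    expR (- (t%:R * (Q / 2))) <= complex.Re ((a +i* b)%C ^+ t).
Proof.
move=> te.
have a0 : 0 < a by apply: lt_le_trans a_half; rewrite invr_gt0.
have e30 : 0 <= eps ^+ 3 by rewrite exprn_ge0.
have e40 : 0 <= eps ^+ 4 by rewrite exprn_ge0.
have e4 : eps ^+ 4 <= 1 by rewrite exprn_ile1// ltW.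
pose s := b / a.
have sle : `|s| <= eps ^+ 3 / 3.
  rewrite normrM normfV (gtr0_norm a0) ler_pdivrMr//; apply: (le_trans b_le).
  by have := a_half; move: (eps ^+ 3) e30 => E; nra.
have zE : (a +i* b)%C = a%:C%C * (1 +i* s)%C.
  by apply/eqP; rewrite eq_complex /= /s !mul0r mulr1 subr0 addr0 mulrC divfK ?eqxx// gt_eqF.
have XC (x : R) n : complex.Re (x%:C%C ^+ n * (1 +i* s)%C ^+ n) = x ^+ n * complex.Re ((1 +i* s)%C ^+ n).
  by rewrite -rmorphXn /=; case: ((1 +i* s)%C ^+ n) => u v /=; rewrite mul0r subr0.
rewrite zE exprMn XC.
have ts : t%:R * `|s| < 1.
  by apply: (@le_lt_trans _ _ (t%:R * eps ^+ 3 / 3)); [rewrite -mulrA ler_wpM2l|lra].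
(* The powers of 1 + i s are followed without their argument. The imaginary part keeps the sign of
   s, so the real part only decreases, by |s| times a quantity of size at most n |s| at each step;
   the three claims need one another. *)
have rec n : n%:R * `|s| <= 1 ->
    let u := (1 +i* s)%C ^+ n in
    [/\ 1 - (n%:R * `|s|) ^+ 2 <= complex.Re u <= 1,
       0 <= complex.Im u * Num.sg s & `|complex.Im u| <= n%:R * `|s|].
  elim: n => [|n IH] ns /=; first by rewrite !mul0r normr0 expr0n subr0 lexx.
  have ns' : n%:R * `|s| <= 1 by apply: le_trans ns; rewrite ler_wpM2r// ler_nat.
  have [/andP[r1 r2] i1 i2] := IH ns'; rewrite (exprS (1 +i* s)%C n).
  case: ((1 +i* s)%C ^+ n) r1 r2 i1 i2 => x y /= r1 r2 i1 i2.
  rewrite !mul1r.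
  have sE : s = Num.sg s * `|s| by rewrite -numEsg.
  have yE : s * y = `|s| * `|y|.
    rewrite -normrM ger0_norm// mulrC {1}sE mulrA mulr_ge0//.
  have sg0 : 0 <= s * Num.sg s by rewrite mulrC -normrEsg.
  have x0 : 0 <= x.
    apply: le_trans r1; rewrite subr_ge0 expr_le1// mulr_ge0//.
  have n0 : 0 <= n%:R :> R by [].
  have nS : n.+1%:R = n%:R + 1 :> R by rewrite natr1.
  split.
  - rewrite yE; have q0 := normr_ge0 s; have q1 := normr_ge0 y.
    have q2 : 0 <= `|s| * `|y| by rewrite mulr_ge0.
    have q3 : `|s| * `|y| <= `|s| * (n%:R * `|s|) by rewrite ler_wpM2l.
    rewrite nS; apply/andP; split; last by lra.
    have q4 : 0 <= n%:R * `|s| * `|s| by rewrite !mulr_ge0.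
    have q5 : 0 <= `|s| * `|s| by rewrite mulr_ge0.
    by lra.
  - by rewrite mulrDl addr_ge0// mulrAC mulr_ge0.
  - apply: (le_trans (ler_normD _ _)); rewrite nS mulrDl mul1r normrM (ger0_norm x0).
    by apply: lerD => //; rewrite ler_piMr.
have [/andP[re1 _] _ _] := rec t (ltW ts).
rewrite -mulrA mulrC.
have ex : expR (- (Q / 2)) <= 1 - Q / 2 + (Q / 2) ^+ 2 / 2.
  by apply: expRN_le_deg2; have := Q0; lra.
have aexp : ((1 - 3^-1 * eps ^+ 4) * expR (- (Q / 2))) ^+ t <= a ^+ t.
  apply: lerXn2r; rewrite ?nnegrE ?(ltW a0)//.
    by rewrite mulr_ge0 ?expR_ge0//; lra.
  apply: le_trans a_ge.
  apply: (@le_trans _ _ ((1 - 3^-1 * eps ^+ 4) * (1 - Q / 2 + (Q / 2) ^+ 2 / 2))).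
    by apply: ler_wpM2l => //; lra.
  have E4 : eps ^+ 4 = (eps ^+ 2) ^+ 2 by ring.
  have Q2 : Q ^+ 2 <= eps ^+ 4 by rewrite E4 lerXn2r// nnegrE// (le_trans Q0).
  have Q1 : Q <= 1 by have := e2; have := Qe; lra.
  move: Q2 Q1 Q0 e40 e4; move: (eps ^+ 4) => E; rewrite expr2 => ? ? ? ? ?; nra.
have -> : (1 - 3^-1 * eps ^+ 4) ^+ t * expR (- (t%:R * (Q / 2))) =
    ((1 - 3^-1 * eps ^+ 4) * expR (- (Q / 2))) ^+ t.
  by rewrite exprMn -expRM_natl mulrN.
apply: ler_pM => //.
- by rewrite exprn_ge0// mulr_ge0 ?expR_ge0//; lra.
- exact: powR_ge0.
apply: le_trans re1.
have -> : t%:R ^+ 2 * eps ^+ 6 = (t%:R * eps ^+ 3) ^+ 2 by ring.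
(* As t |s| <= y / 3, what remains is 1 - y^2/9 >= (1 + y^2)^(-1/2), which holds because y < 2. *)
set y := t%:R * eps ^+ 3.
have y0 : 0 <= y by rewrite mulr_ge0.
have ys : t%:R * `|s| <= y / 3 by rewrite -mulrA ler_wpM2l.
have ty2 : (t%:R * `|s|) ^+ 2 <= (y / 3) ^+ 2.
  by rewrite lerXn2r// nnegrE ?mulr_ge0.
rewrite powRN powR12_sqrt; last by rewrite addr_ge0// sqr_ge0.
have yy : y ^+ 2 < 4 by rewrite -/y in te; nra.
have y20 := sqr_ge0 y.
set v := Num.sqrt _.
have v0 : 0 < v by rewrite sqrtr_gt0; lra.
have vv : v ^+ 2 = 1 + y ^+ 2 by rewrite sqr_sqrtr; lra.
apply: (@le_trans _ _ (1 - (y / 3) ^+ 2)); last by lra.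
have -> : (y / 3) ^+ 2 = y ^+ 2 / 9 by field.
set w := 1 - _; have w0 : 0 <= w by rewrite /w; lra.
rewrite -[leLHS]mul1r ler_pdivrMr// leNgt; apply/negP => h.
have : (w * v) ^+ 2 < 1 by rewrite expr_lt1// mulr_ge0// ltW.
rewrite exprMn vv /w; move: yy y20; move: (y ^+ 2) => z; nra.
Qed.

End LocalExpansion.

(** * The peaks of the characteristic function *)

Section Edges.
Local Open Scope set_scope.
Variable v : nat.
Implicit Types (a : 'I_('C(v, 2))) (i j x : 'I_v) (A : {set 'I_v}).

Lemma mem_lex_pairs i j : ((i, j) \in lex_pairs v) = (i < j)%N.
Proof.
rewrite mem_filter /= andb_idr// => _.
by apply/allpairsP; exists (i, j); rewrite !mem_enum.
Qed.

Lemma lex_pairs_uniq : uniq (lex_pairs v).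
Proof.
apply: filter_uniq; apply: allpairs_uniq; rewrite ?enum_uniq//.
by move=> [? ?] [? ?].
Qed.

Lemma lex_pair_lt a : ((lex_pair a).1 < (lex_pair a).2)%N.
Proof.
by rewrite -mem_lex_pairs -surjective_pairing; apply: (mem_tnth a (Tuple (size_lex_pairs v))).
Qed.

Lemma lex_pair_neq a : (lex_pair a).1 != (lex_pair a).2.
Proof. by apply: contraTneq (lex_pair_lt a) => ->; rewrite ltnn. Qed.

Lemma lex_pair_inj : injective (@lex_pair v).
Proof.
move=> a b; rewrite /lex_pair => e; apply/val_inj/eqP.
have := nth_uniq (lex_pair a) _ _ lex_pairs_uniq.
rewrite (eqP (size_lex_pairs v)) => /(_ a b (ltn_ord a) (ltn_ord b)) <-.
by rewrite -!(tnth_nth _ (Tuple (size_lex_pairs v))) e.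
Qed.

Lemma edge_inj : injective (@edge v).
Proof.
move=> a b e; apply: lex_pair_inj; move: (lex_pair_lt a) (lex_pair_lt b) e.
rewrite /edge; case: (lex_pair a) => i j; case: (lex_pair b) => i' j' /= ij ij' e.
have : i \in [set i'; j'] by rewrite -e set21.
have : j \in [set i'; j'] by rewrite -e set22.
have : i' \in [set i; j] by rewrite e set21.
have : j' \in [set i; j] by rewrite e set22.
rewrite !inE -!val_eqE /= => h1 h2 h3 h4; congr (_, _); apply/val_inj => /=; lia.
Qed.

Lemma edge_surj i j : i != j -> exists a, edge a = [set i; j].
Proof.
wlog ij : i j / (i < j)%N.
  move=> H ij; have [l|l|/val_inj e] := ltngtP i j; first exact: H.
    by have [|a e] := H j i l; [rewrite eq_sym|exists a; rewrite e finset.setUC].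
  by rewrite e eqxx in ij.
move=> _; have := ij; rewrite -mem_lex_pairs => /(tnthP (Tuple (size_lex_pairs v)))[a e].
by exists a; rewrite /edge /lex_pair -e.
Qed.

Lemma card_edge a : #|edge a| = 2.
Proof. by rewrite cards2 lex_pair_neq. Qed.

(** A pair inside [x |: A] that is not inside A joins x to a point of A. The booleans are read as
    numbers, ready for the weighted sums of [phase_setU1]. *)
Lemma edge_sub_setU1 a x A : x \notin A ->
  (edge a \subset x |: A : nat) = ((edge a \subset A) + \sum_(b in A) (edge a == [set b; x]))%N.
Proof.
move=> xA; rewrite /edge; move: (lex_pair_neq a); case: (lex_pair a) => p q /= pq.
rewrite !finset.subUset !finset.sub1set !inE.
have sumE y z : y != x -> (\sum_(b in A) ([set y; z] == [set b; x]) = ((y \in A) && (z == x)))%N.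
  move=> yx; have E b : ([set y; z] == [set b; x]) = (b == y) && (z == x).
    apply/eqP/andP => [e|[/eqP -> /eqP -> //]].
    have : y \in [set b; x] by rewrite -e set21.
    have : x \in [set y; z] by rewrite e set22.
    by rewrite !inE (negPf yx) (eq_sym x y) (negPf yx) /= orbF eq_sym => /eqP <- /eqP ->; rewrite !eqxx.
  have [yA|yA] := boolP (y \in A).
    rewrite (bigD1 y)//= E eqxx big1 ?addn0// => b /andP[_ by_].
    by rewrite E (negPf by_).
  by rewrite big1// => b bA; rewrite E; case: eqP => // bE; rewrite -bE bA in yA.
have [px|px] := eqVneq p x; last first.
  by rewrite sumE//; case: (eqVneq q x) => [->|_]; rewrite /= ?(negPf xA) ?andbT ?andbF ?addn0.
subst p; have qx : q != x by rewrite eq_sym.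
by rewrite (negPf xA) /= add0n finset.setUC sumE// eqxx andbT (negPf qx).
Qed.

End Edges.

Lemma edge_last n (a : 'I_('C(n.+2, 2))) : a.+1 = 'C(n.+2, 2) ->
  edge a = [set inord n; ord_max]%SET.
Proof.
move=> e; rewrite /edge /lex_pair.
have -> : tnth (Tuple (size_lex_pairs n.+2)) a = last (ord0, ord0) (lex_pairs n.+2).
  rewrite (tnth_nth (ord0, ord0)) /=; have := eqP (size_lex_pairs n.+2).
  move: e; move: (nat_of_ord a) => m <-.
  by case: (lex_pairs n.+2) => // q s [<-]; rewrite (last_nth (ord0, ord0)).
by rewrite last_lex_pairs.
Qed.

(** * Angles modulo 2 pi and fractions of the full turn *)

Section Angles.
Variable R : realType.
Implicit Types (x y r s : R) (z u : int).

Definition near_2pi x r := exists u, `|x - 2 * pi * u%:~R| < r.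

Lemma near_2piD x y r s : near_2pi x r -> near_2pi y s -> near_2pi (x + y) (r + s).
Proof.
move=> [u hu] [w hw]; exists (u + w).
have -> : x + y - 2 * pi * (u + w)%:~R = (x - 2 * pi * u%:~R) + (y - 2 * pi * w%:~R).
  by rewrite intrD; ring.
by apply: (le_lt_trans (ler_normD _ _)); lra.
Qed.

Lemma near_2piN x r : near_2pi x r -> near_2pi (- x) r.
Proof.
move=> [u hu]; exists (- u); rewrite -normrN; congr (`|_| < _): hu.
by rewrite mulrNz; ring.
Qed.

Lemma near_2piB x y r s : near_2pi x r -> near_2pi y s -> near_2pi (x - y) (r + s).
Proof. by move=> hx hy; apply: near_2piD => //; exact: near_2piN. Qed.

Lemma near_2pi_shift x r u : near_2pi (x + 2 * pi * u%:~R) r <-> near_2pi x r.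
Proof.
split=> -[w hw]; [exists (w - u)|exists (w + u)]; congr (`|_| < _): hw;
  by rewrite ?intrB ?intrD; ring.
Qed.

(** Nonemptiness matters: the inequality in [near_2pi] is strict, and an empty sum would need radius
    0. *)
Lemma near_2pi_sum (I : finType) (B : {set I}) (f : I -> R) r :
  (forall i, i \in B -> near_2pi (f i) r) -> (0 < #|B|)%N ->
  near_2pi (\sum_(i in B) f i) (#|B|%:R * r).
Proof.
move=> hf; elim: {B}_.+1 {-2}B (ltnSn #|B|) hf => // m IH B Bm hf B0.
have /card_gt0P[b bB] := B0.
rewrite (big_setD1 b)//= (cardsD1 b) bB natrD mulrDl mul1r.
have [e|ne] := posnP #|(B :\ b)%SET|.
  rewrite e mul0r addr0 (cards0_eq e) big_set0 addr0; exact: hf.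
apply: near_2piD; first exact: hf.
apply: IH => //; first by move: Bm; rewrite (cardsD1 b B) bB.
by move=> i; rewrite !inE => /andP[_]; exact: hf.
Qed.

Variable K : nat.

Let K_neq0 : K.+1%:R != 0 :> R. Proof. by rewrite pnatr_eq0. Qed.

(** Closeness of x to z/(K+1) of a full turn. Only the class of z modulo K+1 matters; K+1 stands for
    k-1. *)
Definition near_frac x z r := near_2pi (x - 2 * pi * z%:~R / K.+1%:R) r.

Lemma near_fracD x y z u r s : near_frac x z r -> near_frac y u s ->
  near_frac (x + y) (z + u) (r + s).
Proof.
move=> hx hy; rewrite /near_frac.
have -> : x + y - 2 * pi * (z + u)%:~R / K.+1%:R =
  (x - 2 * pi * z%:~R / K.+1%:R) + (y - 2 * pi * u%:~R / K.+1%:R).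
  by rewrite intrD; have := K_neq0; move: (K.+1%:R : R) => c c0; field.
exact: near_2piD.
Qed.

Lemma near_fracN x z r : near_frac x z r -> near_frac (- x) (- z) r.
Proof.
move=> /near_2piN; rewrite /near_frac; congr near_2pi.
by rewrite mulrNz; have := K_neq0; move: (K.+1%:R : R) => c c0; field.
Qed.

Lemma near_fracB x y z u r s : near_frac x z r -> near_frac y u s ->
  near_frac (x - y) (z - u) (r + s).
Proof. by move=> hx hy; apply: near_fracD => //; exact: near_fracN. Qed.

Lemma near_frac0 x r : near_2pi x r -> near_frac x 0 r.
Proof. by rewrite /near_frac mulr0 mul0r subr0. Qed.

Lemma near_frac_congr x z u r : (K.+1 %| z - u)%Z -> near_frac x z r -> near_frac x u r.
Proof.
move=> /dvdzP[q e] h; rewrite /near_frac -(near_2pi_shift _ _ (- q)).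
congr near_2pi: h; have -> : z = u + q * K.+1 by lia.
by rewrite intrD intrM mulrNz -pmulrn; have := K_neq0; move: (K.+1%:R : R) => c c0; field.
Qed.

Lemma near_frac_uniq x z u r s : near_frac x z r -> near_frac x u s ->
  r + s <= 2 * pi / K.+1%:R -> (K.+1 %| z - u)%Z.
Proof.
move=> hx hy rs; have := near_fracB hx hy; rewrite subrr => -[w].
have K0 : 0 < K.+1%:R :> R by [].
pose D : int := (z - u) + w * K.+1%:Z.
have -> : 0 - 2 * pi * (z - u)%:~R / K.+1%:R - 2 * pi * w%:~R = - (2 * pi / K.+1%:R * D%:~R) :> R.
  by rewrite /D !intrD intrM -pmulrn; have := K_neq0; move: (K.+1%:R : R) => c c0; field.
have p0 : 0 < 2 * pi / K.+1%:R :> R by rewrite divr_gt0// mulr_gt0// pi_gt0.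
rewrite normrN normrM (gtr0_norm p0) => h.
have : `|D%:~R| < 1 :> R by rewrite -(ltr_pM2l p0) mulr1; exact: lt_le_trans rs.
rewrite -intr_norm -[1]/(1%:~R) ltr_int => D1.
by apply/dvdzP; exists (- w); rewrite /D in D1; lia.
Qed.

(** Division by K+1 recovers an angle only up to multiples of 2 pi / (K+1): this is the origin of
    the fractions that describe the peaks. *)
Lemma near_frac_of_mul x r : near_2pi (K.+1%:R * x) (K.+1%:R * r) ->
  exists z : 'I_K.+1, near_frac x z%:Z r.
Proof.
move=> [u hu].
have K0 : 0 < K.+1%:R :> R by [].
have hz : (`|(u %% K.+1)%Z| < K.+1)%N.
  by have := modz_ge0 u (_ : K.+1%:Z != 0); have := ltz_pmod u (_ : 0 < K.+1%:Z); lia.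
exists (Ordinal hz) => /=.
have -> : (`|(u %% K.+1)%Z|%N : int) = (u %% K.+1)%Z by rewrite gez0_abs// modz_ge0.
apply: (@near_frac_congr _ u).
  by rewrite {1}(divz_eq u K.+1) addrK dvdz_mull.
exists 0; rewrite mulr0 subr0 -(ltr_pM2l K0) -[X in X * `|_|](gtr0_norm K0) -normrM.
by congr (`|_| < _): hu; have := K_neq0; move: (K.+1%:R : R) => c c0; field.
Qed.

End Angles.

Lemma exists_subset_card (T : finType) (S : {set T}) m : (m <= #|S|)%N ->
  exists2 B : {set T}, B \subset S & #|B| = m.
Proof.
move=> mS; exists [set x in take m (enum S)]%SET.
  by apply/fintype.subsetP => x; rewrite inE => /mem_take; rewrite mem_enum.
rewrite cardsE (card_uniqP _) ?take_uniq ?enum_uniq// size_take -cardE.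
by case: ltngtP mS => // ->.
Qed.

Section Peaks.
Local Open Scope set_scope.
Variables (R : realType) (v k : nat).
Hypothesis hvk : (k.+2 <= v)%N.
Let d := 'C(v.+2, 2).
Variable lam : 'I_d.-1 -> R.
Implicit Types (a : 'I_d.-1) (i j l q x : 'I_v.+2) (A B : {set 'I_v.+2}).

(* The last pair {v, v+1} has been deleted from the coordinates: its weight is 0. *)
Definition edge' a : {set 'I_v.+2} := edge (widen_ord (leq_pred d) a).

(** The centering constant is left out, since only differences of phases are used. *)
Definition phase A : R := \sum_a lam a * (edge' a \subset A)%:R.
Definition weight i j : R := \sum_a lam a * (edge' a == [set i; j])%:R.

Let om : 'I_v.+2 := ord_max.
Let om' : 'I_v.+2 := inord v.

Let om'_om : om' != om.
Proof. by rewrite -val_eqE /= inordK// neq_ltn leqnn. Qed.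

Lemma edge'_inj : injective edge'.
Proof. by move=> a b /edge_inj/(congr1 val) /= /val_inj. Qed.

Lemma edge'_neq_last a : edge' a != [set om'; om].
Proof.
have d0 : (0 < d)%N by rewrite bin_gt0.
have ld : (d.-1 < d)%N by rewrite prednK.
rewrite -(edge_last (a := Ordinal ld)) ?prednK//; apply/eqP => /edge_inj/(congr1 val) /= e.
by have := ltn_ord a; rewrite e ltnn.
Qed.

Lemma edge'_surj i j : i != j -> [set i; j] != [set om'; om] -> exists a, edge' a = [set i; j].
Proof.
move=> ij; have [b <-] := edge_surj ij.
have d0 : (0 < d)%N by rewrite bin_gt0.
have [bd _|bd] := ltnP b d.-1.
  by exists (Ordinal bd); congr edge; apply/val_inj.
have e : b.+1 = 'C(v.+2, 2).
  by apply/eqP; rewrite eqn_leq ltn_ord -[X in (X <= _)%N](prednK d0) ltnS.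
by rewrite (edge_last e) eqxx.
Qed.

Lemma weightC i j : weight i j = weight j i.
Proof. by rewrite /weight finset.setUC. Qed.

Lemma weight_edge a i j : edge' a = [set i; j] -> weight i j = lam a.
Proof.
move=> e; rewrite /weight -e (bigD1 a)//= eqxx mulr1 big1 ?addr0// => b ba.
by rewrite (inj_eq edge'_inj) (negPf ba) mulr0.
Qed.

Lemma weight_last : weight om' om = 0.
Proof. by rewrite /weight big1// => a _; rewrite (negPf (edge'_neq_last a)) mulr0. Qed.

Lemma phase_setU1 x A : x \notin A ->
  phase (x |: A)%SET = phase A + \sum_(b in A) weight b x.
Proof.
move=> xA; rewrite /phase /weight exchange_big -big_split /=; apply: eq_bigr => a _.
by rewrite edge_sub_setU1// natrD natr_sum mulrDr mulr_sumr.
Qed.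

Variable del : R.
Hypothesis del0 : 0 < del.
Hypothesis phase_near : forall A B, #|A| = k.+2 -> #|B| = k.+2 ->
  near_2pi (phase A - phase B) (del / 4).

Lemma near_2pi_le (x r s : R) : r <= s -> near_2pi x r -> near_2pi x s.
Proof. by move=> rs [u hu]; exists u; exact: lt_le_trans rs. Qed.

(* Exchanging i for j and l for q in a k-set containing i and l: in the
   alternating sum of the four phases all other weights cancel. *)
Lemma four_term i j l q : uniq [:: i; j; l; q] ->
  near_2pi ((weight l i - weight l j) - (weight q i - weight q j)) (del / 2).
Proof.
move=> u.
have [B BS Bk] : exists2 B : {set 'I_v.+2}, B \subset ~: [set x in [:: i; j; l; q]] & #|B| = k.
  apply: exists_subset_card; rewrite cardsCs finset.setCK card_ord cardsE (card_uniqP u) /=.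
  by lia.
have nB x : x \in [:: i; j; l; q] -> x \notin B.
  by move=> xs; apply: contraL xs => /(fintype.subsetP BS); rewrite !inE.
move: u; rewrite /= !inE !negb_or => /and4P[/and3P[ij il iq] /andP[jl jq] lq _].
have [Bi Bj Bl Bq] : [/\ i \notin B, j \notin B, l \notin B & q \notin B].
  by split; apply: nB; rewrite !inE eqxx ?orbT.
have P x y : x \notin B -> y \notin B -> x != y ->
    phase (x |: (y |: B))%SET = phase (y |: B)%SET + (weight y x + \sum_(b in B) weight b x)
    /\ #|(x |: (y |: B))%SET| = k.+2.
  move=> xB yB xy.
  have xyB : x \notin (y |: B)%SET by rewrite !inE negb_or xy.
  by rewrite phase_setU1// big_setU1//= !cardsU1 yB xyB Bk.
have [p1 c1] := P i l Bi Bl il; have [p2 c2] := P j l Bj Bl jl.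
have [p3 c3] := P i q Bi Bq iq; have [p4 c4] := P j q Bj Bq jq.
have := near_2piB (phase_near c1 c2) (phase_near c3 c4).
rewrite p1 p2 p3 p4 (_ : del / 4 + del / 4 = del / 2); last by field.
by congr near_2pi; ring.
Qed.

(* Exchanging i for j next to a fixed set [l |: B] sums the differences
   [weight b i - weight b j] over k.+1 vertices b, which agree by [four_term]. *)
Lemma row_term i j l : uniq [:: i; j; l] ->
  exists z : 'I_k.+1, near_frac k (weight l i - weight l j) z%:Z (del / 2).
Proof.
move=> u; apply: near_frac_of_mul.
have [B BS Bk] : exists2 B : {set 'I_v.+2}, B \subset ~: [set x in [:: i; j; l]] & #|B| = k.
  apply: exists_subset_card; rewrite cardsCs finset.setCK card_ord cardsE (card_uniqP u) /=.
  by lia.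
have nB x : x \in [:: i; j; l] -> x \notin B.
  by move=> xs; apply: contraL xs => /(fintype.subsetP BS); rewrite !inE.
move: u; rewrite /= !inE !negb_or => /and3P[/andP[ij il] jl _].
have [Bi Bj Bl] : [/\ i \notin B, j \notin B & l \notin B].
  by split; apply: nB; rewrite !inE eqxx ?orbT.
have P x : x \notin B -> x != l -> phase (x |: (l |: B))%SET =
      phase (l |: B)%SET + (weight l x + \sum_(b in B) weight b x)
    /\ #|(x |: (l |: B))%SET| = k.+2.
  move=> xB xl.
  have xyB : x \notin (l |: B)%SET by rewrite !inE negb_or xl.
  by rewrite phase_setU1// big_setU1//= !cardsU1 Bl xyB Bk.
have [p1 c1] := P i Bi il; have [p2 c2] := P j Bj jl.
have n1 : near_2pi (phase (i |: (l |: B)) - phase (j |: (l |: B))) (del / 2).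
  have q : del / 4 <= del / 2 by have := del0; lra.
  exact: near_2pi_le q (phase_near c1 c2).
have E : k.+1%:R * (weight l i - weight l j) =
    (phase (i |: (l |: B)) - phase (j |: (l |: B))) +
    \sum_(b in B) ((weight l i - weight l j) - (weight b i - weight b j)).
  rewrite p1 p2 !sumrB !sumr_const Bk -natr1.
  by rewrite -(mulr_natl (weight l i)) -(mulr_natl (weight l j)); ring.
(* For k = 0 the set B is empty and [near_2pi_sum] does not apply. *)
rewrite E; case: (posnP k) => [k0|k0].
  rewrite [X in _ + X]big_pred0 => [|b]; first by rewrite addr0 k0 mul1r.
  by have := Bk; rewrite k0 => /cards0_eq ->; rewrite inE.
rewrite -natr1 mulrDl mul1r addrC; apply: near_2piD => //.
rewrite -Bk; apply: near_2pi_sum; last by rewrite Bk.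
move=> b bB; apply: four_term; rewrite /= !inE !negb_or ij il jl /=.
have bN x : x \notin B -> x != b by apply: contraNneq => ->.
by rewrite !bN.
Qed.

Hypothesis del_small : 2 * del <= 2 * pi / k.+1%:R.

Let fresh (s : seq 'I_v.+2) : (size s < 4)%N -> exists l, l \notin s.
Proof.
move=> s4; have [l|h] := pickP (fun l => l \notin s); first by exists l.
have : (#|'I_v.+2| <= size s)%N.
  apply: leq_trans (card_size s); apply: subset_leq_card.
  by apply/fintype.subsetP => x _; have := h x => /negbFE.
by rewrite card_ord; lia.
Qed.

(** For each l [row_term] gives some numerator; [four_term] puts those of two choices of l so close
    together that they coincide. *)
Lemma weight_diff_om i : i != om ->
  exists z : 'I_k.+1, forall l, l != i -> l != om ->
    near_frac k (weight l i - weight l om) z%:Z (del / 2).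
Proof.
move=> iom; have [l0] := fresh (s := [:: i; om]) isT.
rewrite !inE negb_or => /andP[l0i l0om].
have [|z0 hz0] := @row_term i om l0.
  by rewrite /= !inE negb_or iom (eq_sym i) l0i (eq_sym om) l0om.
exists z0 => l li lom; have [->//|ll0] := eqVneq l l0.
have [|z hz] := @row_term i om l.
  by rewrite /= !inE negb_or iom (eq_sym i) li (eq_sym om) lom.
apply: (near_frac_congr _ hz).
have four : near_2pi ((weight l i - weight l om) - (weight l0 i - weight l0 om)) (del / 2).
  apply: four_term; rewrite /= !inE !negb_or iom (eq_sym i) li (eq_sym om) lom ll0.
  by rewrite (eq_sym i) l0i (eq_sym om) l0om.
have := near_fracD (near_frac0 k four) hz0; rewrite subrK add0r => hz0'.
apply: (near_frac_uniq hz hz0'); apply: le_trans del_small; have := del0; lra.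
Qed.

(** Here [p i] is the common numerator of the differences [weight l i - weight l om]. Starting from
    the pair {om', om}, of weight 0, the exchange of om' for i contributes p i - p om', and the
    exchange of om for j contributes p j. *)
Lemma peak_exists : exists p : {ffun 'I_v.+2 -> 'I_k.+1}, p om = ord0 /\
  forall a, let: (i, j) := lex_pair (widen_ord (leq_pred d) a) in
    near_frac k (lam a) ((p i)%:Z + (p j)%:Z - (p om')%:Z) del.
Proof.
have /fin_all_exists[p0 hp0] : forall i, exists z : 'I_k.+1, i != om -> forall l, l != i -> l != om ->
    near_frac k (weight l i - weight l om) z%:Z (del / 2).
  move=> i; have [->|iom] := eqVneq i om; first by exists ord0.
  by have [z hz] := weight_diff_om iom; exists z.
pose p : {ffun 'I_v.+2 -> 'I_k.+1} := [ffun i => if i == om then ord0 else p0 i].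
have hp i l : i != om -> l != i -> l != om ->
    near_frac k (weight l i - weight l om) (p i)%:Z (del / 2).
  by move=> iom li lom; rewrite ffunE (negPf iom); exact: hp0.
have pom : p om = ord0 by rewrite ffunE eqxx.
have hq i : i != om -> i != om' ->
    near_frac k (weight om i - weight om om') ((p i)%:Z - (p om')%:Z) (del / 2).
  move=> iom iom'.
  (* This has the right radius del/2 but an unknown numerator. The detour through a third point l
     identifies the numerator with radius 3 del/2; the sum 2 del of the radii is exactly what
     [del_small] allows. *)
  have [|z hz] := @row_term i om' om.
    by rewrite /= !inE negb_or iom iom' om'_om.
  apply: (near_frac_congr _ hz).
  have [l] := fresh (s := [:: i; om; om']) isT.
  rewrite !inE !negb_or => /and3P[li lom lom'].
  have four : near_2pi ((weight om i - weight om om') - (weight l i - weight l om')) (del / 2).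
    apply: four_term; rewrite /= !inE !negb_or iom iom' om'_om /=.
    by rewrite (eq_sym i) li (eq_sym om') lom' (eq_sym om) lom.
  have h1 := near_fracB (hp i l iom li lom) (hp om' l om'_om lom' lom).
  have := near_fracD (near_frac0 k four) h1; rewrite add0r.
  rewrite (_ : _ + _ = weight om i - weight om om'); last by ring.
  move=> h2; apply: (near_frac_uniq hz h2); apply: le_trans del_small; have := del0; lra.
have half : del / 2 <= del by have := del0; lra.
have near_le (y : R) (z : int) : near_frac k y z (del / 2) -> near_frac k y z del.
  by apply: near_2pi_le.
exists p; split=> // a.
have := lex_pair_lt (widen_ord (leq_pred d) a); have := edge'_neq_last a.
have : edge' a = [set (lex_pair (widen_ord (leq_pred d) a)).1; (lex_pair (widen_ord (leq_pred d) a)).2] by [].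
case: lex_pair => i j /= e nl ij.
have iom : i != om by rewrite -val_eqE /= neq_ltn (leq_trans ij)// -ltnS.
rewrite -(weight_edge e).
have [jE|jom] := eqVneq j om.
  have iom' : i != om' by apply: contraNneq nl => iE; rewrite e iE jE.
  rewrite jE pom addr0; apply: near_le.
  by have := hq i iom iom'; rewrite (weightC om om') weight_last subr0 weightC.
have ji : j != i by rewrite -val_eqE neq_ltn ij orbT.
have [jE|jom'] := eqVneq j om'.
  rewrite jE addrK; apply: near_le.
  have om'i : om' != i by rewrite -jE.
  by have := hp i om' iom om'i om'_om; rewrite weight_last subr0 weightC.
have [iE|iom'] := eqVneq i om'.
  rewrite -iE addrAC subrr add0r; apply: near_le.
  have om'j : om' != j by rewrite eq_sym.
  by have := hp j om' jom om'j om'_om; rewrite weight_last subr0 -iE.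
have ij' : i != j by rewrite eq_sym.
have := near_fracD (hp j i jom ij' iom) (hq i iom iom').
rewrite (weightC om om') weight_last (weightC om i).
rewrite (_ : del / 2 + del / 2 = del); last by field.
rewrite (_ : weight i j - weight i om + (weight i om - 0) = weight i j); last by ring.
by rewrite (_ : (p j)%:Z + ((p i)%:Z - (p om')%:Z) = (p i)%:Z + (p j)%:Z - (p om')%:Z); last ring.
Qed.

(** On the pair {i, om'} the value at om' cancels and p i is determined; the pair {i, om} then
    determines p om'. *)
Lemma peak_uniq (p q : {ffun 'I_v.+2 -> 'I_k.+1}) : p om = ord0 -> q om = ord0 ->
  (forall a, let: (i, j) := lex_pair (widen_ord (leq_pred d) a) in
    near_frac k (lam a) ((p i)%:Z + (p j)%:Z - (p om')%:Z) del /\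
    near_frac k (lam a) ((q i)%:Z + (q j)%:Z - (q om')%:Z) del) -> p = q.
Proof.
move=> p0 q0 H.
have H' i j : i != j -> [set i; j] != [set om'; om] ->
    (k.+1 %| ((p i)%:Z + (p j)%:Z - (p om')%:Z) - ((q i)%:Z + (q j)%:Z - (q om')%:Z))%Z.
  move=> ij nl; have [a] := edge'_surj ij nl.
  have := H a; rewrite /edge' /edge; case: lex_pair => i' j' [h1 h2] e.
  have := near_frac_uniq h1 h2; rewrite (_ : del + del = 2 * del); last by ring.
  move=> /(_ del_small).
  have : i \in [set i'; j'] by rewrite e set21.
  have : j \in [set i'; j'] by rewrite e set22.
  rewrite !inE => /orP[] /eqP jE /orP[] /eqP iE; rewrite iE jE ?eqxx// in ij *.
  by rewrite (addrC (p i')%:Z) (addrC (q i')%:Z).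
have nlast i x : i != om -> i != om' -> [set i; x] != [set om'; om].
  move=> iom iom'; apply/eqP => /setP/(_ i).
  by rewrite !inE eqxx (negPf iom) (negPf iom').
have Hi i : i != om -> i != om' ->
    (k.+1 %| (p i)%:Z - (q i)%:Z)%Z /\ (k.+1 %| (p om')%:Z - (q om')%:Z)%Z.
  move=> iom iom'.
  have := H' i om' iom' (nlast i om' iom iom'); rewrite !addrK => h1; split=> //.
  have := H' i om iom (nlast i om iom iom'); rewrite p0 q0 => h2.
  have /dvdzP[c1 e1] := h1; have /dvdzP[c2 e2] := h2.
  by apply/dvdzP; exists (c1 - c2); rewrite mulrBl -e1 -e2 /=; ring.
have modE (x y : 'I_k.+1) : (k.+1 %| x%:Z - y%:Z)%Z -> x = y.
  by rewrite -eqz_mod_dvd !modz_nat !modn_small// => /eqP[] /val_inj.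
have [l] := fresh (s := [:: om; om']) isT; rewrite !inE negb_or => /andP[lom lom'].
apply/ffunP => i; have [->|iom] := eqVneq i om; first by rewrite p0 q0.
have [->|iom'] := eqVneq i om'; first by apply: modE; case: (Hi l lom lom').
by apply: modE; case: (Hi i iom iom').
Qed.

End Peaks.

Lemma sum_edges_at v (V : nmodType) (G : {set 'I_v} -> V) (i : 'I_v) :
  \sum_(b : 'I_('C(v, 2)) | i \in edge b) G (edge b) = \sum_(x | x != i) G [set i; x]%SET.
Proof.
have E (b : 'I_('C(v, 2))) : \sum_(x | (x != i) && (edge b == [set i; x]%SET)) G (edge b) =
    if i \in edge b then G (edge b) else 0.
  case: ifP => ib; last first.
    rewrite big_pred0// => x; apply/negbTE/negP => /andP[_ /eqP e].
    by rewrite e set21 in ib.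
  have [y [yi ey]] : exists y, y != i /\ edge b = [set i; y]%SET.
    move: ib (lex_pair_neq b); rewrite /edge !inE; case: lex_pair => p q /= /orP[]/eqP -> pq.
      by exists q; rewrite eq_sym.
    by exists p; rewrite finset.setUC.
  rewrite (big_pred1 y)// => x; rewrite ey; apply/andP/eqP => [[xi /eqP e]|->]; last by rewrite yi eqxx.
  have : x \in [set i; y]%SET by rewrite e set22.
  by rewrite !inE (negPf xi) => /eqP.
transitivity (\sum_(b : 'I_('C(v, 2))) \sum_(x | (x != i) && (edge b == [set i; x]%SET)) G (edge b)).
  by rewrite [LHS]big_mkcond; apply: eq_bigr => b _; rewrite E.
rewrite (exchange_big_dep (fun x => x != i)) /=; last by move=> ? ? _ /andP[].
apply: eq_bigr => x xi; have ix : i != x by rewrite eq_sym.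
have [c ec] := edge_surj ix; rewrite (big_pred1 c) => [|b]; first by rewrite ec.
by rewrite xi /= -ec (inj_eq (@edge_inj v)).
Qed.

Lemma edges_at_sub v (A : {set 'I_v}) (i : 'I_v) :
  (\sum_(b : 'I_('C(v, 2)) | i \in edge b) (edge b \subset A) = (i \in A) * #|A|.-1)%N.
Proof.
rewrite (sum_edges_at (fun B : {set 'I_v} => (B \subset A : nat))).
have E x : ([set i; x]%SET \subset A) = (i \in A) && (x \in A).
  by rewrite finset.subUset !finset.sub1set.
rewrite (eq_bigr (fun x => ((i \in A) && (x \in A) : nat))) => [|x _]; last by rewrite E.
have [iA|iA] := boolP (i \in A); last by rewrite big1.
rewrite mul1n (cardsD1 i) iA /= -sum1_card [RHS]big_mkcond [LHS]big_mkcond /=.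
by apply: eq_bigr => x _; rewrite !inE; case: eqP => //= _; case: (x \in A).
Qed.

Lemma sum_ord_pred (V : nmodType) d (G : 'I_d -> V) : (forall b : 'I_d, b.+1 = d -> G b = 0) ->
  \sum_(b < d) G b = \sum_(a < d.-1) G (widen_ord (leq_pred d) a).
Proof.
case: d G => [|d] G G0; first by rewrite !big_ord0.
rewrite big_ord_recr /= G0// addr0; apply: eq_bigr => a _; congr G; exact/val_inj.
Qed.

(** * Walks, their visits to the pairs, and characters *)

(* The paper's v and k are v.+2 and k.+2 here, hence its k - 1 is k.+1. A walk
   is the sequence of supports of the vectors drawn. *)
Section Walk.
Variables (R : realType) (v k t L : nat).
Let d := 'C(v.+2, 2).
Let T := {ffun 'I_t -> {set 'I_v.+2}}.
Implicit Types (F : T) (b : 'I_d) (a : 'I_d.-1) (lam mu : 'I_d.-1 -> R) (A : {set 'I_v.+2}).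

Definition draws : {set {set 'I_v.+2}} := [set A : {set 'I_v.+2} | #|A| == k.+2]%SET.
(* The walk ends at 0 iff every pair is visited the same number L of times; then
   every point is hit t k / v times. *)
Definition visits F b : nat := (\sum_s (edge b \subset F s))%N.
Definition hits F (i : 'I_v.+2) : nat := (\sum_s (i \in F s))%N.
Definition walks : {set T} := [set F : T | [forall s, F s \in draws]]%SET.

Hypothesis hL : (L * (v.+2 * v.+1) = t * (k.+2 * k.+1))%N.

Lemma walksP F s : F \in walks -> #|F s| = k.+2.
Proof. by rewrite inE => /forallP/(_ s); rewrite inE => /eqP. Qed.

Lemma visits_at F i : F \in walks ->
  (\sum_(b : 'I_d | i \in edge b) visits F b = hits F i * k.+1)%N.
Proof.
move=> hF; rewrite exchange_big /= big_distrl /=; apply: eq_bigr => s _.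
by rewrite edges_at_sub (walksP _ hF).
Qed.

Lemma edges_at i : (\sum_(b : 'I_d | i \in edge b) 1 = v.+1)%N.
Proof.
have := edges_at_sub [set: 'I_v.+2]%SET i; rewrite inE mul1n cardsT card_ord /= => e.
by rewrite -[RHS]e; apply: eq_bigr => b _; rewrite finset.subsetT.
Qed.

Lemma sum_hits F : F \in walks -> (\sum_i hits F i = t * k.+2)%N.
Proof.
move=> hF; rewrite exchange_big /= -[in RHS](card_ord t) -sum_nat_const.
apply: eq_bigr => s _; rewrite -(walksP s hF) -sum1_card [RHS]big_mkcond.
by apply: eq_bigr => i _; case: (i \in F s).
Qed.

Lemma sum_edge_ends (V : nmodType) (p : 'I_v.+2 -> V) b :
  \sum_(i in edge b) p i = p (lex_pair b).1 + p (lex_pair b).2.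
Proof. by rewrite /edge big_setU1/= ?big_set1// inE lex_pair_neq. Qed.

Let dev F b : int := (visits F b)%:Z - L%:Z.

Lemma dev_at F i : F \in walks ->
  \sum_(b : 'I_d | i \in edge b) dev F b = (hits F i * k.+1)%:Z - (L * v.+1)%:Z.
Proof.
move=> hF; rewrite sumrB; congr (_ - _).
  by rewrite -(visits_at i hF) -[RHS]/(Posz _) (big_morph Posz PoszD (erefl 0)).
rewrite (eq_bigr (fun b => L%:Z * 1)) => [|b _]; last by rewrite mulr1.
rewrite -mulr_sumr PoszM; congr (_ * _).
by have := congr1 Posz (edges_at i); rewrite (big_morph Posz PoszD (erefl 0)).
Qed.

Lemma sum_dev_ends F (p : 'I_v.+2 -> int) : F \in walks ->
  \sum_b (p (lex_pair b).1 + p (lex_pair b).2) * dev F b =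
  \sum_i p i * ((hits F i * k.+1)%:Z - (L * v.+1)%:Z).
Proof.
move=> hF; under eq_bigr => b _ do rewrite -sum_edge_ends mulr_suml.
rewrite (exchange_big_dep predT)//=; apply: eq_bigr => i _.
by rewrite -mulr_sumr dev_at.
Qed.

(** Each pair has two ends, so twice the total deviation is a sum over points, and a walk has t k
    hits in all. *)
Lemma sum_dev F : F \in walks -> \sum_b dev F b = 0.
Proof.
move=> hF.
have H : 2 * \sum_b dev F b = \sum_i 1 * ((hits F i * k.+1)%:Z - (L * v.+1)%:Z).
  by rewrite -(sum_dev_ends (fun=> 1) hF) mulr_sumr.
suff : 2 * \sum_b dev F b = 0 by lia.
rewrite H; under eq_bigr do rewrite mul1r.
rewrite sumrB sumr_const card_ord -(big_morph Posz PoszD (erefl 0)) -big_distrl /= sum_hits//.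
by rewrite -mulr_natr natz -PoszM; apply/eqP; rewrite subr_eq0 eqz_nat; lia.
Qed.

Lemma visits_last F : F \in walks -> (forall a, visits F (widen_ord (leq_pred d) a) = L) ->
  forall b, visits F b = L.
Proof.
move=> hF hn; have d0 : (0 < d)%N by rewrite bin_gt0.
have ld : (d.-1 < d)%N by rewrite prednK.
have S : dev F (Ordinal ld) = 0.
  rewrite -(sum_dev hF) (bigD1 (Ordinal ld))//= big1 ?addr0// => b bl.
  have bd : (b < d.-1)%N.
    move: bl; rewrite -val_eqE /= ltn_neqAle => ->.
    by have := ltn_ord b; rewrite -[X in (_ < X)%N](prednK d0) ltnS.
  rewrite /dev (_ : b = widen_ord (leq_pred d) (Ordinal bd)) ?hn ?subrr//; exact/val_inj.
move=> b; have [bd|bd] := ltnP b d.-1.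
  by rewrite -(hn (Ordinal bd)); congr visits; apply/val_inj.
have -> : b = Ordinal ld.
  apply/val_inj/eqP; rewrite eqn_leq bd andbT /=.
  by have := ltn_ord b; rewrite -[X in (_ < X)%N](prednK d0) ltnS.
by move: S; rewrite /dev => /eqP; rewrite subr_eq0 => /eqP[].
Qed.

Lemma hits_eq F i : F \in walks -> (forall b, visits F b = L) ->
  (hits F i * v.+2 = t * k.+2)%N.
Proof.
move=> hF hV; have := visits_at i hF.
rewrite (eq_bigr (fun=> L * 1)%N) => [|b _]; last by rewrite hV muln1.
rewrite -big_distrr /= edges_at => e.
have : (hits F i * v.+2 * k.+1 = t * k.+2 * k.+1)%N by nia.
by move/eqP; rewrite eqn_pmul2r// => /eqP.
Qed.

Let C2 : R := Ccoef R v.+2 k.+2 2.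

Lemma Ccoef2E : C2 = (k.+2%:R * k.+1%:R) / (v.+2%:R * v.+1%:R).
Proof.
rewrite /C2 /Ccoef !big_ord_recr !big_ord0 /= !mul1r !subr0.
by rewrite -!natrB// !subn1.
Qed.

Lemma L_eq : L%:R = t%:R * C2.
Proof.
rewrite Ccoef2E mulrA.
have V0 : v.+2%:R * v.+1%:R != 0 :> R by rewrite mulf_neq0// pnatr_eq0.
by apply: (mulIf V0); rewrite divfK// -!natrM hL.
Qed.

Definition centered lam A : R := \sum_a lam a * ((edge' a \subset A)%:R - C2).
(** The characteristic function of one step times the number of k-sets; without normalization its
    t-th power is a sum over walks. *)
Definition charsum lam : R[i] := \sum_(A in draws) cis (centered lam A).

Lemma cis_sum (I : Type) (s : seq I) (P : pred I) (f : I -> R) :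
  cis (\sum_(i <- s | P i) f i) = \prod_(i <- s | P i) cis (f i).
Proof. by apply: (big_morph (@cis R)); [exact: cisD|exact: cis0]. Qed.

Lemma charsumX lam : charsum lam ^+ t =
  \sum_(F in walks) cis (\sum_a lam a * (dev F (widen_ord (leq_pred d) a))%:~R).
Proof.
rewrite -[in LHS](card_ord t) -prodr_const bigA_distr_big /=.
rewrite [LHS](eq_bigl (fun F : T => F \in walks)); last first.
  move=> F; apply/ffun_onP/idP => [h|]; rewrite [F \in walks]inE; first by apply/forallP.
  by move/forallP.
apply: eq_bigr => F _; rewrite -cis_sum; congr cis.
rewrite exchange_big /=; apply: eq_bigr => a _.
rewrite -mulr_sumr sumrB sumr_const card_ord /dev intrB -!pmulrn L_eq mulr_natl.
by rewrite /visits natr_sum.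
Qed.

Lemma cis_2pi_int (x : R) (u : int) : cis (x + 2 * pi * u%:~R) = cis x.
Proof.
have P (n : nat) (y : R) : cis (y + 2 * pi * n%:R) = cis y.
  elim: n => [|n IH]; first by rewrite mulr0 addr0.
  rewrite -[n.+1%:R]natr1 mulrDr mulr1 addrA /cis (_ : _ + 2 * pi = y + 2 * pi * n%:R + pi *+ 2).
    by rewrite cosD2pi sinD2pi; exact: IH.
  by rewrite mulr_natl.
case: u => n; first by rewrite -pmulrn P.
by rewrite NegzE mulrNz -pmulrn mulrN -[LHS](P n.+1) subrK.
Qed.

Lemma charsumX_period lam mu (u : 'I_d.-1 -> int) :
  (forall a, mu a = lam a + 2 * pi * (u a)%:~R) -> charsum mu ^+ t = charsum lam ^+ t.
Proof.
move=> h; rewrite !charsumX; apply: eq_bigr => F _.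
rewrite -[RHS](cis_2pi_int _ (\sum_a u a * dev F (widen_ord (leq_pred d) a))); congr cis.
rewrite rmorph_sum /= mulr_sumr -big_split; apply: eq_bigr => a _.
by rewrite h /= intrM; ring.
Qed.

Variable r : nat.
Hypothesis hr : (r * v.+2 = t * k.+2)%N.

(** Paired with the deviations of a walk, p i + p j yields (k-1) times the sum of p i (hits i - r),
    so every phase changes by a multiple of 2 pi. The constant p (inord v) is paired with the total
    deviation, which is 0. *)
Lemma charsumX_peak lam mu (p : 'I_v.+2 -> int) :
  (forall a, let: (i, j) := lex_pair (widen_ord (leq_pred d) a) in
    mu a = lam a + 2 * pi * (p i + p j - p (inord v))%:~R / k.+1%:R) ->
  p ord_max = 0 -> charsum mu ^+ t = charsum lam ^+ t.
Proof.
move=> h p0; rewrite !charsumX; apply: eq_bigr => F hF.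
pose w a : 'I_d := widen_ord (leq_pred d) a.
have key : \sum_a (p (lex_pair (w a)).1 + p (lex_pair (w a)).2 - p (inord v)) * dev F (w a) =
    k.+1%:Z * \sum_i p i * ((hits F i)%:Z - r%:Z).
  have -> : \sum_a (p (lex_pair (w a)).1 + p (lex_pair (w a)).2 - p (inord v)) * dev F (w a) =
      \sum_b (p (lex_pair b).1 + p (lex_pair b).2 - p (inord v)) * dev F b.
    rewrite [RHS]sum_ord_pred// => b /edge_last.
    rewrite -sum_edge_ends => ->; rewrite big_setU1/= ?big_set1.
      by rewrite p0 addr0 subrr mul0r.
    by rewrite inE -val_eqE /= inordK// neq_ltn leqnn.
  under eq_bigr => b _ do rewrite mulrBl.
  rewrite sumrB -mulr_sumr sum_dev// mulr0 subr0 sum_dev_ends// mulr_sumr.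
  apply: eq_bigr => i _; have -> : (L * v.+1)%N = (r * k.+1)%N.
    by apply/eqP; rewrite -(@eqn_pmul2r v.+2)//; apply/eqP; nia.
  by rewrite !PoszM; ring.
rewrite -[RHS](cis_2pi_int _ (\sum_i p i * ((hits F i)%:Z - r%:Z))); congr cis.
have K0 : k.+1%:R != 0 :> R by rewrite pnatr_eq0.
have -> : 2 * pi * (\sum_i p i * ((hits F i)%:Z - r%:Z))%:~R =
   2 * pi / k.+1%:R * (k.+1%:Z * \sum_i p i * ((hits F i)%:Z - r%:Z))%:~R :> R.
  by rewrite [in RHS]intrM -pmulrn mulrA divfK.
rewrite -key rmorph_sum /= mulr_sumr -big_split; apply: eq_bigr => a _.
have := h a; rewrite -/(w a); case: lex_pair => i j /= ->.
by rewrite intrM; move: K0; move: (k.+1%:R : R) (_%:~R) (_%:~R) => c x y c0; field.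
Qed.

End Walk.

(** * Moments of one step of the walk *)

Lemma card_draws_sup (T : finType) (U : {set T}) k : (#|U| <= k)%N ->
  #|[set A : {set T} | (#|A| == k) && (U \subset A)]%SET| = 'C(#|T| - #|U|, k - #|U|).
Proof.
move=> Uk.
have cU : #|(~: U)%SET| = (#|T| - #|U|)%N by rewrite cardsCs finset.setCK.
rewrite -cU -cards_draws.
pose f (A : {set T}) := (A :\: U)%SET.
rewrite -(@card_in_imset _ _ f).
  apply: eq_card => B; rewrite inE; apply/imsetP/andP => [[A]|[BU /eqP Bk]].
    rewrite inE => /andP[/eqP Ak UA] ->.
    by rewrite subsetDr cardsDS// Ak.
  exists (B :|: U)%SET; last first.
    apply/setP => x; rewrite !inE; have := fintype.subsetP BU x; rewrite inE.
    by case: (x \in B) (x \in U) => [] [] //= /(_ isT).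
  rewrite inE finset.subsetUr andbT cardsU.
  have -> : (B :&: U)%SET = finset.set0.
    apply/setP => x; rewrite !inE; have := fintype.subsetP BU x; rewrite inE.
    by case: (x \in B) (x \in U) => [] [] //= /(_ isT).
  by rewrite cards0 subn0 Bk subnK.
move=> A B; rewrite !inE => /andP[_ UA] /andP[_ UB] /setP e.
apply/setP => x; have := e x; rewrite !inE.
by have := fintype.subsetP UA x; have := fintype.subsetP UB x; case: (x \in U) => //= -> // -> .
Qed.

(** C_j is the probability that a random k-set contains j given points. *)
Lemma Ccoef_bin (R : realType) v k j : (j <= k)%N -> (k <= v)%N ->
  ('C(v, k))%:R * Ccoef R v k j = ('C(v - j, k - j))%:R.
Proof.
move=> jk kv; rewrite /Ccoef.
have v0 : \prod_(i < j) (v%:R - i%:R) != 0 :> R.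
  apply/prodf_neq0 => i _; rewrite subr_eq0 eqr_nat; have := ltn_ord i; lia.
rewrite mulrA; apply: (mulIf v0); rewrite divfK//.
elim: j jk {v0} => [|j IH] jk; first by rewrite !big_ord0 !subn0 !mulr1.
rewrite !big_ord_recr /= mulrA IH 1?ltnW//.
have -> : (k - j = (k - j.+1).+1)%N by lia.
have -> : (v - j = (v - j.+1).+1)%N by lia.
have e := mul_bin_diag (v - j.+1).+1 (k - j.+1).
have E : k%:R - j%:R = (k - j.+1).+1%:R :> R by rewrite -natrB 1?ltnW//; congr (_%:R); lia.
have E' : v%:R - j%:R = (v - j.+1).+1%:R :> R by rewrite -natrB; [congr (_%:R)|]; lia.
rewrite E E'; have := congr1 (fun n => n%:R : R) e; rewrite /= !natrM.
move: (\prod_(_ < _) _) (_%:R) (_%:R) (_%:R) (_%:R) => p x y z u e'.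
by rewrite mulrAC [X in X * p]mulrC -e'; ring.
Qed.

Lemma Ccoef_eq0 (R : realType) v k j : (k < j)%N -> Ccoef R v k j = 0.
Proof.
by move=> kj; rewrite /Ccoef (bigD1 (Ordinal kj))//= subrr !mul0r.
Qed.

Section Moments.
Variables (R : realType) (v k : nat).
Hypothesis hvk : (k.+2 <= v)%N.
Let d := 'C(v.+2, 2).
Let D := draws v k.
Let n := #|D|.
Implicit Types (A U : {set 'I_v.+2}) (lam : 'I_d.-1 -> R).

Lemma card_draws_bin : n = 'C(v.+2, k.+2).
Proof. by rewrite /n /D /draws card_draws card_ord. Qed.

Lemma sum_draws_sup U : \sum_(A in D) (U \subset A)%:R = n%:R * Ccoef R v.+2 k.+2 #|U|.
Proof.
have -> : \sum_(A in D) (U \subset A)%:R =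
    #|[set A : {set 'I_v.+2} | (#|A| == k.+2) && (U \subset A)]%SET|%:R :> R.
  rewrite -sum1_card natr_sum [RHS]big_mkcond [LHS]big_mkcond; apply: eq_bigr => A _.
  by rewrite !inE; case: (_ == _) => //=; case: (U \subset A).
have [Uk|kU] := leqP #|U| k.+2.
  by rewrite card_draws_sup// card_ord card_draws_bin Ccoef_bin//; lia.
rewrite Ccoef_eq0// mulr0 (_ : [set A : {set 'I_v.+2} | _]%SET = finset.set0) ?cards0//.
apply/setP => A; rewrite !inE; apply/negbTE/negP => /andP[/eqP Ak UA].
by have := subset_leq_card UA; rewrite Ak leqNgt kU.
Qed.

Lemma n_gt0 : (0 < n)%N.
Proof. by rewrite card_draws_bin bin_gt0; lia. Qed.

Let w (a : 'I_d.-1) : 'I_d := widen_ord (leq_pred d) a.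

Lemma sum_centered lam : \sum_(A in D) centered k lam A = 0.
Proof.
rewrite exchange_big /= big1// => a _; rewrite -mulr_sumr sumrB sum_draws_sup card_edge.
by rewrite sumr_const -/n -(mulr_natl (Ccoef _ _ _ _)) subrr mulr0.
Qed.

Definition quad lam : R := ((\col_a lam a)^T *m Mmx R v.+2 k.+2 *m (\col_a lam a)) 0 0.

(** M is the covariance matrix of a step: two pairs meeting in 2, 1 or 0 points have a union of 2, 3
    or 4 points, which gives the three cases in its definition. *)
Lemma sum_centered_sqr lam : \sum_(A in D) centered k lam A ^+ 2 = n%:R * quad lam.
Proof.
set C2 := Ccoef R v.+2 k.+2 2.
have S2 b : \sum_(A in D) (edge b \subset A)%:R = n%:R * C2 by rewrite sum_draws_sup card_edge.
have cov a b : \sum_(A in D) ((edge' a \subset A)%:R - C2) * ((edge' b \subset A)%:R - C2) =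
    n%:R * Mmx R v.+2 k.+2 a b.
  have -> : \sum_(A in D) ((edge' a \subset A)%:R - C2) * ((edge' b \subset A)%:R - C2) =
    \sum_(A in D) (((edge' a :|: edge' b)%SET \subset A)%:R : R) - C2 * \sum_(A in D) (edge' a \subset A)%:R
     - C2 * \sum_(A in D) (edge' b \subset A)%:R + n%:R * C2 ^+ 2.
    rewrite !mulr_sumr -!sumrB mulr_natl -sumr_const -big_split; apply: eq_bigr => A _ /=.
    move: (edge' a) (edge' b) => U V; rewrite finset.subUset.
    by case: (_ \subset A); case: (_ \subset A) => /=; ring.
  rewrite !S2 sum_draws_sup !mxE -/C2.
  have cU : #|(edge' a :|: edge' b)%SET| = (4 - #|(edge' a :&: edge' b)%SET|)%N.
    by rewrite cardsU !card_edge.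
  have cI : (#|(edge' a :&: edge' b)%SET| <= 2)%N.
    apply: leq_trans (subset_leq_card (finset.subsetIl (edge' a) (edge' b))) _.
    by rewrite card_edge.
  rewrite cU -/(edge' a) -/(edge' b).
  move: cI; case: #|(edge' a :&: edge' b)%SET| => [|[|[|]]] //= _; rewrite ?subn0 ?subn1 -?/C2; ring.
under eq_bigr => A _.
  rewrite expr2 {1}/centered mulr_suml; under eq_bigr => a _ do rewrite /centered mulr_sumr.
  over.
rewrite exchange_big /=; under eq_bigr => a _ do rewrite exchange_big /=.
rewrite /quad mxE mulr_sumr exchange_big /=; apply: eq_bigr => b _.
rewrite !mxE mulr_suml mulr_sumr; apply: eq_bigr => a _.
rewrite (eq_bigr (fun A =>
  lam a * lam b * (((edge' a \subset A)%:R - C2) * ((edge' b \subset A)%:R - C2)))).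
  by rewrite -mulr_sumr cov !mxE; ring.
by move=> A _; rewrite -/C2; ring.
Qed.

Lemma Ccoef2_itv : 0 <= Ccoef R v.+2 k.+2 2 <= 1.
Proof.
have n0 : 0 < n%:R :> R by rewrite ltr0n n_gt0.
have d0 : (0 < d)%N by rewrite bin_gt0.
have := sum_draws_sup (edge (Ordinal d0)); rewrite card_edge => e.
apply/andP; split; first by rewrite -(pmulr_rge0 _ n0) -e sumr_ge0.
have E : n%:R = \sum_(A in D) 1 :> R by rewrite sumr_const.
rewrite -(ler_pM2l n0) -e mulr1 E; apply: ler_sum => A _.
by case: (_ \subset _).
Qed.

Lemma centered_le lam (del : R) A : 0 <= del -> (forall a, `|lam a| <= del) -> `|centered k lam A| <= d%:R * del.
Proof.
move=> del0 h; apply: (le_trans (ler_norm_sum _ _ _)).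
apply: (@le_trans _ _ (\sum_(a < d.-1) del)).
  apply: ler_sum => a _; rewrite normrM -[leRHS]mulr1 ler_pM//.
  have /andP[c0 c1] := Ccoef2_itv.
  by rewrite ler_norml; case: (_ \subset _) => /=; apply/andP; split; lra.
by rewrite sumr_const card_ord -(mulr_natl del) ler_wpM2r// ler_nat leq_pred.
Qed.

Lemma charsumE lam : charsum k lam = ((\sum_(A in D) cos (centered k lam A)) +i*
  (\sum_(A in D) sin (centered k lam A)))%C.
Proof.
rewrite /charsum /D; elim/big_rec3: _ => [//|A y z x _ ->]; exact: erefl.
Qed.

Section Near.
Variables (lam : 'I_d.-1 -> R) (del : R).
Hypotheses (del0 : 0 < del) (hlam : forall a, `|lam a| <= del) (e1 : d%:R * del < 1).
Let eps := d%:R * del.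

Let n0 : 0 < n%:R :> R. Proof. by rewrite ltr0n n_gt0. Qed.
Let eps0 : 0 <= eps. Proof. by rewrite mulr_ge0// ltW. Qed.
Let X A := centered k lam A.
Let a : R := (\sum_(A in D) cos (X A)) / n%:R.
Let b : R := (\sum_(A in D) sin (X A)) / n%:R.
Let Q := quad lam.

Let XE A : `|X A| <= eps. Proof. exact: centered_le (ltW del0) hlam. Qed.

Let X2 A : X A ^+ 2 <= eps ^+ 2.
Proof. by rewrite -[X A ^+ 2]real_normK ?num_real// lerXn2r// nnegrE. Qed.

Let QE : Q = (\sum_(A in D) X A ^+ 2) / n%:R.
Proof. by rewrite sum_centered_sqr mulrC mulKf// gt_eqF. Qed.

Let avg_le (f g : {set 'I_v.+2} -> R) : (forall A, f A <= g A) ->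
  (\sum_(A in D) f A) / n%:R <= (\sum_(A in D) g A) / n%:R.
Proof. by move=> h; rewrite ler_pM2r ?invr_gt0//; apply: ler_sum. Qed.

Let avg_cst (c : R) : (\sum_(A in D) c) / n%:R = c.
Proof. by rewrite sumr_const -/n -(mulr_natl c) mulrC mulKf// gt_eqF. Qed.

Let Q0 : 0 <= Q.
Proof. by rewrite QE divr_ge0// sumr_ge0// => A _; exact: sqr_ge0. Qed.

Let Qe : Q <= eps ^+ 2.
Proof. by rewrite QE -[leRHS]avg_cst; exact: avg_le. Qed.

Let a_ge : 1 - Q / 2 <= a.
Proof.
have -> : 1 - Q / 2 = (\sum_(A in D) (1 - X A ^+ 2 / 2)) / n%:R.
  by rewrite sumrB mulrBl avg_cst -mulr_suml QE; ring.
by apply: avg_le => A; exact: cos_ge_deg2.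
Qed.

Let a_le : a <= 1 - Q / 2 + eps ^+ 2 * Q / 24.
Proof.
have -> : 1 - Q / 2 + eps ^+ 2 * Q / 24 =
  (\sum_(A in D) (1 - X A ^+ 2 / 2 + eps ^+ 2 / 24 * X A ^+ 2)) / n%:R.
  by rewrite big_split /= sumrB mulrDl mulrBl avg_cst -mulr_suml -mulr_sumr QE; ring.
apply: avg_le => A; apply: (le_trans (cos_le_deg4 _)); rewrite lerD2l.
have -> : X A ^+ 4 = X A ^+ 2 * X A ^+ 2 by ring.
have := X2 A; have := sqr_ge0 (X A); move: (X A ^+ 2) (eps ^+ 2) => x y; nra.
Qed.

Let b_le : `|b| <= eps ^+ 3 / 6.
Proof.
(* The mean of X is 0, so X can be subtracted and only cubic remainders are left. *)
have -> : b = (\sum_(A in D) (sin (X A) - X A)) / n%:R.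
  by rewrite sumrB [X in _ - X]sum_centered subr0.
rewrite normrM normfV (gtr0_norm n0).
apply: (@le_trans _ _ ((\sum_(A in D) `|sin (X A) - X A|) / n%:R)).
  by rewrite ler_pM2r ?invr_gt0//; exact: ler_norm_sum.
rewrite -[leRHS]avg_cst; apply: avg_le => A; apply: (le_trans (dist_sin_deg3 _)).
by rewrite ler_pM2r// lerXn2r// nnegrE.
Qed.

Let charE : charsum k lam = (n%:R : R)%:C%C * (a +i* b)%C.
Proof.
rewrite charsumE; apply/eqP; rewrite eq_complex /= !mul0r subr0 addr0 /a /b.
by rewrite ![n%:R * _]mulrC !divfK ?eqxx// gt_eqF.
Qed.

Lemma Re_charsum_le t : complex.Re (charsum k lam ^+ t) <= n%:R ^+ t *
  ((1 + 4^-1 * eps ^+ 6) `^ (t%:R / 2) * (1 + 3^-1 * eps ^+ 4) ^+ t * expR (- (t%:R * (Q / 2)))).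
Proof.
apply: (le_trans (Re_le_normc _)); rewrite charE exprMn Normc.normcM !normcX.
have -> : Normc.normc (n%:R : R)%:C%C = n%:R.
  by rewrite /= expr0n addr0 sqrtr_sqr ger0_norm.
rewrite ler_pM2l ?exprn_gt0//.
exact: (normc_near_peak_le Q0 Qe eps0 e1 a_ge a_le b_le).
Qed.

Lemma Re_charsum_ge t : t%:R * eps ^+ 3 < 2 -> n%:R ^+ t *
  ((1 + t%:R ^+ 2 * eps ^+ 6) `^ (- 2^-1) * (1 - 3^-1 * eps ^+ 4) ^+ t * expR (- (t%:R * (Q / 2)))) <=
  complex.Re (charsum k lam ^+ t).
Proof.
have ReX (x : R) (z : R[i]) : complex.Re (x%:C%C ^+ t * z) = x ^+ t * complex.Re z.
  by rewrite -rmorphXn; case: z => p q /=; rewrite mul0r subr0.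
move=> te; rewrite charE [X in complex.Re X]exprMn ReX.
rewrite ler_pM2l ?exprn_gt0//.
exact: (Re_near_peak_ge Q0 Qe eps0 e1 a_ge b_le te).
Qed.

End Near.
End Moments.

(** * Orthogonality of characters and decay away from the peaks *)

Section Characters.
Variable R : realType.
Implicit Types x y : R.

Lemma reduce_2pi x : exists u : int, `|x - 2 * pi * u%:~R| <= pi.
Proof.
have p0 : 0 < 2 * pi :> R by rewrite mulr_gt0// pi_gt0.
exists (Num.floor (x / (2 * pi) + 2^-1)).
have := floor_itv (x / (2 * pi) + 2^-1) => /andP[].
rewrite intrD; move: (Num.floor _) => u h1 h2.
have e : x = x / (2 * pi) * (2 * pi) by rewrite divfK// gt_eqF.
have h3 := ler_wpM2r (ltW p0) h1; have h4 := ltW h2; have h5 := ler_wpM2r (ltW p0) h4.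
by rewrite {1}e ler_norml; apply/andP; split; lra.
Qed.

Lemma cos_2pi_int x (u : int) : cos (x - 2 * pi * u%:~R) = cos x.
Proof.
have := cis_2pi_int x (- u); rewrite mulrNz mulrN => /eqP.
by rewrite eq_complex /= => /andP[/eqP].
Qed.

Lemma cos_far x r : 0 <= r -> r <= pi -> ~ near_2pi x r -> cos x <= cos r.
Proof.
move=> r0 rpi far; have [u hu] := reduce_2pi x.
rewrite -(cos_2pi_int x u) -(cos_norm (x - _)).
have : r <= `|x - 2 * pi * u%:~R| by rewrite leNgt; apply/negP => h; apply: far; exists u.
by rewrite le_eqVlt => /predU1P[->//|h]; rewrite ltW// ltr_cos// in_itv/= ?r0// normr_ge0.
Qed.

Lemma cos_eq1_near x : cos x = 1 -> exists u : int, x = 2 * pi * u%:~R.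
Proof.
move=> c1; have [u hu] := reduce_2pi x; exists u; apply/eqP; rewrite -subr_eq0 -normr_eq0.
rewrite eq_le normr_ge0 andbT leNgt; apply/negP => h.
have : cos `|x - 2 * pi * u%:~R| < cos 0 by rewrite ltr_cos// in_itv/= ?lexx ?pi_ge0// normr_ge0.
by rewrite cos_norm cos_2pi_int c1 cos0 ltxx.
Qed.

(** The squared modulus is 2 + 2 cos(x - y), at most 4 - del^2/16 + del^4/3072. For del <= 1 this is
    at most 4 - (11/192) del^2, hence at most the square of 2 - (11/768) del^2. *)
Lemma normc_cisD2 x y (del : R) : 0 <= del <= 1 -> ~ near_2pi (x - y) (del / 4) ->
  Normc.normc (cis x + cis y) <= 2 - 11 / 768 * del ^+ 2.
Proof.
move=> /andP[d0 d1] far.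
have pi1 : 1 <= pi :> R by apply: le_trans (pi_ge2 R); lra.
have cle := cos_far (_ : 0 <= del / 4) (_ : del / 4 <= pi) far.
have {}cle : cos (x - y) <= cos (del / 4) by apply: cle; lra.
have c4 := cos_le_deg4 (del / 4).
have d2 : 0 <= del ^+ 2 <= 1 by rewrite sqr_ge0 expr_le1.
have s2 : (cos x + cos y) ^+ 2 + (sin x + sin y) ^+ 2 = 2 + 2 * cos (x - y).
  rewrite cosB; have := cos2Dsin2 x; have := cos2Dsin2 y; lra.
have b0 : 0 <= 2 - 11 / 768 * del ^+ 2 by lra.
rewrite -(ger0_norm b0) -sqrtr_sqr /= ler_wsqrtr// s2.
apply: (@le_trans _ _ (2 + 2 * (1 - (del / 4) ^+ 2 / 2 + (del / 4) ^+ 4 / 24))); first by lra.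
rewrite (_ : (del / 4) ^+ 4 = (del ^+ 2) ^+ 2 / 256); last by field.
rewrite (_ : (del / 4) ^+ 2 = del ^+ 2 / 16); last by field.
by move: d2; move: (del ^+ 2) => z /andP[z0 z1]; nra.
Qed.

Lemma normc_sum (I : Type) (s : seq I) (P : pred I) (f : I -> R[i]) :
  Normc.normc (\sum_(i <- s | P i) f i) <= \sum_(i <- s | P i) Normc.normc (f i).
Proof.
elim/big_rec2: _ => [|i y z _ h]; first by rewrite Normc.normc0.
by apply: (le_trans (le_normcD _ _)); rewrite lerD2l.
Qed.

Lemma sum_character N (z : int) :
  \sum_(x : 'I_N.+2) cis (2 * pi / N.+2%:R * (cent x)%:~R * z%:~R) =
  if (N.+2 %| z)%Z then N.+2%:R else 0 :> R[i].
Proof.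
have m0 : N.+2%:R != 0 :> R by rewrite pnatr_eq0.
case: ifP => [/dvdzP[q ->]|nz].
  rewrite (eq_bigr (fun=> 1)) => [|x _]; first by rewrite sumr_const card_ord.
  rewrite -(cis0 R) -(cis_2pi_int 0 (cent x * q)) add0r; congr cis.
  by rewrite !intrM -pmulrn; move: m0; move: (N.+2%:R : R) => c c0; field.
set S := \sum_(x : 'I_N.+2) _; pose zeta : R[i] := cis (2 * pi / N.+2%:R * z%:~R).
(* Translating the index by 1 multiplies every summand by zeta; a wrap-around turns the angle by a
   multiple of 2 pi. *)
have SE : S = zeta * S.
  rewrite {1}/S (reindex_inj (addIr (1%:~R : 'I_N.+2))) /= /S mulr_sumr; apply: eq_bigr => x _.
  have [e ->] := cent_add x 1; rewrite -cisD.
  rewrite -[RHS](cis_2pi_int _ (e * z)); congr cis.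
  by rewrite !intrD !intrM -pmulrn; move: m0; move: (N.+2%:R : R) => c c0; field.
have zeta1 : zeta != 1.
  apply/negP => /eqP /eqP; rewrite eq_complex /= => /andP[/eqP /cos_eq1_near[u hu] _].
  have : z%:~R = (u * N.+2)%:~R :> R.
    rewrite intrM -pmulrn; have p0 : pi != 0 :> R by rewrite gt_eqF// pi_gt0.
    have p20 : 2 * pi != 0 :> R by rewrite mulf_neq0// pnatr_eq0.
    apply: (mulfI p20); move: hu; move: m0; move: (N.+2%:R : R) => c c0 hu.
    have -> : 2 * pi * z%:~R = 2 * pi / c * z%:~R * c by field.
    by rewrite hu mulrA.
  by move/intr_inj => zE; rewrite zE dvdz_mull in nz.
apply/eqP; have : (1 - zeta) * S == 0 by rewrite mulrBl mul1r -SE subrr.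
by rewrite mulf_eq0 subr_eq0 eq_sym (negPf zeta1).
Qed.

End Characters.

Section OffPeak.
Variables (R : realType) (v k : nat).
Let d := 'C(v.+2, 2).
Let D := draws v k.
Let n := #|D|.
Variables (lam : 'I_d.-1 -> R) (del : R).
Hypothesis hdel : 0 <= del <= 1.

Lemma normc_charsum_le (A B : {set 'I_v.+2}) : A \in D -> B \in D ->
  ~ near_2pi (phase lam A - phase lam B) (del / 4) ->
  Normc.normc (charsum k lam) <= n%:R - 11 / 768 * del ^+ 2.
Proof.
move=> AD BD far.
have e : phase lam A - phase lam B = centered k lam A - centered k lam B.
  rewrite /phase /centered -!sumrB; apply: eq_bigr => a _; ring.
have del4 : 0 < del / 4 \/ del = 0.
  by case/andP: hdel => d0 _; move: d0; rewrite le_eqVlt => /predU1P[<-|d0]; [right|left; rewrite divr_gt0].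
have nle : Normc.normc (charsum k lam) <= n%:R.
  apply: (le_trans (normc_sum _ _ _)).
  by rewrite (eq_bigr (fun=> 1)) ?sumr_const// => C _; exact: normc_cis.
case: del4 => [d4|d0]; last by rewrite d0 expr0n mulr0 subr0.
have BA : B != A.
  by apply: contra_notN far => /eqP ->; exists 0; rewrite mulr0 subrr subr0 normr0.
have nE : n%:R = 2 + \sum_(C in D | (C != A) && (C != B)) 1 :> R.
  rewrite /n -sum1_card natr_sum (bigD1 A)//= (bigD1 B)/= ?BD//.
  rewrite addrA; congr (_ + _); apply: eq_bigl => C; by rewrite andbA.
rewrite /charsum (bigD1 A)//= (bigD1 B)/= ?BD// addrA nE.
apply: (le_trans (le_normcD _ _)).
rewrite addrAC; apply: lerD.
  by rewrite e in far; exact: normc_cisD2.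
apply: (le_trans (normc_sum _ _ _)).
rewrite (eq_bigl (fun C => (C \in D) && ((C != A) && (C != B)))); last by move=> C; rewrite andbA.
by apply: ler_sum => C _; rewrite normc_cis.
Qed.

Lemma normc_charsumX_le t (A B : {set 'I_v.+2}) : A \in D -> B \in D ->
  ~ near_2pi (phase lam A - phase lam B) (del / 4) ->
  Normc.normc (charsum k lam ^+ t) <= n%:R ^+ t * expR (- (n%:R^-1 * (11 / 768) * t%:R * del ^+ 2)).
Proof.
move=> AD BD far; have h := normc_charsum_le AD BD far.
have n0 : 0 < n%:R :> R by rewrite ltr0n; apply/card_gt0P; exists A.
rewrite normcX (_ : expR _ = expR (- (n%:R^-1 * (11 / 768) * del ^+ 2)) ^+ t); last first.
  by rewrite -expRM_natl; congr expR; ring.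
rewrite -exprMn; apply: lerXn2r; rewrite ?nnegrE.
- by case: charsum => p q /=; exact: sqrtr_ge0.
- by rewrite mulr_ge0 ?expR_ge0// ltW.
apply: (le_trans h).
apply: (@le_trans _ _ (n%:R * (1 - n%:R^-1 * (11 / 768) * del ^+ 2))).
  by rewrite mulrBr mulr1 !mulrA mulfV ?gt_eqF// mul1r.
by rewrite ler_pM2l// expR_ge1Dx.
Qed.

End OffPeak.

(** * The local limit estimate *)

Section TorusSum.
Variables (R : realType) (v k t L r N M : nat) (del : R).
Hypothesis hvk : (k.+2 <= v)%N.
Hypothesis hL : (L * (v.+2 * v.+1) = t * (k.+2 * k.+1))%N.
Hypothesis hr : (r * v.+2 = t * k.+2)%N.
Hypothesis hN : N.+2 = (k.+1 * M)%N.
Hypothesis tN : (t < N.+2)%N.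
Hypothesis del01 : 0 < del <= 1.
Hypothesis del_small : 2 * del <= 2 * pi / k.+1%:R.
Let d := 'C(v.+2, 2).
Let D := draws v k.
Let n := #|D|.
Let h : R := 2 * pi / N.+2%:R.
Let J := {ffun 'I_d.-1 -> 'I_N.+2}.
Let Pk := {ffun 'I_v.+2 -> 'I_k.+1}.
Implicit Types (j : J) (p : Pk).

Definition angle j (a : 'I_d.-1) : R := mesh_point h j a 0.

Let angleE j a : angle j a = h * (cent (j a))%:~R.
Proof. by rewrite /angle mxE. Qed.

Definition bridges : {set {ffun 'I_t -> {set 'I_v.+2}}} :=
  [set F in walks v k t | [forall b, visits F b == L]]%SET.

Let m0 : 0 < N.+2%:R :> R. Proof. by []. Qed.
Let hm : h * N.+2%:R = 2 * pi. Proof. by rewrite divfK// gt_eqF. Qed.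

Let L_le : (L <= t)%N.
Proof.
have : (L * (v.+2 * v.+1) <= t * (v.+2 * v.+1))%N.
  by rewrite hL leq_mul2l leq_mul ?orbT//; lia.
by rewrite leq_pmul2r.
Qed.

Let visits_le (F : {ffun 'I_t -> {set 'I_v.+2}}) b : (visits F b <= t)%N.
Proof.
rewrite -[X in (_ <= X)%N](card_ord t) -sum1_card; apply: leq_sum => s _.
by case: (_ \subset _).
Qed.

Lemma bridges_fourier : \sum_(j : J) charsum k (angle j) ^+ t =
  (#|bridges|%:R * N.+2%:R ^+ d.-1 : R)%:C%C.
Proof.
under eq_bigr do rewrite (charsumX hL).
rewrite exchange_big /=.
have sumF F : F \in walks v k t -> \sum_(j : J) cis (\sum_a angle j a *
      ((visits F (widen_ord (leq_pred d) a))%:Z - L%:Z)%:~R) =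
    if F \in bridges then (N.+2%:R ^+ d.-1 : R[i]) else 0.
  move=> hF.
  pose z a : int := (visits F (widen_ord (leq_pred d) a))%:Z - L%:Z.
  rewrite (eq_bigr (fun j : J =>
      \prod_a cis (2 * pi / N.+2%:R * (cent (j a))%:~R * (z a)%:~R))); last first.
    by move=> j _; rewrite cis_sum; apply: eq_bigr => a _; rewrite angleE.
  rewrite -(bigA_distr_bigA (fun a x => cis (2 * pi / N.+2%:R * (cent x)%:~R * (z a)%:~R))) /=.
  under eq_bigr do rewrite sum_character.
  (* Both counts lie between 0 and t, and t is below the modulus. *)
  have z_dvd a : (N.+2 %| z a)%Z = (visits F (widen_ord (leq_pred d) a) == L).
    have := visits_le F (widen_ord (leq_pred d) a); have := L_le; have := tN; rewrite /z.
    move: (visits F _) => V; move=> h1 h2 h3; apply/idP/eqP => [/dvdzP[q]|->].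
      have [->|q0] := eqVneq q 0; first by lia.
      by nia.
    by rewrite subrr dvdz0.
  rewrite inE hF /=; case: forallP => [all_eq|nall].
    by rewrite (eq_bigr (fun=> N.+2%:R)) ?prodr_const ?card_ord// => a _; rewrite z_dvd all_eq.
  have [a na|all_a] := pickP (fun a : 'I_d.-1 => visits F (widen_ord (leq_pred d) a) != L).
    by rewrite (bigD1 a)//= z_dvd (negPf na) mul0r.
  case: nall => b; apply/eqP; apply: (visits_last hL hF) => a.
  by apply/eqP; have := all_a a => /negbFE.
rewrite (eq_bigr _ sumF) -big_mkcondr /=.
rewrite (eq_bigl (fun F => F \in bridges)) => [|F]; last first.
  by rewrite andb_idl// inE => /andP[].
by rewrite sumr_const rmorphM rmorphXn !rmorph_nat mulr_natl.
Qed.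

(** M mesh steps make the angle 2 pi / (k.+1), so the peaks are mesh points. *)
Let peak (p : Pk) : J := [ffun a => let: (i, l) := lex_pair (widen_ord (leq_pred d) a) in
  (M%:Z * ((p i)%:Z + (p l)%:Z - (p (inord v))%:Z))%:~R].

Let peaks : {set Pk} := [set p : Pk | p ord_max == ord0]%SET.

Let angle_peak p j a : exists e : int, angle (j + peak p) a =
  let: (i, l) := lex_pair (widen_ord (leq_pred d) a) in
  angle j a + 2 * pi * ((p i)%:Z + (p l)%:Z - (p (inord v))%:Z)%:~R / k.+1%:R + 2 * pi * e%:~R.
Proof.
rewrite !angleE !ffunE; case: lex_pair => i l.
move: ((p i)%:Z + (p l)%:Z - (p (inord v))%:Z) => z.
have [e ->] := cent_add (j a) (M%:Z * z); exists e.
have hM : 2 * pi / k.+1%:R = h * M%:R.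
  have M0 : M%:R != 0 :> R by rewrite pnatr_eq0; have := hN; case: (M) => //; rewrite muln0.
  have K0 : k.+1%:R != 0 :> R by rewrite pnatr_eq0.
  apply: (mulIf K0); rewrite divfK// -hm hN natrM; ring.
rewrite [2 * pi * z%:~R / _]mulrAC hM -hm !intrD !intrM -!pmulrn; ring.
Qed.

Let Phi j : R[i] := charsum k (angle j) ^+ t.

Let Phi_peak p j : p \in peaks -> Phi (j + peak p) = Phi j.
Proof.
rewrite inE => /eqP p0.
have /fin_all_exists[e he] := angle_peak p j.
pose mid a := angle (j + peak p) a - 2 * pi * (e a)%:~R.
rewrite /Phi (charsumX_period hL (lam := mid) (mu := angle (j + peak p)) (u := e)); last first.
  by move=> a; rewrite subrK.
apply: (charsumX_peak hL hr (p := fun i => (p i)%:Z)); last by rewrite p0.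
by move=> a; rewrite /mid he; case: lex_pair => i l; rewrite addrK.
Qed.

Definition in_box j := [forall a, `|angle j a| < del].

Let in_boxP j : reflect (forall a, near_2pi (angle j a) del) (in_box j).
Proof.
apply: (iffP forallP) => hj a; first by exists 0; rewrite mulr0 subr0.
have [u hu] := hj a.
have p3 : 1 < pi :> R by apply: lt_le_trans (pi_ge2 R); rewrite ltr1n.
have a_pi : `|angle j a| <= pi.
  have h0 : 0 < h by rewrite divr_gt0// mulr_gt0// pi_gt0.
  have := cent_le (j a); rewrite -(ler_int R) intrM intr_norm -(ler_pM2l h0) -pmulrn hm.
  by rewrite angleE normrM (gtr0_norm h0) mulrA; lra.
(* The angles are at most pi in absolute value, hence at least pi > del away from a nonzero multiple
   of 2 pi. *)
have [u0|u0] := eqVneq u 0; first by move: hu; rewrite u0 mulr0 subr0.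
have u1 : 1 <= `|u%:~R| :> R by rewrite -intr_norm -[1]/(1%:~R) ler_int; lia.
have n1 := lerB_dist (2 * pi * u%:~R) (angle j a).
rewrite distrC in n1; rewrite normrM in n1.
have p20 : 0 < 2 * pi :> R by rewrite mulr_gt0// pi_gt0.
rewrite (gtr0_norm p20) in n1.
have n2 : 2 * pi <= 2 * pi * `|u%:~R| :> R by rewrite ler_peMr// ltW.
case/andP: del01 => _ d1; exfalso.
have : 2 * pi - pi < del by apply: le_lt_trans hu; apply: le_trans n1; lra.
by lra.
Qed.

Let box_peak p j : reflect (forall a, let: (i, l) := lex_pair (widen_ord (leq_pred d) a) in
    near_frac k (angle j a) ((p i)%:Z + (p l)%:Z - (p (inord v))%:Z) del)
  (in_box (j - peak p)).
Proof.
have E a : near_2pi (angle (j - peak p) a) del <-> let: (i, l) := lex_pair (widen_ord (leq_pred d) a) in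
    near_frac k (angle j a) ((p i)%:Z + (p l)%:Z - (p (inord v))%:Z) del.
  have [e] := angle_peak p (j - peak p) a; rewrite subrK; case: lex_pair => i l ->.
  by rewrite /near_frac addrAC addrK near_2pi_shift.
by apply: (iffP (in_boxP _)) => H a; apply/E; exact: H.
Qed.

(* The number of peaks whose box contains j. *)
Let W j : nat := (\sum_(p in peaks) in_box (j - peak p)%R)%N.

Let W_le1 j : (W j <= 1)%N.
Proof.
rewrite leqNgt; apply/negP => W2.
have [p /andP[pP pb]|none] := pickP (fun p => (p \in peaks) && in_box (j - peak p)); last first.
  by move: W2; rewrite /W big1// => p pP; have := none p; rewrite pP /= => ->.
move: W2; rewrite /W (bigD1 p)//= pb big1// => q /andP[qP qp].
apply/eqP; rewrite eqb0; apply: contra qp => qb; apply/eqP; apply/esym.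
move: pP qP; rewrite !inE => /eqP p0 /eqP q0.
case/andP: del01 => d0 _; apply: (peak_uniq hvk (lam := angle j) d0 del_small p0 q0) => a.
by move/box_peak: pb => /(_ a); move/box_peak: qb => /(_ a); case: lex_pair.
Qed.

Let err : R := expR (- (n%:R^-1 * (11 / 768) * t%:R * del ^+ 2)).

Let W0 j : W j = 0%N -> Normc.normc (Phi j) <= n%:R ^+ t * err.
Proof.
move=> Wj.
have [AB|] := pselect (exists A B, [/\ A \in D, B \in D &
    ~ near_2pi (phase (angle j) A - phase (angle j) B) (del / 4)]).
  have [A [B [AD BD far]]] := AB; case/andP: del01 => d0 d1.
  by apply: normc_charsumX_le AD BD far; rewrite (ltW d0).
move=> nAB; exfalso.
have near (A B : {set 'I_v.+2}) : #|A| = k.+2 -> #|B| = k.+2 ->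
      near_2pi (phase (angle j) A - phase (angle j) B) (del / 4).
  move=> cA cB; apply: contrapT => far; apply: nAB; exists A, B.
  by rewrite !inE cA cB.
case/andP: del01 => d0 _.
have [p [p0 hp]] := peak_exists hvk d0 near del_small.
have pP : p \in peaks by rewrite inE p0.
by move/eqP: Wj; rewrite /W (bigD1 p)//= (introT (box_peak p j) hp).
Qed.

Lemma card_peaks : #|peaks| = (k.+1 ^ v.+1)%N.
Proof.
pose f (q : {ffun 'I_v.+1 -> 'I_k.+1}) : Pk := [ffun i => oapp q ord0 (unlift ord_max i)].
have f_inj : injective f.
  move=> q q' e; apply/ffunP => i.
  by have := congr1 (fun g : Pk => g (lift ord_max i)) e; rewrite !ffunE liftK.
rewrite -[v.+1 in RHS]card_ord -[k.+1 in RHS]card_ord -card_ffun -(card_imset _ f_inj).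
apply: eq_card => p; rewrite inE; apply/eqP/imsetP => [p0|[q _ ->]]; last first.
  by rewrite ffunE unlift_none.
exists [ffun i => p (lift ord_max i)] => //; apply/ffunP => i; rewrite ffunE.
by case: unliftP => [l ->|->] /=; rewrite ?ffunE.
Qed.

Lemma bridges_box : `|#|bridges|%:R * N.+2%:R ^+ d.-1 -
    k.+1%:R ^+ v.+1 * \sum_(j | in_box j) complex.Re (charsum k (angle j) ^+ t)| <=
  N.+2%:R ^+ d.-1 * (n%:R ^+ t * err).
Proof.
have ReS (I : Type) (s : seq I) (P : pred I) (f : I -> R[i]) :
    complex.Re (\sum_(i <- s | P i) f i) = \sum_(i <- s | P i) complex.Re (f i).
  by apply: (big_morph (@complex.Re R)) => // [[? ?] [? ?]].
have := congr1 (@complex.Re R) bridges_fourier; rewrite ReS /= => <-.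
(* Translation by a peak carries the sum over the box at 0 to the sum over its own box. Adding over
   the peaks gives each j the weight [W j], which is 0 or 1; only points of weight 0 contribute to
   the difference. *)
have -> : k.+1%:R ^+ v.+1 * \sum_(j | in_box j) complex.Re (charsum k (angle j) ^+ t) =
    \sum_(j : J) (W j)%:R * complex.Re (Phi j).
  transitivity (\sum_(p in peaks) \sum_(j : J) (in_box (j - peak p))%:R * complex.Re (Phi j)).
    rewrite -natrX -card_peaks mulr_natl -sumr_const; apply: eq_bigr => p pP.
    rewrite [RHS](reindex_inj (addIr (peak p))) /= big_mkcond; apply: eq_bigr => j _.
    by rewrite addrK (Phi_peak _ pP); case: in_box; rewrite ?mul1r ?mul0r.
  rewrite exchange_big; apply: eq_bigr => j _ /=.
  by rewrite /W natr_sum mulr_suml.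
rewrite -sumrB; apply: (le_trans (ler_norm_sum _ _ _)).
have -> : N.+2%:R ^+ d.-1 * (n%:R ^+ t * err) = \sum_(j : J) (n%:R ^+ t * err).
  by rewrite sumr_const card_ffun !card_ord -natrX mulr_natl.
apply: ler_sum => j _; have := W_le1 j; rewrite leq_eqVlt ltnS leqn0 => /orP[/eqP ->|/eqP W00].
  by rewrite mul1r subrr normr0 mulr_ge0 ?expR_ge0// exprn_ge0.
rewrite W00 mul0r subr0; apply: le_trans (W0 W00).
by rewrite -/(Phi j); case: (Phi j) => a b /=; rewrite -sqrtr_sqr ler_wsqrtr// lerDl sqr_ge0.
Qed.

End TorusSum.

(** * Refining the mesh *)

Section Limit.
Variables (R : realType) (v k t L r : nat) (del : R).
Hypothesis hvk : (k.+2 <= v)%N.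
Hypothesis hL : (L * (v.+2 * v.+1) = t * (k.+2 * k.+1))%N.
Hypothesis hr : (r * v.+2 = t * k.+2)%N.
Hypothesis t0 : (0 < t)%N.
Let d := 'C(v.+2, 2).
Let n := #|draws v k|.
Hypothesis del0 : 0 < del.
Hypothesis eps1 : d%:R * del < 1.
Hypothesis del_small : 2 * del <= 2 * pi / k.+1%:R.
Variable P : 'M[R]_d.-1.
Hypothesis Psym : P^T = P.
Hypothesis uP : P \in unitmx.
Hypothesis hPM : P *m P = Mmx R v.+2 k.+2.
Variable E : R -> R.
Let c : R := t%:R / 2.
Hypothesis E0 : E 0 = 0.
Hypothesis E_itv : forall x y, 0 <= x -> x <= y ->
  gauss c y * (y - x) <= E y - E x <= gauss c x * (y - x).

Let eps := d%:R * del.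
Let err : R := expR (- (n%:R^-1 * (11 / 768) * t%:R * del ^+ 2)).
Let Uf : R := (1 + 4^-1 * eps ^+ 6) `^ (t%:R / 2) * (1 + 3^-1 * eps ^+ 4) ^+ t.
Let Lf : R := (1 + t%:R ^+ 2 * eps ^+ 6) `^ (- 2^-1) * (1 - 3^-1 * eps ^+ 4) ^+ t.
Let cnt : R := #|bridges v k t L|%:R.

Let c0 : 0 < c. Proof. by rewrite divr_gt0// ltr0n. Qed.
Let n0 : 0 < n%:R :> R. Proof. by rewrite ltr0n n_gt0. Qed.

Let del1 : 0 < del <= 1.
Proof.
rewrite del0 /=; apply: le_trans (ltW eps1); rewrite ler_peMl ?(ltW del0)//.
by rewrite ler1n bin_gt0.
Qed.

(** As P is symmetric with square M, the quadratic form of M is the squared length of P x, and the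
    Gaussian becomes a product over the coordinates of P x. *)
Let quad_gauss (x : 'cV[R]_d.-1) : expR (- (t%:R * (quad k (fun a => x a 0) / 2))) =
  \prod_i gauss c ((P *m x) i 0).
Proof.
have -> : quad k (fun a => x a 0) = \sum_i (P *m x) i 0 ^+ 2.
  rewrite /quad -hPM (_ : \col_a x a 0 = x); last by apply/colP => a; rewrite mxE.
  rewrite mulmxA -[in X in X *m P](Psym) -trmx_mul -mulmxA mxE.
  by apply: eq_bigr => i _; rewrite mxE expr2.
rewrite /gauss -expR_sum sumrN -mulr_sumr /c; congr expR; ring.
Qed.

Let good_modulus (h0 : R) : 0 < h0 -> exists N M, [/\ N.+2 = (k.+1 * M)%N, (t < N.+2)%N &
  0 < (2 * pi / N.+2%:R : R) < h0].
Proof.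
move=> h00; pose M := (t + Num.truncn (2 * pi / h0)).+2.
exists (k.+1 * M).-2, M.
have e : (k.+1 * M).-2.+2 = (k.+1 * M)%N by rewrite /M; lia.
have Mle : (M <= k.+1 * M)%N by rewrite leq_pmull.
split=> //; rewrite e.
  by apply: leq_trans Mle; rewrite /M; lia.
have M0 : 0 < (k.+1 * M)%:R :> R by rewrite ltr0n; lia.
rewrite divr_gt0 ?mulr_gt0 ?pi_gt0//= ltr_pdivrMr// -ltr_pdivrMl// mulrC.
apply: (@lt_le_trans _ _ M%:R); last by rewrite ler_nat.
have q0 : 0 <= 2 * pi / h0 by rewrite divr_ge0 ?mulr_ge0 ?pi_ge0// ltW.
have /andP[_ /lt_le_trans] := truncn_itv q0; apply.
by rewrite ler_nat /M ltnS leqW// leq_addl.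
Qed.

Let in_boxE N (j : {ffun 'I_d.-1 -> 'I_N.+2}) :
  in_box del j = [forall a, `|mesh_point (2 * pi / N.+2%:R : R) j a 0| < del].
Proof. by []. Qed.

Let mesh_pow N : (2 * pi / N.+2%:R : R) ^+ d.-1 = (2 * pi) ^+ d.-1 / N.+2%:R ^+ d.-1.
Proof. by rewrite expr_div_n. Qed.

(** P maps the box into the cube of radius D2 del, where the cutoff is 1; the cutoff falls to 0
    between D2 del and 2 D2 del, the radius that occurs in U. *)
Lemma bridges_upper D2 : 0 < D2 -> (forall x : 'cV[R]_d.-1, (forall i, `|x i 0| < del) ->
    forall i, `|(P *m x) i 0| <= D2 * del) ->
  cnt / n%:R ^+ t <= k.+1%:R ^+ v.+1 / (2 * pi) ^+ d.-1 * Uf *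
    ((2 * E (2 * D2 * del)) ^+ d.-1 / `|\det P|) + err.
Proof.
move=> D20 hD2.
set al := D2 * del; set be := 2 * D2 * del.
have al0 : 0 < al by rewrite mulr_gt0.
have albe : al < be by rewrite /be /al -mulrA; move: al0; rewrite /al; lra.
set A := k.+1%:R ^+ v.+1 / (2 * pi) ^+ d.-1 * Uf.
have A0 : 0 <= A.
  rewrite /A !mulr_ge0// ?exprn_ge0// ?invr_ge0 ?exprn_ge0 ?mulr_ge0 ?pi_ge0 ?powR_ge0//.
  have : 0 <= eps ^+ 4 by rewrite exprn_ge0// mulr_ge0// ltW.
  by lra.
set V := (2 * E be) ^+ d.-1 / `|\det P|.
apply/ler_addgt0Pr => e e0.
have e'0 : 0 < e / (A + 1) by rewrite divr_gt0// ltr_wpDl.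
have [h0 h00 H] := riemann_sum_gauss_trap c0 E0 E_itv (ltW al0) albe uP (2 * del) e'0.
have [N [M [hN tN hh]]] := good_modulus h00.
set h : R := 2 * pi / N.+2%:R in hh; have hp : 0 < h by case/andP: hh.
have m0 : 0 < N.+2%:R :> R by [].
have hm : h * N.+2%:R = 2 * pi by rewrite /h divfK// gt_eqF.
have [N' hN' /andP[_ HU]] := H h hh.
have := bridges_box hvk hL hr hN tN del1 del_small.
rewrite ler_norml => /andP[_]; rewrite -/cnt -/n -/err => B.
have mp : 0 < N.+2%:R ^+ d.-1 :> R by rewrite exprn_gt0.
have np : 0 < n%:R ^+ t :> R by rewrite exprn_gt0.
pose G (x : 'cV[R]_d.-1) := \prod_i gauss_trap c al be ((P *m x) i 0).
(* [F] keeps the sharp box, so its support fits into the torus of width 2 pi and it can be moved to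
   the modulus N'. Only there is it enlarged to [G]. *)
pose F (x : 'cV[R]_d.-1) := [forall a, `|x a 0| < del]%:R * G x.
have G0 x : 0 <= G x by apply: prodr_ge0 => i _; case/andP: (gauss_trap_itv c0 al be ((P *m x) i 0)).
have suppF : supported_in del F.
  move=> x [a ha]; rewrite /F (_ : [forall a, _] = false) ?mul0r//.
  by apply/negbTE; rewrite negb_forall; apply/existsP; exists a; rewrite -leNgt ltW.
have d2pi : 2 * del < h * N.+2%:R.
  by rewrite hm; have := pi_ge2 R; case/andP: del1 => _; lra.
have RF : riemann_sum h N F <= V + e / (A + 1).
  rewrite (riemann_sum_eq hp suppF d2pi hN'); apply: le_trans HU.
  rewrite ler_pM2l ?exprn_gt0//; apply: ler_sum => j _; rewrite /F.
  by case: [forall _, _]; rewrite ?mul1r ?mul0r// G0.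
have SF : \sum_(j : {ffun 'I_d.-1 -> 'I_N.+2} | in_box del j) complex.Re (charsum k (angle R j) ^+ t) <=
    n%:R ^+ t * Uf * (riemann_sum h N F / h ^+ d.-1).
  rewrite /riemann_sum [X in _ * X]mulrAC mulfV ?gt_eqF ?exprn_gt0// mul1r mulr_sumr big_mkcond.
  apply: ler_sum => j _; rewrite /F in_boxE -/h; case: ifP => bj; last by rewrite mul0r mulr0.
  have bj' a : `|angle R j a| < del by move/forallP: bj; apply.
  have EG : expR (- (t%:R * (quad k (angle R j) / 2))) = G (mesh_point h j).
    apply: (etrans (quad_gauss (mesh_point h j))); apply: eq_bigr => i _.
    by rewrite gauss_trap_in//; exact: (hD2 (mesh_point h j) bj').
  rewrite mul1r -[leRHS]mulrA -EG.
  exact: (Re_charsum_le hvk del0 (fun a => ltW (bj' a)) eps1 t).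
rewrite ler_pdivrMr//.
have K0 : 0 <= k.+1%:R ^+ v.+1 :> R by rewrite exprn_ge0.
have B2 := ler_wpM2l K0 SF.
rewrite -(ler_pM2r mp).
have Uf0 : 0 <= Uf.
  rewrite /Uf mulr_ge0 ?powR_ge0// exprn_ge0//.
  have : 0 <= eps ^+ 4 by rewrite exprn_ge0// mulr_ge0// ltW.
  by lra.
have hE : h ^+ d.-1 = (2 * pi) ^+ d.-1 / N.+2%:R ^+ d.-1 by exact: mesh_pow.
have B3 : k.+1%:R ^+ v.+1 * (n%:R ^+ t * Uf * (riemann_sum h N F / h ^+ d.-1)) =
    A * riemann_sum h N F * n%:R ^+ t * N.+2%:R ^+ d.-1.
  rewrite hE /A invfM invrK; ring.
have B4 : A * riemann_sum h N F <= A * V + e.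
  apply: (le_trans (ler_wpM2l A0 RF)); rewrite mulrDr lerD2l mulrCA ler_piMr ?(ltW e0)//.
  by rewrite ler_pdivrMr ?mul1r ?lerDl// ltr_wpDl.
have B5 := ler_wpM2r (ltW mp) (ler_wpM2r (ltW np) B4).
rewrite B3 in B2; rewrite -/A -/V; lra.
Qed.

(** Here the cutoff vanishes from D1 del on, so that its support already lies in the box; it equals
    1 up to some [al] so close to D1 del that the loss of volume is negligible. *)
Lemma bridges_lower D1 : 0 < D1 -> (forall x : 'cV[R]_d.-1, (forall i, `|(P *m x) i 0| <= D1 * del) ->
    forall i, `|x i 0| < del) -> t%:R * eps ^+ 3 < 2 ->
  k.+1%:R ^+ v.+1 / (2 * pi) ^+ d.-1 * Lf *
    ((2 * E (D1 * del)) ^+ d.-1 / `|\det P|) - err <= cnt / n%:R ^+ t.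
Proof.
move=> D10 hD1 te.
set be := D1 * del; have be0 : 0 < be by rewrite mulr_gt0.
set A := k.+1%:R ^+ v.+1 / (2 * pi) ^+ d.-1 * Lf.
have e40 : 0 <= eps ^+ 4 by rewrite exprn_ge0// mulr_ge0// ltW.
have e41 : eps ^+ 4 <= 1 by rewrite exprn_ile1// ?mulr_ge0 ?(ltW del0) ?(ltW eps1).
have Lf0 : 0 <= Lf by rewrite /Lf mulr_ge0 ?powR_ge0// exprn_ge0//; lra.
have A0 : 0 <= A.
  by rewrite /A mulr_ge0// divr_ge0// exprn_ge0// mulr_ge0// pi_ge0.
set V := (2 * E be) ^+ d.-1 / `|\det P|.
apply/ler_addgt0Pr => e e0.
have dP0 : 0 < `|\det P| by rewrite normr_gt0 -unitfE -unitmxE.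
have e'0 : 0 < e / (2 * (A + 1)) by rewrite divr_gt0// mulr_gt0// ltr_wpDl.
have Em (x y : R) : 0 <= x -> x <= y -> E x <= E y by move=> x0 xy; exact: (E_mono E_itv x0 xy).
have Ebe0 : 0 <= E be by rewrite -E0; apply: Em => //; exact: ltW.
have [al [al0 albe Val]] : exists al, [/\ 0 <= al, al < be &
    V - e / (2 * (A + 1)) <= (2 * E al) ^+ d.-1 / `|\det P|].
  pose K := 2 * E be + 1; have K1 : 1 <= K by rewrite /K; lra.
  pose T := K ^+ d.-1 * (d.-1%:R * 2) + 1.
  have T0 : 0 < T by rewrite ltr_wpDl// mulr_ge0 ?exprn_ge0 ?mulr_ge0// (le_trans _ K1).
  (* On a ramp of width s the primitive E loses at most s, and the power of 2 E at most s T; the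
     minimum with be / 2 keeps [al] nonnegative. *)
  pose s := Num.min (be / 2) (e / (2 * (A + 1)) * `|\det P| / T).
  have s0 : 0 < s by rewrite lt_min divr_gt0//= divr_gt0// mulr_gt0.
  have sbe : s <= be / 2 by rewrite ge_min lexx.
  have sT : s * T <= e / (2 * (A + 1)) * `|\det P| by rewrite -ler_pdivlMr// ge_min lexx orbT.
  have als : 0 <= be - s by lra.
  exists (be - s); split; [exact: als|lra|].
  rewrite ler_pdivlMr// mulrBl divfK ?gt_eqF//.
  have le1 : E (be - s) <= E be by apply: Em => //; lra.
  have E10 : 0 <= E (be - s) by rewrite -E0; apply: Em.
  have /andP[_ E2] : gauss c be * (be - (be - s)) <= E be - E (be - s) <= gauss c (be - s) * (be - (be - s)).
    by apply: E_itv => //; lra.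
  have E3 : E be - E (be - s) <= s.
    by apply: (le_trans E2); rewrite subKr ler_piMl ?(ltW s0)// gauss_le1.
  have := @prod_shift_close R d.-1 (fun=> 2 * E be) (fun=> 2 * E (be - s)) K K1 _ _ (2 * s) _.
  rewrite !prodr_const !card_ord => HH.
  have {HH} : `|(2 * E be) ^+ d.-1 - (2 * E (be - s)) ^+ d.-1| <= K ^+ d.-1 * (d.-1%:R * (2 * s)).
    by apply: HH => i; rewrite ger0_norm /K; lra.
  rewrite ler_norml => /andP[_ HH].
  have : K ^+ d.-1 * (d.-1%:R * (2 * s)) <= s * T by rewrite /T; lra.
  lra.
have [h0 h00 H] := riemann_sum_gauss_trap c0 E0 E_itv al0 albe uP (2 * del) e'0.
have [N [M [hN tN hh]]] := good_modulus h00.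
set h : R := 2 * pi / N.+2%:R in hh; have hp : 0 < h by case/andP: hh.
have m0 : 0 < N.+2%:R :> R by [].
have hm : h * N.+2%:R = 2 * pi by rewrite /h divfK// gt_eqF.
have [N' hN' /andP[HL _]] := H h hh.
have := bridges_box hvk hL hr hN tN del1 del_small.
rewrite ler_norml => /andP[+ _]; rewrite -/cnt -/n -/err => B.
have mp : 0 < N.+2%:R ^+ d.-1 :> R by rewrite exprn_gt0.
have np : 0 < n%:R ^+ t :> R by rewrite exprn_gt0.
pose G (x : 'cV[R]_d.-1) := \prod_i gauss_trap c al be ((P *m x) i 0).
have Gout (x : 'cV[R]_d.-1) : (exists i, be <= `|(P *m x) i 0|) -> G x = 0.
  by move=> [i hi]; rewrite /G (bigD1 i)//= gauss_trap_out ?mul0r.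
have Gbox (x : 'cV[R]_d.-1) a : del <= `|x a 0| -> G x = 0.
  move=> xa; apply: Gout.
  have [i hi|all_i] := pickP (fun i => be <= `|(P *m x) i 0|); first by exists i.
  have hx i : `|(P *m x) i 0| <= D1 * del by rewrite ltW// ltNge all_i.
  by have := hD1 x hx a; rewrite ltNge xa.
have suppG : supported_in del G by move=> x [a /ltW]; exact: Gbox.
have d2pi : 2 * del < h * N.+2%:R.
  by rewrite hm; have := pi_ge2 R; case/andP: del1 => _; lra.
have RG : V - e / (A + 1) <= riemann_sum h N G.
  rewrite (riemann_sum_eq hp suppG d2pi hN'); apply: le_trans HL.
  have -> : e / (A + 1) = e / (2 * (A + 1)) + e / (2 * (A + 1)).
    by field; rewrite gt_eqF// ltr_wpDl.
  by lra.
have SG : n%:R ^+ t * Lf * (riemann_sum h N G / h ^+ d.-1) <=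
    \sum_(j : {ffun 'I_d.-1 -> 'I_N.+2} | in_box del j) complex.Re (charsum k (angle R j) ^+ t).
  rewrite /riemann_sum [X in _ * X]mulrAC mulfV ?gt_eqF ?exprn_gt0// mul1r mulr_sumr [leRHS]big_mkcond.
  apply: ler_sum => j _; rewrite in_boxE -/h; case: ifPn => bj; last first.
    move: bj; rewrite negb_forall => /existsP[a]; rewrite -leNgt => /Gbox ->.
    by rewrite mulr0.
  have bj' a : `|angle R j a| < del by move/forallP: bj; apply.
  apply: le_trans (Re_charsum_ge hvk del0 (fun a => ltW (bj' a)) eps1 te).
  rewrite -[leLHS]mulrA ler_pM2l ?exprn_gt0// ler_wpM2l//.
  apply: (@le_trans _ _ (\prod_i gauss c ((P *m mesh_point h j) i 0))); last first.
    by rewrite -quad_gauss.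
  apply: ler_prod => i _; rewrite gauss_trap_le// andbT.
  by case/andP: (gauss_trap_itv c0 al be ((P *m mesh_point h j) i 0)).
have K0 : 0 <= k.+1%:R ^+ v.+1 :> R by rewrite exprn_ge0.
have B2 := ler_wpM2l K0 SG.
have hE : h ^+ d.-1 = (2 * pi) ^+ d.-1 / N.+2%:R ^+ d.-1 by exact: mesh_pow.
have B3 : k.+1%:R ^+ v.+1 * (n%:R ^+ t * Lf * (riemann_sum h N G / h ^+ d.-1)) =
    A * riemann_sum h N G * n%:R ^+ t * N.+2%:R ^+ d.-1.
  by rewrite hE /A invfM invrK; ring.
have B4 : A * V - e <= A * riemann_sum h N G.
  apply: le_trans (ler_wpM2l A0 RG); rewrite mulrBr lerD2l lerN2 mulrCA ler_piMr ?(ltW e0)//.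
  by rewrite ler_pdivrMr ?mul1r ?lerDl// ltr_wpDl.
have B5 := ler_wpM2r (ltW mp) (ler_wpM2r (ltW np) B4).
have B6 : cnt / n%:R ^+ t * n%:R ^+ t = cnt by rewrite divfK// gt_eqF.
suff : (A * V - e - err) * n%:R ^+ t <= cnt.
  by rewrite -ler_pdivlMr//; lra.
rewrite -(ler_pM2r mp); rewrite B3 in B2; lra.
Qed.

End Limit.

(** * From the probability to the number of returning walks *)

Section Walks.
Variables (R : realType) (v k : nat).
Implicit Types (A : {set 'I_v.+2}) (y : 'cV[R]_v.+2).

Definition indic A : 'cV[R]_v.+2 := \col_i (i \in A)%:R.

Lemma indic_inj : injective indic.
Proof.
move=> A B e; apply/setP => i; have := congr1 (fun y : 'cV[R]_v.+2 => y i 0) e.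
rewrite !mxE; case: (i \in A) (i \in B) => [] [] //= /eqP; rewrite ?oner_eq0//.
by rewrite eq_sym oner_eq0.
Qed.

Lemma kvectors_indic y : kvectors R v.+2 k.+2 y -> exists2 A, A \in draws v k & y = indic A.
Proof.
move=> [y01 cy]; exists [set i : 'I_v.+2 | y i 0 == 1]%SET; first by rewrite inE cy.
apply/colP => i; rewrite mxE inE; have [->|->] := y01 i; last by rewrite eqxx.
by rewrite eq_sym oner_eq0.
Qed.

Lemma indic_kvectors A : A \in draws v k -> kvectors R v.+2 k.+2 (indic A).
Proof.
rewrite inE => /eqP cA; split=> [i|].
  by rewrite mxE; case: (i \in A); [right|left].
rewrite -cA; apply: eq_card => i; rewrite inE mxE.
by case: (i \in A); rewrite ?eqxx// eq_sym oner_eq0.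
Qed.

Lemma card_kvectors : #|` fset_set (kvectors R v.+2 k.+2)|%fset = #|draws v k|.
Proof.
have fin : finite_set (kvectors R v.+2 k.+2).
  apply: (@sub_finite_set _ _ (indic @` setT)).
    by move=> y /kvectors_indic[A _ ->]; exists A.
  by apply: finite_image; exact: finite_finset.
have /perm_size : perm_eq (fset_set (kvectors R v.+2 k.+2)) [seq indic A | A <- enum (draws v k)].
  apply: uniq_perm; first exact: fset_uniq.
    by rewrite map_inj_uniq ?enum_uniq//; exact: indic_inj.
  move=> y; rewrite in_fset_set//; apply/idP/mapP => [|[A AD ->]].
    move/set_mem/kvectors_indic => [A AD ->]; exists A => //.
    by rewrite mem_enum.
  by apply/mem_set; apply: indic_kvectors; rewrite mem_enum in AD.
by rewrite size_map -cardE.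
Qed.

Lemma Zmap_indic A a : Zmap (indic A) a 0 = (edge a \subset A)%:R.
Proof.
rewrite !mxE -natrM mulnb; congr (_%:R); congr (nat_of_bool _).
by rewrite /edge finset.subUset !finset.sub1set.
Qed.

Variables (disp : measure_display) (T : measurableType disp) (Pr : probability T R).
Variable xi : nat -> T -> 'cV[R]_v.+2.
Hypothesis hxi : iid_uniform Pr (kvectors R v.+2 k.+2) xi.
Variable t : nat.
Let W := {ffun 'I_t -> {set 'I_v.+2}}.
Let n := #|draws v k|.
Let lam : R := (k.+2%:R * (k.+2%:R - 1)) / (v.+2%:R * (v.+2%:R - 1)).

Let path_event (F : W) : set T := [set w | forall s : 'I_t, xi s w = indic (F s)].

Lemma walk_path F w a : path_event F w ->
  walk k.+2 xi t w a 0 = (visits F a)%:R - t%:R * lam.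
Proof.
move=> hF; rewrite /walk summxE (eq_bigr (fun s => (edge a \subset F s)%:R - lam)).
  by rewrite sumrB sumr_const card_ord /visits natr_sum mulr_natl.
by move=> s _; rewrite hF mxE Zmap_indic mxE mxE.
Qed.

Lemma path_of w : exists2 F : W, F \in walks v k t & path_event F w.
Proof.
have [h1 _ _ _] := hxi.
have /fin_all_exists[F hF] : forall s : 'I_t, exists A, A \in draws v k /\ xi s w = indic A.
  by move=> s; have [A AD e] := kvectors_indic (h1 s w); exists A.
exists [ffun s => F s] => [|s]; last by rewrite ffunE; case: (hF s).
by rewrite inE; apply/forallP => s; rewrite ffunE; case: (hF s).
Qed.

Lemma walk_eq0 F w : path_event F w ->
  walk k.+2 xi t w = 0 <-> forall a, (visits F a)%:R = t%:R * lam.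
Proof.
move=> hF; split=> [w0 a|h].
  have := walk_path a hF; rewrite w0 mxE => /esym/eqP.
  by rewrite subr_eq0 => /eqP.
by apply/colP => a; rewrite (walk_path a hF) h mxE subrr.
Qed.

Let J : {fset nat} := [fset s in iota 0 t]%fset.

Let memJ s : (s \in J) = (s < t)%N.
Proof. by rewrite in_fsetE /= mem_iota. Qed.

(** [A0] is a default value for indices beyond the walk, which do not occur in [J]. *)
Let path_eventE (F : W) (A0 : {set 'I_v.+2}) : path_event F =
  \bigcap_(s in [set` J]) (xi s @^-1` [set indic (if insub s is Some s' then F s' else A0)]).
Proof.
apply/seteqP; split=> w hw.
  move=> s /=; rewrite memJ => st.
  by rewrite insubT/= (hw (Sub s st)).
move=> s; have := hw s; rewrite /= memJ ltn_ord => /(_ isT).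
by rewrite (valK s).
Qed.

Lemma path_event_measurable F : measurable (path_event F).
Proof.
have [_ h2 _ _] := hxi; rewrite (path_eventE F finset.set0).
by apply: fin_bigcap_measurable => [|s _]; [exact: finite_fset|exact: h2].
Qed.

Lemma path_event_prob F : F \in walks v k t -> Pr (path_event F) = (n%:R^-1 ^+ t)%:E.
Proof.
move=> hF; have [_ _ h3 h4] := hxi; rewrite (path_eventE F finset.set0) h4.
rewrite (perm_big (iota 0 t)) /=; last first.
  apply: uniq_perm; rewrite ?fset_uniq ?iota_uniq//.
  by move=> s; rewrite memJ mem_iota.
rewrite -[X in iota _ X]subn0 -/(index_iota 0 t) big_mkord.
rewrite (eq_bigr (fun=> (n%:R^-1)%:E)) => [|s _].
  by rewrite prodEFin prodr_const card_ord.
rewrite h3 ?card_kvectors//; apply: indic_kvectors.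
by rewrite insubT// => st; rewrite inE; apply/eqP; exact: walksP hF.
Qed.

Lemma walk_prob L : t%:R * lam = L%:R ->
  Pr [set w | walk k.+2 xi t w = 0] = (#|bridges v k t L|%:R / n%:R ^+ t)%:E.
Proof.
move=> hL.
pose D : {fset W} := [fset F in enum (bridges v k t L)]%fset.
have DE F : (F \in D) = (F \in bridges v k t L) by rewrite in_fsetE /= mem_enum.
have -> : [set w | walk k.+2 xi t w = 0] = \big[setU/set0]_(F <- D) path_event F.
  rewrite -bigcup_fset; apply/seteqP; split=> w /=.
    have [F hF hw] := path_of w => w0; exists F => //=.
    rewrite DE inE hF /=; apply/forallP => a; rewrite -(eqr_nat R) -hL; apply/eqP.
    exact: (walk_eq0 hw).1 w0 a.
  move=> [F /=]; rewrite DE inE => /andP[hF /forallP hv] hw.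
  by apply/(walk_eq0 hw) => a; rewrite (eqP (hv a)) hL.
rewrite measure_fbigsetU; first last.
- move=> F G _ _ [w [hF hG]]; apply/ffunP => s; apply: indic_inj.
  by rewrite -(hF s) -(hG s).
- by move=> F _; exact: path_event_measurable.
rewrite (perm_big (enum (bridges v k t L))) /=; last first.
  apply: uniq_perm; rewrite ?fset_uniq ?enum_uniq//.
  by move=> F; rewrite DE mem_enum.
rewrite big_enum /= (eq_bigr (fun=> (n%:R^-1 ^+ t)%:E)) => [|F]; last first.
  by rewrite inE => /andP[hF _]; exact: path_event_prob.
by rewrite sumEFin sumr_const exprVn mulr_natl.
Qed.

Lemma walk_never0 : (forall F : W, F \in walks v k t -> ~ (forall a, (visits F a)%:R = t%:R * lam)) ->
  Pr [set w | walk k.+2 xi t w = 0] = 0%E.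
Proof.
move=> h; rewrite (_ : [set w | _] = set0) ?measure0//.
apply/seteqP; split=> // w /= w0; have [F hF hw] := path_of w.
by apply: (h F hF) => a; exact: (walk_eq0 hw).1 w0 a.
Qed.

End Walks.

(** * Normalization and conclusion *)

Lemma posdefmx_unitmx (R : realType) n (P : 'M[R]_n) : posdefmx P -> P \in unitmx.
Proof.
move=> [_ pos]; rewrite unitmxE unitfE; apply/negP => /det0P[x x0 xP].
have := pos x^T; rewrite trmxK xP mul0mx mxE ltxx => h.
suff : x^T != 0 by move/h.
by apply: contra_neq x0 => e; rewrite -[x]trmxK e trmx0.
Qed.

Lemma sqrtr_expn (R : rcfType) (x : R) m : 0 <= x -> Num.sqrt (x ^+ m) = Num.sqrt x ^+ m.
Proof.
by move=> x0; rewrite -{1}(sqr_sqrtr x0) exprAC sqrtr_sqr ger0_norm// exprn_ge0// sqrtr_ge0.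
Qed.

Lemma powR_half_nat (R : realType) (x : R) m : 0 <= x -> x `^ (m%:R / 2) = Num.sqrt x ^+ m.
Proof.
by move=> x0; rewrite (mulrC m%:R) powRrM powR12_sqrt// powR_mulrn ?sqrtr_ge0.
Qed.

(** The constants are distributed so that each one-dimensional integral e is divided by sqrt(2 pi /
    t), its value over the whole line; D * D is det M for D = det P. *)
Lemma gauss_volume_normalize (R : realType) m (t D : R) (e : R) : 0 < t ->
  ((2 * pi) ^+ m)^-1 * (e ^+ m / `|D|) =
  (e * Num.sqrt (t / (2 * pi))) ^+ m / Num.sqrt ((2 * pi * t) ^+ m * (D * D)).
Proof.
move=> t0; have p0 : 0 < 2 * pi :> R by rewrite mulr_gt0// pi_gt0.
have q0 : 0 <= 2 * pi * t by rewrite mulr_ge0// ltW.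
have -> : Num.sqrt ((2 * pi * t) ^+ m * (D * D)) = Num.sqrt (2 * pi * t) ^+ m * `|D|.
  by rewrite sqrtrM ?exprn_ge0// -expr2 sqrtr_sqr sqrtr_expn.
have s1 : Num.sqrt (t / (2 * pi)) ^+ m / Num.sqrt (2 * pi * t) ^+ m = ((2 * pi) ^+ m)^-1.
  have a0 : 0 < Num.sqrt (t / (2 * pi)) by rewrite sqrtr_gt0 divr_gt0.
  have -> : Num.sqrt (2 * pi * t) = 2 * pi * Num.sqrt (t / (2 * pi)).
    have -> : 2 * pi * t = (2 * pi) ^+ 2 * (t / (2 * pi)).
      by rewrite expr2 -[RHS]mulrA [X in _ = _ * X]mulrC divfK// gt_eqF.
    by rewrite sqrtrM ?sqr_ge0// sqrtr_sqr ger0_norm// ltW.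
  move: (Num.sqrt (t / (2 * pi))) a0 => a a0.
  by rewrite [X in _ / X]exprMn invfM mulrA [LHS]mulrAC mulfV ?mul1r// gt_eqF// exprn_gt0.
rewrite -s1; move: (Num.sqrt (t / (2 * pi))) (Num.sqrt (2 * pi * t)) => a b.
by rewrite exprMn invfM; ring.
Qed.

(** This turns the explicit bound on delta into disjointness of the boxes: x = 2 pi / (k-1) is at
    most 8, so x^4 <= 512 x, and 512 is far below half of 6 * 96^2. *)
Lemma double_radius_le (R : realType) (k n : nat) (delta : R) : (0 < n)%N ->
  delta < k.+2%:R ^- 2 * n%:R ^- 2 * ((6 * 96 ^+ 2)^-1 * (2 * pi / k.+1%:R) ^+ 4) ->
  2 * delta <= 2 * pi / k.+1%:R.
Proof.
move=> n0; have pi4 : pi <= 4 :> R by have := pihalf_lt2 R; lra.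
have : 0 < 2 * pi / k.+1%:R :> R by rewrite divr_gt0// mulr_gt0// pi_gt0.
have : 2 * pi / k.+1%:R <= 8 :> R.
  rewrite ler_pdivrMr//; apply: (@le_trans _ _ (8 * 1)); first by lra.
  by rewrite ler_pM2l// ler1n.
set x := 2 * pi / _ => x8 x0 hd.
have c1 : 1 <= n%:R ^+ 2 :> R by apply: exprn_ege1; rewrite ler1n.
have k1 : 1 <= k.+2%:R ^+ 2 :> R by apply: exprn_ege1; rewrite ler1n.
have f1 : k.+2%:R ^- 2 * n%:R ^- 2 <= 1 :> R.
  have kn1 := mulr_ege1 k1 c1.
  by rewrite -invfM invf_le1// (lt_le_trans ltr01).
have y0 : 0 <= (6 * 96 ^+ 2)^-1 * x ^+ 4.
  apply: mulr_ge0; last by rewrite exprn_ge0// ltW.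
  by rewrite invr_ge0 mulr_ge0// exprn_ge0.
have h2 : delta < (6 * 96 ^+ 2)^-1 * x ^+ 4.
  by apply: (lt_le_trans hd); rewrite ler_piMl.
have x3 : x ^+ 3 <= 8 ^+ 3 by rewrite lerXn2r// nnegrE// ltW.
have x4 : x ^+ 4 <= 512 * x.
  rewrite exprSr ler_pM2r//; apply: (le_trans x3); lra.
move: h2 x4; move: (x ^+ 4) => X; lra.
Qed.

Theorem theorem7p1 (R : realType) (v k : nat)
  (hk : (2 <= k)%N) (hvk : (k + 2 <= v)%N)
  (disp : measure_display) (T : measurableType disp) (Pr : probability T R)
  (xi : nat -> T -> 'cV[R]_v)
  (hxi : iid_uniform Pr (kvectors R v k) xi)
  (P : 'M[R]_(('C(v, 2)).-1))
  (hP : posdefmx P) (hPM : P *m P = Mmx R v k)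
  (D1 D2 : R) (hD1 : 0 < D1) (hD2 : 0 < D2)
  (hD : forall eta : R, 0 < eta ->
     cube (('C(v, 2)).-1) (D1 * eta)
       `<=` (mulmx P) @` open_cube (('C(v, 2)).-1) eta /\
     (mulmx P) @` open_cube (('C(v, 2)).-1) eta
       `<=` cube (('C(v, 2)).-1) (D2 * eta))
  (delta : R) (hdelta0 : 0 < delta)
  (hdelta : delta < k%:R ^- 2 * ('C(v, k))%:R ^- 2 *
     ((6 * 96 ^+ 2)^-1 * (2 * pi / (k%:R - 1)) ^+ 4))
  (t : nat) (ht2 : (2 <= t)%N)
  (ht : t%:R < 2 * (('C(v, 2))%:R * delta) ^- 3) :
  let lam : R := t%:R * (k%:R * (k%:R - 1) / (v%:R * (v%:R - 1))) in
  let r : R := t%:R * (k%:R / v%:R) in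
  let p00 : \bar R := Pr [set w | walk k xi t w = 0] in
  let err : R := expR (- (('C(v, k))%:R^-1 * (11 / 768) * t%:R * delta ^+ 2)) in
  let main : R := (k%:R - 1) ^+ v.-1 /
    Num.sqrt ((2 * pi * t%:R) ^+ (('C(v, 2)).-1) * \det (Mmx R v k)) in
  [/\ lam \isn't a Num.int -> p00 = 0%E,
      lam \is a Num.int -> r \isn't a Num.int -> (p00 <= err%:E)%E
    & lam \is a Num.int -> r \is a Num.int ->
      (p00 <= (main * upper_factor v t D2 delta + err)%:E)%E /\
      ((main * lower_factor v t D1 delta - err)%:E <= p00)%E].
Proof.
case: k hk hvk hxi hPM hdelta => [|[|k]] // hk hvk hxi hPM hdelta.
case: v hvk xi hxi P hP hPM hD hdelta ht => [|[|v]] hvk xi hxi P hP hPM hD hdelta ht; try by lia.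
have kv : (k.+2 <= v)%N by lia.
have Sk : k.+2%:R - 1 = k.+1%:R :> R by rewrite -(addn1 k.+1) natrD addrK.
have Sv : v.+2%:R - 1 = v.+1%:R :> R by rewrite -(addn1 v.+1) natrD addrK.
move=> lam r p00 err main.
set d := 'C(v.+2, 2) in P hP hPM hD ht p00 main *.
have d0 : (0 < d)%N by rewrite bin_gt0.
have V0 : v.+2%:R * v.+1%:R != 0 :> R by rewrite mulf_neq0// pnatr_eq0.
have hL_of (L : nat) : lam = L%:R -> (L * (v.+2 * v.+1) = t * (k.+2 * k.+1))%N.
  by move=> e; apply/eqP; rewrite -(eqr_nat R) !natrM -e /lam Sk Sv -[X in X == _]mulrA [X in _ * X == _]divfK.
split.
- move=> lamN; apply: (walk_never0 hxi) => F hF hv; move: lamN.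
  by rewrite /lam -(hv (Ordinal d0)) natr_int.
(* A returning walk would hit every point exactly r times. *)
- move=> _ rN; suff -> : p00 = 0%E by rewrite lee_fin expR_ge0.
  apply: (walk_never0 hxi) => F hF hv; move: rN.
  have hLL := hL_of (visits F (Ordinal d0)) (esym (hv _)).
  have hV b : visits F b = visits F (Ordinal d0) by apply/eqP; rewrite -(eqr_nat R) !hv.
  have := hits_eq hLL ord0 hF hV => /(congr1 (fun m => m%:R : R)) e.
  suff -> : r = (hits F ord0)%:R by rewrite natr_int.
  have v0 : v.+2%:R != 0 :> R by rewrite pnatr_eq0.
  by apply: (mulIf v0); rewrite /r -mulrA divfK// -!natrM.
move=> lamI rI.
have nat_of_int (x : R) : 0 <= x -> x \is a Num.int -> exists m : nat, x = m%:R.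
  move=> x0 /intrP[z ez]; exists `|z|%N; rewrite ez pmulrn gez0_abs//.
  by move: x0; rewrite ez ler0z.
have [L eL] : exists L : nat, lam = L%:R.
  by apply: nat_of_int lamI; rewrite /lam Sk Sv mulr_ge0// divr_ge0.
have [r' er] : exists r' : nat, r = r'%:R.
  by apply: nat_of_int rI; rewrite /r mulr_ge0// divr_ge0.
have hL := hL_of L eL.
have hr : (r' * v.+2 = t * k.+2)%N.
  apply/eqP; rewrite -(eqr_nat R) !natrM -er /r -mulrA divfK// pnatr_eq0//.
have t0 : (0 < t)%N by lia.
have tR : 0 < t%:R :> R by rewrite ltr0n.
have p00E : p00 = (#|bridges v k t L|%:R / #|draws v k|%:R ^+ t)%:E.
  by apply: (walk_prob hxi).
have eps0 : 0 < d%:R * delta by rewrite mulr_gt0// ltr0n.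
have te : t%:R * (d%:R * delta) ^+ 3 < 2.
  by rewrite -ltr_pdivlMr ?exprn_gt0.
(* Because t >= 2 and t (d delta)^3 < 2. *)
have eps1 : d%:R * delta < 1.
  have t2 : 2 <= t%:R :> R by rewrite (ler_nat R 2).
  have e3 : (d%:R * delta) ^+ 3 < 1.
    have : 0 < (d%:R * delta) ^+ 3 by rewrite exprn_gt0.
    by nra.
  by rewrite -(@expr_lt1 R 3)// ltW.
have del_small : 2 * delta <= 2 * pi / k.+1%:R.
  have cb : (0 < 'C(v.+2, k.+2))%N by rewrite bin_gt0; exact: leq_trans kv (leqW (leqnSn v)).
  by apply: (double_radius_le cb); rewrite -Sk.
have uP := posdefmx_unitmx hP.
have t2 : 0 < t%:R / 2 :> R by rewrite divr_gt0.
have [E [E0 E_itv E_bd]] := gauss_primitive t2.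
have [hDlo hDup] := hD _ hdelta0.
have hup (x : 'cV[R]_d.-1) : (forall i, `|x i 0| < delta) -> forall i, `|(P *m x) i 0| <= D2 * delta.
  move=> hx i; have := hDup (P *m x); rewrite /cube /= => h.
  rewrite ler_norml; apply: h; by exists x.
have hlo (x : 'cV[R]_d.-1) : (forall i, `|(P *m x) i 0| <= D1 * delta) -> forall i, `|x i 0| < delta.
  move=> hx; have [|y hy e] := hDlo (P *m x).
    by move=> i; rewrite -ler_norml.
  by rewrite -(mulKmx uP x) -e mulKmx.
have := bridges_upper kv hL hr t0 hdelta0 eps1 del_small hP.1 uP hPM E0 E_itv hD2 hup.
have := bridges_lower kv hL hr t0 hdelta0 eps1 del_small hP.1 uP hPM E0 E_itv hD1 hlo te.
rewrite p00E !lee_fin (card_draws_bin v k) -/err -/d.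
have dN : d%:R - 1 = d.-1%:R :> R by rewrite -[in LHS](prednK d0) -addn1 natrD addrK.
have mainE : main = k.+1%:R ^+ v.+1 / Num.sqrt ((2 * pi * t%:R) ^+ d.-1 * (\det P * \det P)).
  by rewrite /main Sk -hPM det_mulmx.
have p0 : 0 < 2 * pi :> R by rewrite mulr_gt0// pi_gt0.
have volume (b : R) : 0 <= b -> 0 <= E b.
  by move=> b0; rewrite -E0; exact: (E_mono E_itv).
have scale (b : R) : 0 <= b ->
    (2 * E b * Num.sqrt (t%:R / (2 * pi))) ^+ 2 = (2 * E b) ^+ 2 / (pi / (t%:R / 2)).
  move=> b0; rewrite exprMn sqr_sqrtr ?divr_ge0 ?(ltW p0) ?(ltW tR)//.
  have pn : pi != 0 :> R by rewrite gt_eqF// pi_gt0.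
  have tn : t%:R != 0 :> R by rewrite gt_eqF.
  by congr (_ * _); move: (pi : R) pn (t%:R : R) tn => p pn x xn; field; rewrite xn pn.
have c0 : 0 < pi / (t%:R / 2) :> R by rewrite divr_gt0 ?pi_gt0// divr_gt0.
move=> lower upper; split.
- apply: (le_trans upper); rewrite lerD2r mainE /upper_factor -/d.
  set b := 2 * D2 * delta; have b0 : 0 <= b by rewrite /b !mulr_ge0// ltW.
  set Y := 1 - expR (- (t%:R * b ^+ 2)).
  have Y0 : 0 <= Y by rewrite subr_ge0 -expR0 ler_expR oppr_le0 mulr_ge0 ?sqr_ge0 ?(ltW tR).
  rewrite dN (powR_half_nat _ Y0).
  set Uf := _ `^ _ * _ ^+ t.
  have Uf0 : 0 <= Uf by rewrite mulr_ge0 ?powR_ge0// exprn_ge0// addr_ge0// mulr_ge0// exprn_ge0// ltW.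
  have vol := gauss_volume_normalize d.-1 (\det P) (2 * E b) tR.
  (* The primitive is controlled through its square, so the comparison is made between squares. *)
  have le_vol : (2 * E b * Num.sqrt (t%:R / (2 * pi))) ^+ d.-1 <= Num.sqrt Y ^+ d.-1.
    have e0 : 0 <= 2 * E b * Num.sqrt (t%:R / (2 * pi)) by rewrite !mulr_ge0 ?sqrtr_ge0// volume.
    apply: lerXn2r; rewrite ?nnegrE ?sqrtr_ge0//.
    rewrite -(ger0_norm e0) -sqrtr_sqr ler_wsqrtr// scale// ler_pdivrMr// [leRHS]mulrC.
    have /andP[_] := E_bd b b0; rewrite (_ : 2 * (t%:R / 2 * b ^+ 2) = t%:R * b ^+ 2)//.
    by field.
  have K0 : 0 <= k.+1%:R ^+ v.+1 :> R by rewrite exprn_ge0.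
  rewrite [leLHS](_ : _ = k.+1%:R ^+ v.+1 * Uf *
    (((2 * pi) ^+ d.-1)^-1 * ((2 * E b) ^+ d.-1 / `|\det P|))); last by ring.
  rewrite vol [leRHS](_ : _ = k.+1%:R ^+ v.+1 * Uf *
    (Num.sqrt Y ^+ d.-1 / Num.sqrt ((2 * pi * t%:R) ^+ d.-1 * (\det P * \det P)))); last by ring.
  apply: ler_wpM2l; first by rewrite mulr_ge0.
  by apply: ler_wpM2r; rewrite // invr_ge0 sqrtr_ge0.
- apply: (le_trans _ lower); rewrite lerD2r mainE /lower_factor -/d.
  set b := D1 * delta; have b0 : 0 <= b by rewrite /b mulr_ge0// ltW.
  set Y := 1 - expR (- (2^-1 * t%:R * b ^+ 2)).
  have Y0 : 0 <= Y.
    by rewrite subr_ge0 -expR0 ler_expR oppr_le0 mulr_ge0 ?sqr_ge0// mulr_ge0.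
  rewrite dN (powR_half_nat _ Y0).
  set Lf := _ `^ _ * _ ^+ t.
  have e4 : (d%:R * delta) ^+ 4 <= 1 by rewrite exprn_ile1// ltW.
  have Lf0 : 0 <= Lf by rewrite mulr_ge0 ?powR_ge0// exprn_ge0//; lra.
  have vol := gauss_volume_normalize d.-1 (\det P) (2 * E b) tR.
  have le_vol : Num.sqrt Y ^+ d.-1 <= (2 * E b * Num.sqrt (t%:R / (2 * pi))) ^+ d.-1.
    have e0 : 0 <= 2 * E b * Num.sqrt (t%:R / (2 * pi)) by rewrite !mulr_ge0 ?sqrtr_ge0// volume.
    apply: lerXn2r; rewrite ?nnegrE ?sqrtr_ge0//.
    rewrite -[leRHS](ger0_norm e0) -sqrtr_sqr ler_wsqrtr// scale// ler_pdivlMr// [leLHS]mulrC.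
    have /andP[+ _] := E_bd b b0; rewrite (_ : t%:R / 2 * b ^+ 2 = 2^-1 * t%:R * b ^+ 2)//.
    by ring.
  have K0 : 0 <= k.+1%:R ^+ v.+1 :> R by rewrite exprn_ge0.
  rewrite [leRHS](_ : _ = k.+1%:R ^+ v.+1 * Lf *
    (((2 * pi) ^+ d.-1)^-1 * ((2 * E b) ^+ d.-1 / `|\det P|))); last by ring.
  rewrite vol [leLHS](_ : _ = k.+1%:R ^+ v.+1 * Lf *
    (Num.sqrt Y ^+ d.-1 / Num.sqrt ((2 * pi * t%:R) ^+ d.-1 * (\det P * \det P)))); last by ring.
  apply: ler_wpM2l; first by rewrite mulr_ge0.
  by apply: ler_wpM2r; rewrite // invr_ge0 sqrtr_ge0.
Qed.
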